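(* Let $d\ge 2$ and let $F_N\subset \mathbb{T}_N\times[-\frac N2,\frac N2]$, $N\ge 1$, be a sequence of sets such that $|F_N|\to\infty$ as $N\to\infty$. Then under $P$, $$\frac{C_{F_N}}{(N^d\log|F_N|)^2}\ \longrightarrow\ \zeta\Big(\frac{g(0)}{\sqrt{d+1}}\Big)\quad\text{in law, as }N\to\infty.$$
   Context: Fix an integer $d\ge2$. $\mathbb{T}_N=(\mathbb{Z}/N\mathbb{Z})^d$ is the discrete torus and $E_N=\mathbb{T}_N\times\mathbb{Z}$ the discrete cylinder (nearest-neighbour graph); intervals in the second coordinate mean the integers in them. $P$ (which depends on $N$) is the law of discrete time simple random walk $(X_n)_{n\ge0}$ on $E_N$ whose starting point is uniformly distributed on $\mathbb{T}_N\times\{0\}$. For $a\le b$, $X(a,b)=\{X_n: n\in[a,b]\}$. For a finite set $F\subset E_N$ the cover time is $C_F=\inf\{n\ge0: F\subset X(0,n)\}$. $g(x)=\sum_{n\ge0}P_x^{\mathbb{Z}^{d+1}}(X_n=0)$ is the Green function of simple random walk on $\mathbb{Z}^{d+1}$. For $u>0$, $\zeta(u)=\inf\{t\ge0:\hat L_t\ge u\}$, where $\hat L_t$ is the (continuous) local time at zero of a standard one-dimensional Brownian motion; its cumulative distribution function is $z\mapsto 1_{\{z>0\}}\sqrt{2/\pi}\int_{-\infty}^{-u/\sqrt z}e^{-x^2/2}\,dx$. *)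

(* Defs.v *)
From HB Require Import structures.
From mathcomp Require Import all_boot all_order all_algebra finmap.
From mathcomp Require Import all_classical all_reals all_analysis.

Set Implicit Arguments.
Unset Strict Implicit.
Unset Printing Implicit Defensive.

Import Order.TTheory GRing.Theory Num.Theory.
Import numFieldNormedType.Exports.

Local Open Scope classical_set_scope.
Local Open Scope ring_scope.

(* Random walk on an abelian group G whose steps are [st i], with i uniform in
   the finite type I. *)
Definition step_prob (R : realType) (G : zmodType) (I : finType) (st : I -> G)
    (x y : G) : R :=
  #|[set i | x + st i == y]%SET|%:R / #|I|%:R.

(* P_x(X_n = y), by conditioning on the first step. *)
Fixpoint walk_prob (R : realType) (G : zmodType) (I : finType) (st : I -> G)
    (n : nat) (x y : G) : R :=
  if n is m.+1 then (\sum_(i : I) walk_prob R st m (x + st i) y) / #|I|%:R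
  else (x == y)%:R.

(* X is such a walk under P, with initial law mu; stated through the
   finite-dimensional laws, which determine the law of the path because G is
   countable in all the uses below. *)
Definition is_walk (R : realType) (G : zmodType) (I : finType) (st : I -> G)
    (mu : G -> R) (dsp : measure_display) (Om : measurableType dsp)
    (P : probability Om R) (X : nat -> Om -> G) : Prop :=
  (forall (n : nat) (x : G), measurable (X n @^-1` [set x])) /\
  (forall (n : nat) (x : nat -> G),
     P [set w | forall i, (i <= n)%N -> X i w = x i] =
     (mu (x 0%N) * \prod_(i < n) step_prob R st (x i) (x i.+1))%:E).

(* The unit steps of Z^m: (k, b) is e_k if b = false, - e_k if b = true. *)
Definition lattice_step (m : nat) (i : 'I_m * bool) : 'rV[int]_m :=
  \row_j (if j == i.1 then (-1) ^+ i.2 else 0).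

(* g(x) = sum_n P_x(X_n = 0) for simple random walk on Z^m. *)
Definition green (R : realType) (m : nat) (x : 'rV[int]_m) : \bar R :=
  (\sum_(0 <= n <oo) (walk_prob R (@lattice_step m) n x 0)%:E)%E.

(* 'I_N.-1.+1 with its additive group structure is Z/NZ for every N >= 1
   (whereas 'Z_1 is Z/2Z). At N = 0 it is the trivial group. *)
Definition torus (d N : nat) : zmodType := 'rV['I_N.-1.+1]_d.

Definition cylinder (d N : nat) : zmodType := (torus d N * int)%type.

(* The 2(d+1) unit steps of the cylinder: direction [Some k] is the k-th torus
   coordinate, [None] the vertical one. For N >= 3 the endpoints of the steps
   from a point are its 2(d+1) distinct nearest neighbours. *)
Definition cylinder_step (d N : nat) (i : option 'I_d * bool) : cylinder d N :=
  let: (o, b) := i in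
  match o with
  | Some k => (\row_j (if j == k then (if b then - inZp 1 else inZp 1) else 0), 0)
  | None => (0, (-1) ^+ b)
  end.

(* The uniform distribution on T_N x {0}. *)
Definition unif_base (R : realType) (d N : nat) (x : cylinder d N) : R :=
  if x.2 == 0 then ((N.-1.+1 ^ d)%N%:R)^-1 else 0.

(* inf {n >= 0 : F \subset {X_0, ..., X_n}}, equal to +oo if F is never
   covered. *)
Definition cover_time (R : realType) (G : choiceType) (Om : Type)
    (X : nat -> Om -> G) (F : {fset G}) (w : Om) : \bar R :=
  ereal_inf [set (n%:R : R)%:E | n in
    [set n : nat | forall x, x \in F -> exists2 k, (k <= n)%N & X k w = x]].

Section brownian.
Context (R : realType) (dsp : measure_display) (Om : measurableType dsp)
  (P : probability Om R).

(* Standard Brownian motion indexed by [0, +oo[ (the values at negative times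
   are irrelevant). *)
Definition is_brownian (B : R -> {RV P >-> R}) : Prop :=
  [/\ forall w, B 0 w = 0,
      forall w, {within `[0, +oo[, continuous (fun t => B t w)},
      forall s t : R, 0 <= s -> s < t -> forall A : set R, measurable A ->
        P [set w | A (B t w - B s w)] = normal_prob 0 (Num.sqrt (t - s)) A &
      forall (n : nat) (t : nat -> R), 0 <= t 0%N ->
        (forall i, (i < n)%N -> t i <= t i.+1) ->
        forall A : nat -> set R, (forall i, measurable (A i)) ->
        P [set w | forall i, (i < n)%N -> A i (B (t i.+1) w - B (t i) w)] =
        (\prod_(i < n) P [set w | A i (B (t i.+1) w - B (t i) w)%R])%E].

(* L is the continuous local time of B at zero:
   L_t = lim_(eps -> 0+) |{s in [0, t] : |B_s| < eps}| / (2 eps)  a.s. *)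
Definition is_local_time0 (B L : R -> {RV P >-> R}) : Prop :=
  (forall w, {within `[0, +oo[, continuous (fun t => L t w)}) /\
  (forall t : R, 0 <= t -> {ae P, forall w,
     (fun eps : R => ((2 * eps)^-1)%:E *
        lebesgue_measure [set s : R | 0 <= s <= t /\ `|B s w| < eps]%R)%E @ 0^'+
     --> (L t w)%:E}).

(* zeta(u) = inf {t >= 0 : L_t >= u} *)
Definition inv_local_time (L : R -> {RV P >-> R}) (u : R) (w : Om) : \bar R :=
  ereal_inf [set t%:E | t in [set t : R | 0 <= t /\ u <= L t w]].

End brownian.

(* Y_N -> Z in law: convergence of the distribution functions at every
   continuity point of the limit. The variables may live on different spaces
   and may take infinite values. *)
Definition cvg_in_law (R : realType)
    (dsp : nat -> measure_display) (Om : forall N, measurableType (dsp N))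
    (P : forall N, probability (Om N) R) (Y : forall N, Om N -> \bar R)
    (dsp' : measure_display) (Om' : measurableType dsp')
    (P' : probability Om' R) (Z : Om' -> \bar R) : Prop :=
  forall z : R,
    {for z, continuous (fun s : R => P' [set w | (Z w <= s%:E)%E])} ->
    (fun N => P N [set w | (Y N w <= z%:E)%E]) @ \oo -->
      P' [set w | (Z w <= z%:E)%E].

(* Main.v *)
(** Both laws are determined by their Laplace transforms at positive integers:
    [expR (- Y)] lies in [0, 1], and its moments control its distribution
    function through Bernstein polynomials.

    For the walk, fix [s = exp (- lam / (N^d log |F|)^2)].  The function
    [x |-> E_x (s ^ C_A)] satisfies a recursion in the set [A], and the minimum
    principle for [1 - s P] turns it into an exact form of the Matthews bounds:
    if the ratios [E_x (s ^ H_y)] are all at most (at least) [1 / (1 + gamma)]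
    then [E_x (s ^ C_A)] is at most (at least) the product of the
    [1 / (1 + gamma / j)], which behaves like [exp (- gamma log |A|)].  These
    ratios are quotients of Green functions killed at rate [s].  Passing to the
    lazy walk makes the number of moves along each coordinate multinomial and
    the coordinates independent given these numbers; a discrete Nash inequality
    on the cycle then gives, uniformly in [N], that the [k]-step kernel is its
    vertical part spread evenly over the torus up to [O(k ^ (-3/2))].  So the
    killed Green function is an explicit geometric profile in the height plus a
    bounded part.  The drop from its value on the diagonal to its value at another
    point at height difference at most [N] is at most [2 g(0) + o(1)], the factor
    2 being due to laziness, and close to this for two points that do not
    communicate in few steps.  The lower Matthews bound uses all of [F], the upper
    one a separated subset of comparable size.

    For Brownian motion, let [psi] be an approximation of [theta] times the
    Dirac mass at 0 with [f'' / 2 - lam f = - psi f], [f] close to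
    [exp (- theta |x|)] and [theta ^ 2 = 2 lam].  Then
    [exp (- lam t + int_0^t psi (B_s) ds) f (B_t)] is a martingale, and stopping
    it when the integral reaches [a] gives the Laplace transform [exp (- a)] of
    the passage time.  This is carried out on the skeleton [B_(k h)], where the
    Taylor error per step is [O (h ^ (3/2))]; the limits [h -> 0] and
    [psi -> theta delta_0] are two applications of the lemma of Fatou, and the
    integral becomes [theta] times the local time. *)

From HB Require Import structures.
Require Import Defs.
From mathcomp Require Import all_boot all_order all_algebra finmap.
From mathcomp Require Import all_classical all_reals all_analysis.
From mathcomp Require Import measurable_realfun.
From mathcomp Require Import ring lra zify.

Set Implicit Arguments.
Unset Strict Implicit.
Unset Printing Implicit Defensive.

Import Order.TTheory GRing.Theory Num.Theory.
Import numFieldNormedType.Exports.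

Local Open Scope classical_set_scope.
Local Open Scope ring_scope.

(** * Discounted sums and the Matthews bounds *)

(** The constant comes from comparing two scales. At the killing rate used, the height profile
    decays at rate [r], with [r ^ 2] close to [2 (d + 1) lam / (N ^ d log |F|) ^ 2], and its
    diagonal value, about [2 (d + 1) / (N ^ d r)], is asymptotic to
    [log |F| sqrt (2 (d + 1) / lam)]. Dividing the drop [2 g(0)] by this gives [gamma], so
    [gamma log |F|] tends to [g(0) / sqrt (d + 1) * sqrt (2 lam)], the exponent [theta u] of the
    inverse local time at [u = g(0) / sqrt (d + 1)]. The obstacle is precision: a bounded error is
    harmless in the Green function itself, which is of order [log |F|], but the drop must be known
    up to [o(1)]. Hence its first [m] terms are kept exactly and the bound [k ^ (-3/2)] serves only
    beyond them, with [m] fixed before [N] tends to infinity. The profile varies by only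
    [O (N ^ (1 - d))] over heights up to [N], which uses [d >= 2] and the band containing [F_N]. As
    [log |F|] may grow arbitrarily slowly, all kernel bounds are uniform in [N]. On the Brownian
    side no stochastic integral is formed: local time enters only as an almost sure limit of
    occupation times, at dyadic times. *)

Section geometric_sums.
Context {R : realType}.
Implicit Types (s M : R) (a b : R^nat).

Definition gsum s a : R := limn (series (fun n => s ^+ n * a n)).

Lemma gsum_is_cvg s a M : 0 <= s < 1 -> (forall n, `|a n| <= M) ->
  cvgn (series (fun n => s ^+ n * a n)).
Proof.
move=> /andP[s0 s1] aM; apply: normed_cvg.
have M0 : 0 <= M by apply: le_trans (aM 0%N).
apply: (@series_le_cvg _ _ (fun n => M * s ^+ n)).
- by move=> n; rewrite normr_ge0.
- by move=> n; rewrite mulr_ge0// exprn_ge0.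
- by move=> n; rewrite /= normrM normrX (ger0_norm s0) mulrC ler_wpM2r// exprn_ge0.
- by apply: is_cvg_geometric_series; rewrite ger0_norm.
Qed.

Lemma gsumD s a b M M' : 0 <= s < 1 ->
  (forall n, `|a n| <= M) -> (forall n, `|b n| <= M') ->
  gsum s (fun n => a n + b n) = gsum s a + gsum s b.
Proof.
move=> s01 aM bM; rewrite /gsum -limD; [|exact: gsum_is_cvg aM|exact: gsum_is_cvg bM].
congr (limn _); rewrite -seriesD; congr series.
by apply/funext => n /=; rewrite mulrDr.
Qed.

Lemma gsumZ s c a M : 0 <= s < 1 -> (forall n, `|a n| <= M) ->
  gsum s (fun n => c * a n) = c * gsum s a.
Proof.
move=> s01 aM; rewrite /gsum.
rewrite (_ : (fun n => s ^+ n * (c * a n)) = c *: (fun n => s ^+ n * a n)).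
  by rewrite seriesZ limZr//; exact: gsum_is_cvg aM.
by apply/funext => n; rewrite /= mulrCA.
Qed.

Lemma ler_gsum s a b M M' : 0 <= s < 1 ->
  (forall n, `|a n| <= M) -> (forall n, `|b n| <= M') ->
  (forall n, a n <= b n) -> gsum s a <= gsum s b.
Proof.
move=> s01 aM bM ab; apply: ler_lim; [exact: gsum_is_cvg aM|exact: gsum_is_cvg bM|].
apply: nearW => n; rewrite /series/=; apply: ler_sum => i _.
by rewrite ler_wpM2l// exprn_ge0//; case/andP: s01.
Qed.

Lemma gsum_recl s a M : 0 <= s < 1 -> (forall n, `|a n| <= M) ->
  gsum s a = a 0%N + s * gsum s (fun n => a n.+1).
Proof.
move=> s01 aM; have aM' n : `|a n.+1| <= M by [].
apply: cvg_lim => //; rewrite -cvg_shiftS /=.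
rewrite (_ : (fun n => _) =
   cst (a 0%N) + s *: series (fun n => s ^+ n * a n.+1)); last first.
  apply/funext => n; rewrite /series /= big_nat_recl// expr0 mul1r; congr (_ + _).
  rewrite [RHS](_ : _ = s * \sum_(0 <= k < n) s ^+ k * a k.+1)// mulr_sumr.
  by apply: eq_bigr => i _; rewrite exprS mulrA.
apply: cvgD; first exact: cvg_cst.
by apply: cvgZr; exact: gsum_is_cvg aM'.
Qed.

Lemma gsum_ge0 s a M : 0 <= s < 1 -> (forall n, `|a n| <= M) ->
  (forall n, 0 <= a n) -> 0 <= gsum s a.
Proof.
move=> s01 aM a0; apply: limr_ge; first exact: gsum_is_cvg aM.
apply: nearW => n; rewrite /series/=; apply: sumr_ge0 => i _.
by rewrite mulr_ge0// exprn_ge0//; case/andP: s01.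
Qed.

(** For a constant sequence [gsum_recl] is a linear equation for the sum itself. *)
Lemma gsum_cst s c : 0 <= s < 1 -> gsum s (fun=> c) = c / (1 - s).
Proof.
move=> s01; have s1 : 1 - s != 0 by rewrite subr_eq0 gt_eqF//; case/andP: s01.
have /(_ (fun=> c) `|c| (fun=> lexx _)) := gsum_recl s01.
set g := gsum s _ => /eqP; rewrite -subr_eq => /eqP <-.
by field.
Qed.

Lemma gsum_sum s (J : Type) (r : seq J) (a : J -> R^nat) M : 0 <= s < 1 ->
  (forall j n, `|a j n| <= M) ->
  gsum s (fun n => \sum_(j <- r) a j n) = \sum_(j <- r) gsum s (a j).
Proof.
move=> s01 aM; elim: r => [|j r IH].
  rewrite big_nil -[RHS](mul0r (1 - s)^-1) -gsum_cst//; congr gsum.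
  by apply/funext => n; rewrite big_nil.
rewrite big_cons -IH -(@gsumD _ _ _ M (\sum_(j <- r) M))//.
  by congr gsum; apply/funext => n; rewrite big_cons.
by move=> n; apply: le_trans (ler_norm_sum _ _ _) _; exact: ler_sum.
Qed.

End geometric_sums.

Section averages.
Context {R : realType} {I : finType}.
Hypothesis I0 : (0 < #|I|)%N.
Implicit Types (F H : I -> R).

Definition avg F : R := (\sum_i F i) / #|I|%:R.

Lemma avg_cst c : avg (fun=> c) = c.
Proof.
rewrite /avg sumr_const -[c *+ _]mulr_natr mulfK// pnatr_eq0.
by rewrite -lt0n.
Qed.

Lemma avgZ c F : avg (fun i => c * F i) = c * avg F.
Proof. by rewrite /avg -mulr_sumr mulrA. Qed.

Lemma avgD F H : avg (fun i => F i + H i) = avg F + avg H.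
Proof. by rewrite /avg big_split mulrDl. Qed.

Lemma avgB F H : avg (fun i => F i - H i) = avg F - avg H.
Proof. by rewrite /avg sumrB mulrBl. Qed.

Lemma avg_sum (J : Type) (r : seq J) (F : J -> I -> R) :
  avg (fun i => \sum_(j <- r) F j i) = \sum_(j <- r) avg (F j).
Proof. by rewrite /avg exchange_big /= mulr_suml. Qed.

Lemma avg_exchange (J : finType) (F : I -> J -> R) :
  (\sum_i (\sum_j F i j) / #|J|%:R) / #|I|%:R = (\sum_j (\sum_i F i j) / #|I|%:R) / #|J|%:R.
Proof. by rewrite -!mulr_suml exchange_big /= mulrAC. Qed.

Lemma ler_avg F H : (forall i, F i <= H i) -> avg F <= avg H.
Proof. by move=> FH; rewrite /avg ler_wpM2r ?invr_ge0// ler_sum. Qed.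

Lemma avg_ge0 F : (forall i, 0 <= F i) -> 0 <= avg F.
Proof. by move=> F0; rewrite /avg divr_ge0// sumr_ge0. Qed.

Lemma avg_norm F M : (forall i, `|F i| <= M) -> `|avg F| <= M.
Proof.
move=> FM; rewrite ler_norml; apply/andP; split.
  by rewrite -[leLHS]avg_cst ler_avg// => i; have := FM i; rewrite ler_norml => /andP[].
by rewrite -[leRHS]avg_cst ler_avg// => i; have := FM i; rewrite ler_norml => /andP[].
Qed.

Lemma eq_avg F H : (forall i, F i = H i) -> avg F = avg H.
Proof. by move=> FH; congr (_ / _); exact: eq_bigr. Qed.

Lemma gsum_avg s (a : I -> R^nat) M : 0 <= s < 1 ->
  (forall i n, `|a i n| <= M) ->
  gsum s (fun n => avg (a ^~ n)) = avg (fun i => gsum s (a i)).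
Proof.
move=> s01 aM; rewrite /avg -(gsum_sum _ s01 aM) mulrC -(gsumZ _ (M:=\sum_(i : I) M))//.
  by congr gsum; apply/funext => n; rewrite mulrC.
by move=> n; apply: le_trans (ler_norm_sum _ _ _) _; exact: ler_sum.
Qed.

End averages.

Section minimum_principle.
Context {R : realType} {G : zmodType} {I : finType} (st : I -> G).
Hypothesis I0 : (0 < #|I|)%N.

(** Each use of the hypothesis improves a uniform lower bound [- m] to [- s m], so the negative part
    of [u] is zero. The bound from below replaces compactness, the cylinder being infinite. *)
Lemma minimum_principle (s M : R) (u : G -> R) : 0 <= s < 1 ->
  (forall x, - M <= u x) ->
  (forall x, 0 <= u x \/ s * avg (fun i => u (x + st i)) <= u x) ->
  forall x, 0 <= u x.
Proof.
move=> /andP[s0 s1] uM hu x.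
have M0 : 0 <= Num.max M 0 by rewrite le_max lexx orbT.
have key k : forall x, - (Num.max M 0 * s ^+ k) <= u x.
  elim: k => [|k IH] y.
    by rewrite expr0 mulr1; apply: le_trans (uM y); rewrite lerN2 le_max lexx.
  case: (hu y) => [|h]; first by apply: le_trans; rewrite oppr_le0 mulr_ge0// exprn_ge0.
  apply: le_trans h; rewrite exprS mulrCA -mulrN ler_wpM2l//.
  by rewrite -[leLHS](avg_cst I0) ler_avg.
have : cvgn (fun k => - (Num.max M 0 * s ^+ k)) /\ limn (fun k => - (Num.max M 0 * s ^+ k)) = 0.
  have h : (fun k => - (Num.max M 0 * s ^+ k)) @ \oo --> (0:R).
    rewrite -[X in _ --> X]oppr0; apply: cvgN.
    by apply: cvg_geometric; rewrite ger0_norm.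
  by split; [apply/cvg_ex; exists 0|exact: cvg_lim].
move=> [cv <-]; apply: limr_le => //.
by apply: nearW => k.
Qed.

(** The minimum principle is applied to [u - v] and to [v - u]. [D] is where boundary values are
    prescribed: one point for a hitting time, nothing for a resolvent. *)
Lemma bounded_solution_unique (s M : R) (u v : G -> R) (D : pred G) : 0 <= s < 1 ->
  (forall x, `|u x| <= M) -> (forall x, `|v x| <= M) ->
  (forall x, D x -> u x = v x) ->
  (forall x, ~~ D x -> u x - v x = s * avg (fun i => u (x + st i) - v (x + st i))) ->
  forall x, u x = v x.
Proof.
move=> s01 uM vM uvD uvh x.
have B y : `|u y - v y| <= M + M by rewrite (le_trans (ler_normB _ _))// lerD.
apply/eqP; rewrite eq_le; apply/andP; split; rewrite -subr_ge0.
  apply: (@minimum_principle s (M + M) (fun y => v y - u y)) => // y.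
    by have := B y; rewrite ler_norml => /andP[]; lra.
  have [Dy|nDy] := boolP (D y); first by left; rewrite uvD// subrr.
  right; rewrite -opprB uvh// -mulrN le_eqVlt; apply/orP; left.
  by apply/eqP; congr (_ * _); rewrite -mulN1r -avgZ; apply: eq_avg => i; rewrite mulN1r opprB.
apply: (@minimum_principle s (M + M) (fun y => u y - v y)) => // y.
  by have := B y; rewrite ler_norml => /andP[].
have [Dy|nDy] := boolP (D y); first by left; rewrite uvD// subrr.
by right; rewrite uvh.
Qed.

End minimum_principle.

(** * Matthews bounds for Laplace transforms of cover times *)

Section matthews.
Context {R : realType} {G : zmodType} {I : finType} (st : I -> G).
Hypothesis I0 : (0 < #|I|)%N.
Implicit Types (A F : {fset G}) (s : R).

(* P_x(A is covered by time n), by conditioning on the first step. *)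
Fixpoint coverp (n : nat) (x : G) A : R :=
  if (A `\ x == fset0)%fset then 1 else
  if n is m.+1 then avg (fun i => coverp m (x + st i) (A `\ x)%fset) else 0.

(* E_x(s ^ C_A), as C_A <= n has probability [coverp n x A]. *)
Definition coverL s x A : R := (1 - s) * gsum s (fun n => coverp n x A).

Lemma coverp01 n x A : 0 <= coverp n x A <= 1.
Proof.
elim: n x A => [|n IH] x A /=; case: ifP => _; rewrite ?lexx ?ler01//.
apply/andP; split; first by apply: avg_ge0 => // i; case/andP: (IH (x + st i) (A `\ x)%fset).
rewrite -[leRHS](avg_cst I0); apply: ler_avg => i.
by case/andP: (IH (x + st i) (A `\ x)%fset).
Qed.

Lemma coverp_norm n x A : `|coverp n x A| <= 1.
Proof. by case/andP: (coverp01 n x A) => h0 h1; rewrite ger0_norm. Qed.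

Lemma fsetD1K A x : ((A `\ x) `\ x = A `\ x)%fset.
Proof. by apply/fsetP => y; rewrite !inE; case: eqP. Qed.

Lemma coverpD1 n x A : coverp n x A = coverp n x (A `\ x)%fset.
Proof. by case: n => [|n] /=; rewrite fsetD1K. Qed.

Lemma coverp_sub n x A F : (A `<=` F)%fset -> coverp n x F <= coverp n x A.
Proof.
elim: n x A F => [|n IH] x A F AF /=.
  case: ifP => [/eqP F0|_]; last by case: ifP.
  rewrite ifT//; rewrite -fsubset0 -F0; exact: fsetSD.
case: ifP => [/eqP F0|_].
  rewrite ifT//; rewrite -fsubset0 -F0; exact: fsetSD.
case: ifP => _; last by apply: ler_avg => i; apply: IH; exact: fsetSD.
rewrite -[leRHS](avg_cst I0); apply: ler_avg => i.
by case/andP: (coverp01 n (x + st i) (F `\ x)%fset).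
Qed.

Lemma coverL01 s x A : 0 <= s < 1 -> 0 <= coverL s x A <= 1.
Proof.
move=> s01; have /andP[s0 s1] := s01; apply/andP; split.
  rewrite mulr_ge0 ?subr_ge0 ?(ltW s1)//; apply: (@gsum_ge0 _ _ _ 1) => // n.
    exact: coverp_norm.
  by case/andP: (coverp01 n x A).
have : gsum s (fun n => coverp n x A) <= gsum s (fun=> 1).
  apply: (@ler_gsum _ _ _ _ 1 1) => // n; first exact: coverp_norm.
    by rewrite normr1.
  by case/andP: (coverp01 n x A).
by rewrite gsum_cst// mul1r -(ler_pM2l (x:=1 - s)) ?subr_gt0// mulfV// subr_eq0 gt_eqF.
Qed.

Lemma coverL_sub s x A F : 0 <= s < 1 -> (A `<=` F)%fset ->
  coverL s x F <= coverL s x A.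
Proof.
move=> s01 AF; have /andP[s0 s1] := s01.
rewrite ler_wpM2l ?subr_ge0 ?(ltW s1)//; apply: (@ler_gsum _ _ _ _ 1 1) => // n.
- exact: coverp_norm.
- exact: coverp_norm.
- exact: coverp_sub.
Qed.

Lemma coverL_D1 s x A : coverL s x A = coverL s x (A `\ x)%fset.
Proof. by congr (_ * gsum s _); apply/funext => n; exact: coverpD1. Qed.

Lemma coverL_fset0 s x : 0 <= s < 1 -> coverL s x fset0 = 1.
Proof.
move=> s01; rewrite /coverL (_ : (fun n => _) = (fun=> 1)).
  by rewrite gsum_cst// mul1r mulfV// subr_eq0 gt_eqF//; case/andP: s01.
by apply/funext => -[|n] /=; rewrite fset0D eqxx.
Qed.

Lemma coverL_self s x : 0 <= s < 1 -> coverL s x [fset x]%fset = 1.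
Proof. by move=> s01; rewrite coverL_D1 fsetDv coverL_fset0. Qed.

Lemma coverL_rec s x A : 0 <= s < 1 -> x \notin A -> A != fset0 ->
  coverL s x A = s * avg (fun i => coverL s (x + st i) A).
Proof.
move=> s01 xA A0; rewrite /coverL (gsum_recl s01 (fun n => coverp_norm n x A)).
have Ax : (A `\ x = A)%fset by apply/fsetP => z; rewrite !inE andb_idl//; apply: contraTneq => ->.
rewrite [coverp 0 _ _]/= Ax (negbTE A0) add0r mulrCA; congr (_ * _).
rewrite (_ : (fun n => coverp n.+1 x A) = (fun n => avg (fun i => coverp n (x + st i) A))).
  by rewrite (gsum_avg s01 (fun i n => coverp_norm n (x + st i) A)) avgZ.
by apply/funext => n /=; rewrite Ax (negbTE A0).
Qed.

(** The transform of a hitting time is the bounded solution of a Dirichlet problem, so exhibiting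
    any solution [g] identifies it; [g] will be a ratio of Green functions. *)
Lemma coverL1_eq s (g : G -> R) M y : 0 <= s < 1 -> (forall x, `|g x| <= M) ->
  g y = 1 -> (forall x, x != y -> g x = s * avg (fun i => g (x + st i))) ->
  forall x, coverL s x [fset y]%fset = g x.
Proof.
move=> s01 gM gy grec.
apply: (@bounded_solution_unique _ _ _ st I0 s (Num.max M 1) _ _ (pred1 y)) => // x.
- case/andP: (coverL01 x [fset y]%fset s01) => h0 h1.
  by rewrite ger0_norm// le_max h1 orbT.
- by rewrite le_max gM.
- by move=> /= /eqP ->; rewrite coverL_self.
- move=> /= xy; rewrite [g x]grec// avgB mulrBr coverL_rec//.
    by rewrite inE.
  by apply/eqP => /fsetP /(_ y); rewrite !inE eqxx.
Qed.

(* [e = 1] gives the upper bound of Matthews, [e = -1] the lower one. *)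
Lemma matthews_step s F (e gamma : R) : 0 <= s < 1 ->
  (forall x y, x \in F -> y \in F -> x != y ->
     0 <= e * (1 - (1 + gamma) * coverL s x [fset y]%fset)) ->
  forall A, (A `<=` F)%fset -> (2 <= #|` A|)%N -> forall x,
  0 <= e * (\sum_(y <- A) coverL s x (A `\ y)%fset - (#|` A|%:R + gamma) * coverL s x A).
Proof.
move=> s01 hF A; have [n] := ubnP #|` A|; elim: n A => [//|n IH] A nA AF A2.
pose U x := e * (\sum_(y <- A) coverL s x (A `\ y)%fset - (#|` A|%:R + gamma) * coverL s x A).
have bU x : - (`|e| * (\sum_(y <- A) 1 + (#|` A|%:R + `|gamma|))) <= U x.
  suff : `|U x| <= `|e| * (\sum_(y <- A) 1 + (#|` A|%:R + `|gamma|)).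
    by rewrite ler_norml => /andP[].
  rewrite normrM ler_wpM2l// (le_trans (ler_normB _ _))// lerD//.
    apply: le_trans (ler_norm_sum _ _ _) _; apply: ler_sum => y _.
    by case/andP: (coverL01 x (A `\ y)%fset s01) => h0 h1; rewrite ger0_norm.
  rewrite normrM -[leRHS]mulr1 ler_pM//.
    by rewrite (le_trans (ler_normD _ _))// ger0_norm.
  by case/andP: (coverL01 x A s01) => h0 h1; rewrite ger0_norm.
apply: (minimum_principle I0 (st:=st) s01 bU) => x.
have [xA|xA] := boolP (x \in A); [left|right].
  have cA : #|` A| = #|` (A `\ x)%fset|.+1 by rewrite (cardfsD1 x) xA.
  (* The starting point is already covered: the term [y = x] of the sum equals [coverL s x A], which
     lowers the coefficient [#|A|] by one. What remains is the same expression for [A] without [x];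
     when one point is left it is [hF]. *)
  have -> : U x = e * (\sum_(y <- (A `\ x)%fset) coverL s x ((A `\ x) `\ y)%fset
      - (#|` (A `\ x)%fset|%:R + gamma) * coverL s x (A `\ x)%fset).
    rewrite /U cA (big_fsetD1 x)//= [coverL s x A]coverL_D1 -natr1; congr (_ * _).
    rewrite (eq_big_seq (fun y => coverL s x ((A `\ x) `\ y)%fset)); first by ring.
    move=> y _ /=; rewrite coverL_D1; congr coverL.
    by apply/fsetP => z; rewrite !inE; case: (z == x); case: (z == y).
  have sub : (A `\ x `<=` F)%fset by apply: fsubset_trans AF; exact: fsubD1set.
  have [c2|] := leqP 2 #|` (A `\ x)%fset|.
    by apply: IH => //; move: nA; rewrite cA ltnS.
  move=> c1; have /cardfs1P[y Ey] : #|` (A `\ x)%fset| == 1%N by rewrite eqn_leq -ltnS c1 -ltnS -cA.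
  rewrite Ey big_seq_fset1 fsetDv coverL_fset0// cardfs1; apply: hF.
  - exact: (fsubsetP AF).
  - by apply: (fsubsetP sub); rewrite Ey inE.
  - have : y \in (A `\ x)%fset by rewrite Ey inE.
    by rewrite !inE eq_sym => /andP[].
(* Off [A] every transform in the expression satisfies [coverL_rec], so [U] equals [s] times its
   average. *)
rewrite le_eqVlt; apply/orP; left; apply/eqP.
rewrite /U avgZ avgB avg_sum avgZ mulrCA mulrBr; congr (_ * (_ - _)).
  rewrite mulr_sumr; apply: eq_big_seq => y yA; rewrite -coverL_rec//.
    by rewrite !inE negb_and xA orbT.
  apply/eqP => /(congr1 (fun B : {fset G} => #|` B|)); rewrite cardfs0 => h.
  by move: A2; rewrite (cardfsD1 y) h; case: (y \in A).
by rewrite mulrCA -coverL_rec//; apply/eqP => h; rewrite h cardfs0 in A2.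
Qed.

(** The index [j] is the number of points still to be covered. The product starts at 2 because a
    single remaining point is treated apart: bounded by 1 in [matthews_upper], by [c] in
    [matthews_lower]. *)
Definition matthews_prod (gamma : R) (n : nat) : R :=
  \prod_(2 <= j < n.+1) (j%:R / (j%:R + gamma)).

Lemma matthews_prodS (gamma : R) n : (0 < n)%N ->
  matthews_prod gamma n.+1 = matthews_prod gamma n * (n.+1%:R / (n.+1%:R + gamma)).
Proof. by move=> n0; rewrite /matthews_prod big_nat_recr. Qed.

(** Induction on subsets: [matthews_step] bounds [(#|A| + gamma) coverL s x A] by the sum of the
    [#|A|] transforms of [A] minus a point, each at most the product with one factor less. *)
Lemma matthews_upper s F (gamma : R) x : 0 <= s < 1 -> 0 <= gamma ->
  (forall x y, x \in F -> y \in F -> x != y ->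
     (1 + gamma) * coverL s x [fset y]%fset <= 1) ->
  (0 < #|` F|)%N -> coverL s x F <= matthews_prod gamma #|` F|.
Proof.
move=> s01 g0 hF; move: (fsubset_refl F); move: {1 3 4 5}F => A.
move En : #|` A| => n; elim: n A En => [//|n IH] A cA AF _.
have [n0|n0] := posnP n.
  rewrite n0 /matthews_prod big_geq//.
  by case/andP: (coverL01 x A s01).
have h := @matthews_step s F 1 gamma s01 _ A AF _ x.
have {h} : (n.+1%:R + gamma) * coverL s x A <= n.+1%:R * matthews_prod gamma n.
  apply: (@le_trans _ _ (\sum_(y <- A) coverL s x (A `\ y)%fset)).
    rewrite -subr_ge0 -cA -[leRHS]mul1r h ?cA//.
    by move=> u v uF vF uv; rewrite mul1r subr_ge0 hF.
  apply: (@le_trans _ _ (\sum_(y <- A) matthews_prod gamma n)).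
    rewrite big_seq [leRHS]big_seq; apply: ler_sum => y yA.
    have cAy : #|` (A `\ y)%fset| = n by move: cA; rewrite (cardfsD1 y) yA => -[].
    by apply: IH => //; apply: fsubset_trans AF; exact: fsubD1set.
  by rewrite big_const_seq count_predT iter_addr_0 cA mulr_natl.
by move=> h; rewrite matthews_prodS// mulrA ler_pdivlMr ?ltr_pwDl// mulrC [leRHS]mulrC.
Qed.

(** The same induction with signs reversed. The base case asks for [c] because the start [x] may lie
    off [F], where the hypothesis on pairs says nothing. *)
Lemma matthews_lower s F (gamma c : R) x : 0 <= s < 1 -> 0 <= gamma ->
  (forall x y, x \in F -> y \in F -> x != y ->
     1 <= (1 + gamma) * coverL s x [fset y]%fset) ->
  (forall y, y \in F -> c <= coverL s x [fset y]%fset) ->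
  (0 < #|` F|)%N -> c * matthews_prod gamma #|` F| <= coverL s x F.
Proof.
move=> s01 g0 hF hc; move: (fsubset_refl F); move: {1 3 4 5}F => A.
move En : #|` A| => n; elim: n A En => [//|n IH] A cA AF _.
have [n0|n0] := posnP n.
  rewrite n0 /matthews_prod big_geq// mulr1.
  have /cardfs1P[y Ey] : #|` A| == 1%N by rewrite cA n0.
  by rewrite Ey; apply: hc; apply: (fsubsetP AF); rewrite Ey inE.
have h := @matthews_step s F (-1) gamma s01 _ A AF _ x.
have {h} : n.+1%:R * (c * matthews_prod gamma n) <= (n.+1%:R + gamma) * coverL s x A.
  apply: (@le_trans _ _ (\sum_(y <- A) coverL s x (A `\ y)%fset)).
    apply: (@le_trans _ _ (\sum_(y <- A) c * matthews_prod gamma n)).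
      by rewrite big_const_seq count_predT iter_addr_0 cA mulr_natl.
    rewrite big_seq [leRHS]big_seq; apply: ler_sum => y yA.
    have cAy : #|` (A `\ y)%fset| = n by move: cA; rewrite (cardfsD1 y) yA => -[].
    by apply: IH => //; apply: fsubset_trans AF; exact: fsubD1set.
  rewrite -subr_le0 -oppr_ge0 -cA -[leRHS]mulN1r h ?cA//.
  by move=> u v uF vF uv; rewrite mulN1r oppr_ge0 subr_le0 hF.
by move=> h; rewrite matthews_prodS// !mulrA ler_pdivrMr ?ltr_pwDl// mulrC [leRHS]mulrC.
Qed.

End matthews.

Section walk_operator.
Context {R : realType} {G : zmodType} {I : finType} (st : I -> G).
Hypothesis I0 : (0 < #|I|)%N.
Implicit Types f : G -> R.

(* E_x(f(X_n)) *)
Fixpoint walk_op (n : nat) f (x : G) : R :=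
  if n is m.+1 then avg (fun i => walk_op m f (x + st i)) else f x.

Lemma walk_probE n x y : walk_prob R st n x y = walk_op n (fun z => (z == y)%:R) x.
Proof. by elim: n x => [//|n IH] x /=; congr (_ / _); apply: eq_bigr => i _; rewrite IH. Qed.

Lemma eq_walk_op n f h : f =1 h -> walk_op n f =1 walk_op n h.
Proof. by move=> fh; elim: n => [|n IH] x //=; apply: eq_avg => i. Qed.

Lemma walk_opSr n f x : walk_op n.+1 f x = walk_op n (fun z => avg (fun i => f (z + st i))) x.
Proof. by elim: n x => [//|n IH] x; apply: eq_avg => i; exact: IH. Qed.

Lemma walk_op_norm n f M : (forall x, `|f x| <= M) -> forall x, `|walk_op n f x| <= M.
Proof. by move=> fM; elim: n => [|n IH] x //=; exact: avg_norm. Qed.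

Definition resolvent (s : R) f (x : G) : R := gsum s (fun n => walk_op n f x).

Lemma resolvent_rec s f M x : 0 <= s < 1 -> (forall x, `|f x| <= M) ->
  resolvent s f x = f x + s * avg (fun i => resolvent s f (x + st i)).
Proof.
move=> s01 fM; have B n y := walk_op_norm n fM y.
rewrite {1}/resolvent (gsum_recl s01 (fun n => B n x)) /=; congr (_ + _ * _).
by rewrite (gsum_avg s01 (fun i n => B n (x + st i))).
Qed.

Lemma resolvent_norm s f M x : 0 <= s < 1 -> (forall x, `|f x| <= M) ->
  `|resolvent s f x| <= M / (1 - s).
Proof.
move=> s01 fM; have B n y := walk_op_norm n fM y.
have Bc (n : nat) : `|M| <= `|M| by [].
rewrite -gsum_cst// ler_norml; apply/andP; split.
  rewrite -mulN1r -(gsumZ _ s01 Bc); apply: (ler_gsum s01 (M:=`|M|) _ (fun n => B n x)).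
    by move=> n; rewrite mulN1r normrN.
  by move=> n; rewrite mulN1r; have := B n x; rewrite ler_norml => /andP[].
apply: (ler_gsum s01 (fun n => B n x) Bc).
by move=> n; have := B n x; rewrite ler_norml => /andP[].
Qed.

Lemma walk_op_resolvent_unique s f (g : G -> R) M M' : 0 <= s < 1 ->
  (forall x, `|f x| <= M) -> (forall x, `|g x| <= M') ->
  (forall x, g x = f x + s * avg (fun i => g (x + st i))) ->
  forall x, g x = resolvent s f x.
Proof.
move=> s01 fM gM grec; pose K := Num.max M' (M / (1 - s)).
apply: (@bounded_solution_unique _ _ _ st I0 s K _ _ pred0) => // x.
- by rewrite le_max gM.
- by rewrite le_max resolvent_norm ?orbT.
- move=> _; rewrite [g x]grec (resolvent_rec x s01 fM) avgB mulrBr; ring.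
Qed.

Lemma walk_prob01 n x y : 0 <= walk_prob R st n x y <= 1.
Proof.
rewrite walk_probE; elim: n x => [|n IH] x /=; first by case: eqP; rewrite ?lexx ?ler01.
apply/andP; split; first by apply: avg_ge0 => i; case/andP: (IH (x + st i)).
by rewrite -[leRHS](avg_cst I0); apply: ler_avg => i; case/andP: (IH (x + st i)).
Qed.

End walk_operator.

(** * Covering probabilities from the finite-dimensional laws *)

Section walk_events.
Context {R : realType} {G : zmodType} {I : finType} (st : I -> G).
Context {dsp : measure_display} {Om : measurableType dsp} (P : probability Om R).
Context (X : nat -> Om -> G) (mu : G -> R).
Hypothesis I0 : (0 < #|I|)%N.
Hypothesis hX : is_walk st mu P X.

Lemma measurable_walk_eq n x : measurable [set w | X n w = x].
Proof. by case: hX => h _; exact: (h n x). Qed.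

Lemma measurable_prefix k (x : nat -> G) :
  measurable [set w | forall i, (i <= k)%N -> X i w = x i].
Proof.
rewrite (_ : [set w | _] = \bigcap_(i in `I_k.+1) [set w | X i w = x i]).
  by apply: bigcap_measurable => [|i _]; [exists 0%N|exact: measurable_walk_eq].
by apply/seteqP; split => w /= h i ik; apply: h.
Qed.

Lemma measurable_covered (A : {fset G}) k n :
  measurable [set w | forall y, y \in A -> exists j, [/\ (k <= j)%N, (j <= n)%N & X j w = y]].
Proof.
rewrite (_ : [set w | _] = \bigcap_(y in [set` A])
    \bigcup_(j in [set j | (k <= j <= n)%N]) [set w | X j w = y]).
  apply: fin_bigcap_measurable => // y _.
  by apply: bigcup_measurable => j _; exact: measurable_walk_eq.
apply/seteqP; split => w /= h y yA.
  by have [j [kj jn <-]] := h y yA; exists j => //=; rewrite kj jn.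
by have [j /andP[kj jn] Xj] := h y yA; exists j.
Qed.

Lemma measurable_notin k (S : seq G) : measurable [set w | X k w \notin S].
Proof.
rewrite (_ : [set w | _] = ~` \bigcup_(y in [set` S]) [set w | X k w = y]).
  apply: measurableC; apply: fin_bigcup_measurable => // y _.
  exact: measurable_walk_eq.
apply/seteqP; split => w /=.
  by move=> /negP h [z /= zT Zw]; apply: h; rewrite Zw.
by move=> h; apply/negP => ZT; apply: h; exists (X k w).
Qed.

(** [S] is finite while [Z] may take infinitely many values: the remainder is kept as one event,
    which turns out to be null once the masses over [S] are seen to exhaust the total. *)
Lemma measure_partition (Z : Om -> G) (E : set Om) (S : seq G) :
  (forall y, measurable [set w | Z w = y]) -> measurable E -> uniq S ->
  P E = ((\sum_(y <- S) P (E `&` [set w | Z w = y])) + P (E `&` [set w | Z w \notin S]))%E.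
Proof.
move=> mZ mE; elim: S => [_|y S IH /= /andP[yS uS]].
  by rewrite big_nil add0e; congr (P _); apply/seteqP; split => w //= [].
have mS (T : seq G) : measurable [set w | Z w \notin T].
  rewrite (_ : [set w | _] = ~` \bigcup_(y in [set` T]) [set w | Z w = y]).
    by apply: measurableC; apply: fin_bigcup_measurable.
  apply/seteqP; split => w /=.
    by move=> /negP h [z /= zT Zw]; apply: h; rewrite Zw.
  by move=> h; apply/negP => ZT; apply: h; exists (Z w).
rewrite IH// big_cons -addeA [RHS]addeCA; congr (_ + _)%E.
rewrite -measureU; first (congr (P _); apply/seteqP; split => w /=).
- move=> [Ew ZS]; have [Zy|Zy] := eqVneq (Z w) y; [by left|right; split => //].
  by rewrite inE negb_or Zy.
- move=> [[Ew Zy]|[Ew]]; first by rewrite Zy.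
  by rewrite inE negb_or => /andP[].
- exact: measurableI.
- exact: measurableI.
- by apply/seteqP; split => // w [[_ /= ->] [_ /=]]; rewrite inE eqxx.
Qed.

(** Several steps may lead to the same point, as on a torus with [N <= 2]. The list of endpoints is
    therefore deduplicated, and [step_prob] carries the multiplicity. *)
Lemma sum_step_prob (f : G -> R) x :
  \sum_(y <- undup [seq x + st i | i <- enum I]) step_prob R st x y * f y =
  avg (fun i => f (x + st i)).
Proof.
pose S := undup [seq x + st i | i <- enum I].
transitivity (\sum_(y <- S) \sum_(i : I) if x + st i == y then f y / #|I|%:R else 0).
  apply: eq_bigr => y _; rewrite -big_mkcond/= sumr_const -[RHS]mulr_natl /step_prob.
  by rewrite cardsE [LHS]mulrAC mulrA.
rewrite exchange_big /= /avg mulr_suml; apply: eq_bigr => i _.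
rewrite (bigD1_seq (x + st i)) ?undup_uniq//=; last first.
  by rewrite mem_undup; apply/mapP; exists i; rewrite ?mem_enum.
rewrite eqxx big1 ?addr0// => y; by rewrite eq_sym => /negbTE ->.
Qed.

Let prefix k (x : nat -> G) := [set w | forall i, (i <= k)%N -> X i w = x i].
Let covered (A : {fset G}) k n :=
  [set w | forall y, y \in A -> exists j, [/\ (k <= j)%N, (j <= n)%N & X j w = y]].
Let wt k (x : nat -> G) := mu (x 0%N) * \prod_(i < k) step_prob R st (x i) (x i.+1).

Let prefixS k (x : nat -> G) y :
  prefix k x `&` [set w | X k.+1 w = y] = prefix k.+1 (fun i => if (i <= k)%N then x i else y).
Proof.
apply/seteqP; split => w /=.
  move=> [h Xy] i ik; case: leqP => [|ki]; first exact: h.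
  by rewrite (_ : i = k.+1)//; apply/eqP; rewrite eqn_leq ik.
move=> h; split; last by have := h _ (leqnn k.+1); rewrite ltnn.
by move=> i ik; rewrite h ?ik// leqW.
Qed.

Let wtS k (x : nat -> G) y :
  wt k.+1 (fun i => if (i <= k)%N then x i else y) = wt k x * step_prob R st (x k) y.
Proof.
rewrite /wt leq0n big_ord_recr /= leqnn ltnn mulrA; congr (_ * _ * _).
by apply: eq_bigr => i _; rewrite !ifT// ltnW.
Qed.

Let P_prefix k x : P (prefix k x) = (wt k x)%:E.
Proof. by case: hX => _ ->. Qed.

(** Markov property in integrated form: given the path up to time [k], only [x k] matters for the
    future. Each induction step removes [x k] from the set and splits according to the value of
    [X k.+1]. *)
Lemma prob_prefix_covered n k (x : nat -> G) A :
  P (prefix k x `&` covered A k (k + n)) = (wt k x * coverp st n (x k) A)%:E.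
Proof.
elim: n k x A => [|n IH] k x A.
  rewrite addn0 /=; case: ifP => [/eqP A0|/eqP A0].
    rewrite mulr1 -P_prefix; congr (P _); apply/seteqP; split => w /=; first by case.
    move=> h; split => // y yA; exists k; split => //; rewrite h//.
    have : y \notin (A `\ x k)%fset by rewrite A0.
    by rewrite !inE yA andbT negbK => /eqP.
  rewrite mulr0 (_ : _ `&` _ = set0) ?measure0//; apply/seteqP; split => w //= [h1 h2].
  apply: A0; apply/fsetP => y; rewrite !inE; apply/negP => /andP[/eqP yx yA].
  have [j [kj jk Xj]] := h2 _ yA; apply: yx; rewrite -Xj.
  by rewrite (_ : j = k) ?h1//; apply/eqP; rewrite eqn_leq jk.
rewrite /=; case: ifP => [/eqP A0|/eqP A0].
  rewrite mulr1 -P_prefix; congr (P _); apply/seteqP; split => w /=; first by case.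
  move=> h; split => // y yA; exists k; split => //; rewrite ?h ?leq_addr//.
  have : y \notin (A `\ x k)%fset by rewrite A0.
  by rewrite !inE yA andbT negbK => /eqP.
pose S := undup [seq x k + st i | i <- enum I].
have mpre := measurable_prefix k x.
have mX y := measurable_walk_eq k.+1 y.
(* The positions in [S] already carry the whole mass of the prefix, the step probabilities adding up
   to 1. *)
have null : P (prefix k x `&` [set w | X k.+1 w \notin S]) = 0.
  have := measure_partition mX mpre (undup_uniq [seq x k + st i | i <- enum I]).
  rewrite -/(prefix k x) P_prefix.
  rewrite (eq_bigr (fun y => (wt k x * (step_prob R st (x k) y * 1))%:E)); last first.
    by move=> y _; rewrite prefixS P_prefix wtS mulr1.
  rewrite sumEFin -mulr_sumr sum_step_prob avg_cst// mulr1.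
  have : (0 <= P (prefix k x `&` [set w | X k.+1 w \notin S]))%E by [].
  rewrite /S; case: (P _) => [r| |]//= _ [].
  by move/eqP; rewrite addrC -subr_eq subrr => /eqP <-.
have mcov := measurable_covered A k (k + n.+1).
rewrite (measure_partition mX _ (undup_uniq [seq x k + st i | i <- enum I])); last exact: measurableI.
rewrite [X in (_ + X)%E](_ : _ = 0) ?adde0; last first.
  apply/eqP; rewrite eq_le measure_ge0 andbT -null; apply: le_measure; rewrite ?inE.
  - by apply: measurableI; [exact: measurableI|exact: measurable_notin].
  - by apply: measurableI => //; exact: measurable_notin.
  - by move=> w [[]].
rewrite (eq_bigr (fun y => (wt k x * (step_prob R st (x k) y * coverp st n y (A `\ x k)%fset))%:E)).
  by rewrite sumEFin -mulr_sumr sum_step_prob.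
move=> y _; rewrite mulrA -wtS.
have := IH k.+1 (fun i => if (i <= k)%N then x i else y) (A `\ x k)%fset.
rewrite ltnn => <-; rewrite -prefixS addSnnS; congr (P _).
apply/seteqP; split => w /= [[h1 h2] h3]; split => //.
  move=> z; rewrite !inE => /andP[/eqP zx zA]; have [j [kj jk Xj]] := h2 _ zA.
  exists j; split => //; rewrite ltn_neqAle kj andbT; apply/eqP => jk'.
  by apply: zx; rewrite -Xj -jk' h1.
split=> // z zA; have [->|zx] := eqVneq z (x k).
  by exists k; rewrite leqnn leq_addr h1.
have [|j [kj jk Xj]] := h3 z; first by rewrite !inE zx.
by exists j; split => //; exact: ltnW.
Qed.

Lemma prob_covered n A (S : seq G) : uniq S -> (forall x, x \notin S -> mu x = 0) ->
  \sum_(x <- S) mu x = 1 ->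
  P [set w | forall y, y \in A -> exists2 j, (j <= n)%N & X j w = y] =
  (\sum_(x <- S) mu x * coverp st n x A)%:E.
Proof.
move=> uS mu0 mu1.
rewrite (_ : [set w | _] = covered A 0 n); last first.
  by apply/seteqP; split => w /= h y yA; have [j] := h y yA; [exists j|case=> *; exists j].
have mcov := measurable_covered A 0 n.
have mX y := measurable_walk_eq 0 y.
have P0 y : P [set w | X 0%N w = y] = (mu y)%:E.
  have := P_prefix 0 (fun=> y); rewrite /wt big_ord0 mulr1 => <-; congr (P _).
  apply/seteqP; split => w /=; first by move=> h [|i]//.
  by move=> /(_ 0%N); exact.
have mS := measurable_notin 0 S.
rewrite (measure_partition mX _ uS)// [X in (_ + X)%E](_ : _ = 0) ?adde0.
  rewrite -sumEFin; apply: eq_bigr => y _.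
  have := prob_prefix_covered n 0 (fun=> y) A; rewrite /wt big_ord0 mulr1 => <-.
  rewrite setIC; congr (P (_ `&` _)); apply/seteqP; split => w /=; first by move=> h [|i]//.
  by move=> /(_ 0%N); exact.
have null : P [set w | X 0%N w \notin S] = 0.
  have := measure_partition mX measurableT uS; rewrite probability_setT.
  rewrite (eq_bigr (fun y => (mu y)%:E)) => [|y _]; last by rewrite setTI P0.
  rewrite setTI sumEFin mu1.
  have : (0 <= P [set w | X 0%N w \notin S])%E by [].
  case: (P _) => [r| |]//= _ [].
  by move/eqP; rewrite addrC -subr_eq subrr => /eqP <-.
apply/eqP; rewrite eq_le measure_ge0 andbT -null; apply: le_measure; rewrite ?inE//.
exact: measurableI.
Qed.

End walk_events.

(** * The lazy walk on the cycle *)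

Section finite_sums.
Context {R : realType}.

Lemma cauchy_schwarz_sum (J : finType) (a b : J -> R) :
  (\sum_j a j * b j) ^+ 2 <= (\sum_j a j ^+ 2) * (\sum_j b j ^+ 2).
Proof.
set C := \sum_j a j * b j; set S := \sum_j a j ^+ 2; set T := \sum_j b j ^+ 2.
have T0 : 0 <= T by apply: sumr_ge0 => j _; exact: sqr_ge0.
have : 0 <= T * (S * T - C ^+ 2).
  rewrite (_ : _ * _ = \sum_j (T * a j - C * b j) ^+ 2).
    by apply: sumr_ge0 => j _; exact: sqr_ge0.
  rewrite (eq_bigr (fun j => T ^+ 2 * a j ^+ 2 - (2 * T * C) * (a j * b j) + C ^+ 2 * b j ^+ 2)).
    by rewrite big_split sumrB /= -!mulr_sumr -/C -/S -/T; ring.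
  by move=> j _; ring.
move: T0; rewrite le_eqVlt => /orP[/eqP T0 _|T0]; last by rewrite pmulr_rge0// subr_ge0.
have b0 j : b j = 0.
  have : b j ^+ 2 <= T by rewrite /T (bigD1 j)//= lerDl sumr_ge0// => i _; exact: sqr_ge0.
  rewrite -T0.
  by move=> h; apply/eqP; rewrite -sqrf_eq0 eq_le h sqr_ge0.
by rewrite /C big1 ?expr0n/= -?T0 ?mulr0// => j _; rewrite b0 mulr0.
Qed.

(** Factors are replaced one at a time, the others lying in [[0, 1]]. *)
Lemma prod_diff_le (J : Type) (r : seq J) (u : J -> R) (c : R) :
  0 <= c <= 1 -> (forall j, 0 <= u j <= 1) ->
  `|\prod_(j <- r) u j - \prod_(j <- r) c| <= \sum_(j <- r) `|u j - c|.
Proof.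
move=> /andP[c0 c1] u01; elim: r => [|j r IH]; first by rewrite !big_nil subrr normr0.
rewrite !big_cons; set p := \prod_(j <- r) u j; set q := \prod_(j <- r) c.
rewrite (_ : _ - _ = (u j - c) * p + c * (p - q)); last by ring.
rewrite (le_trans (ler_normD _ _))// lerD// normrM.
  rewrite ler_piMr//; have : 0 <= p <= 1.
    rewrite /p; elim/big_rec: _ => [|i x _ /andP[x0 x1]]; first by rewrite ler01 lexx.
    by have /andP[ui0 ui1] := u01 i; rewrite mulr_ge0//= mulr_ile1.
  by case/andP => p0 p1; rewrite ger0_norm.
rewrite (ger0_norm c0); apply: le_trans IH; rewrite ler_piMl//.
Qed.

Lemma norm_opposite (x y : R) : x * y <= 0 -> `|x| <= `|x - y|.
Proof.
move=> xy; rewrite -ler_sqr ?nnegrE// !real_normK ?num_real//.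
by have := sqr_ge0 y; nra.
Qed.

(** Mean value bound for the signed square, whose derivative is [2 |x|]; it feeds the Nash
    inequality. *)
Lemma norm_signed_sqr (x y : R) :
  `|x * `|x| - y * `|y| | <= `|x - y| * (`|x| + `|y|).
Proof.
have h : 2 * (x * `|x| - y * `|y|) = (x - y) * (`|x| + `|y|) + (x + y) * (`|x| - `|y|) by ring.
have h1 : `|(x + y) * (`|x| - `|y|)| <= (`|x| + `|y|) * `|x - y|.
  by rewrite normrM ler_pM// ?ler_normD// ler_dist_dist.
have h2 : `|(x - y) * (`|x| + `|y|)| = `|x - y| * (`|x| + `|y|).
  by rewrite normrM [X in _ * X]ger0_norm// addr_ge0.
have := ler_normD ((x - y) * (`|x| + `|y|)) ((x + y) * (`|x| - `|y|)).
rewrite -h normrM (ger0_norm (_ : 0 <= 2))// h2; lra.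
Qed.

(** Discrete form of the equation [e' = - e ^ 2 / c], whose solution from 1 is [c / (k + c)]. *)
Lemma harmonic_decay (c : R) (e : R^nat) : 1 <= c -> (forall k, 0 <= e k <= 1) ->
  (forall k, e k ^+ 2 <= c * (e k - e k.+1)) -> forall k, e k * (k%:R + c) <= c.
Proof.
move=> c1 e01 he; elim => [|k IH].
  by rewrite add0r ler_piMl//; [lra|case/andP: (e01 0%N)].
have /andP[] := e01 k; have := he k; move: IH; rewrite -[k.+1%:R]natr1.
have : (0:R) <= k%:R by [].
set t := k%:R; set x := e k; set y := e k.+1 => t0 xt hy x0 x1.
rewrite -(ler_pM2l (x := c)); last by lra.
have cy : c * y <= c * x - x ^+ 2 by lra.
apply: (@le_trans _ _ ((c * x - x ^+ 2) * (t + 1 + c))).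
  by rewrite mulrA ler_wpM2r//; lra.
have d0 : 0 <= (c - x * (t + c)) * (c - x) by rewrite mulr_ge0//; lra.
have := sqr_ge0 x; nra.
Qed.

End finite_sums.

Section cycle.
Context {R : realType} (n : nat).
Notation cyc := ('I_n.+1).
Notation e := (inZp 1 : cyc).
Notation N := (n.+1%:R : R).

(* The law of a sum of k independent uniform variables on {0, e}; the lazy
   kernel is its autocorrelation, hence is of positive type. *)
Fixpoint half_walk (k : nat) (x : cyc) : R :=
  if k is m.+1 then (half_walk m x + half_walk m (x - e)) / 2 else (x == 0)%:R.

Lemma sum_shift (F : cyc -> R) z : \sum_x F (x + z) = \sum_x F x.
Proof. by rewrite [RHS](reindex_inj (addIr z)). Qed.

Lemma half_walk_ge0 k x : 0 <= half_walk k x.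
Proof. by elim: k x => [|k IH] x //=; rewrite divr_ge0// addr_ge0. Qed.

Lemma sum_half_walk k : \sum_x half_walk k x = 1.
Proof.
elim: k => [|k IH] /=.
  by rewrite (bigD1 0)//= big1 ?addr0// => i /negbTE ->.
by rewrite -mulr_suml big_split /= (sum_shift (half_walk k)) IH; field.
Qed.

Definition lazy_kernel k y : R := \sum_x half_walk k x * half_walk k (x + y).

Lemma lazy_kernel0 y : lazy_kernel 0 y = (y == 0)%:R.
Proof.
rewrite /lazy_kernel (bigD1 0)//= mul1r add0r big1 ?addr0// => i /negbTE ->.
by rewrite mul0r.
Qed.

Lemma lazy_kernelS k y : lazy_kernel k.+1 y =
  (lazy_kernel k (y + e) + lazy_kernel k y *+ 2 + lazy_kernel k (y - e)) / 4.
Proof.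
have A z : \sum_x half_walk k (x - e) * half_walk k (x + z) = lazy_kernel k (z + e).
  rewrite /lazy_kernel -(sum_shift _ e); apply: eq_bigr => x _.
  by rewrite addrK addrAC addrA.
rewrite {1}/lazy_kernel /=.
rewrite (eq_bigr (fun x => (half_walk k x * half_walk k (x + y)
   + half_walk k x * half_walk k (x + (y - e)) + half_walk k (x - e) * half_walk k (x + y)
   + half_walk k (x - e) * half_walk k (x + (y - e))) / 4)).
  by rewrite -mulr_suml !big_split /= !A subrK /lazy_kernel mulr2n; ring.
by move=> x _; rewrite !addrA; field.
Qed.

Let g k x := half_walk k x - N^-1.

Let g_sum k : \sum_x g k x = 0.
Proof.
by rewrite sumrB sum_half_walk sumr_const card_ord -[N^-1 *+ _]mulr_natl mulfV ?subrr// pnatr_eq0.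
Qed.

(** Squared distance from [half_walk] to the uniform law. By [lazy_kernelE] at [y = 0] it is also
    the excess of the kernel on the diagonal, and it dominates the excess everywhere else. *)
Definition kernel_excess k : R := \sum_x g k x ^+ 2.

Let lazy_kernelE k y : lazy_kernel k y - N^-1 = \sum_x g k x * g k (x + y).
Proof.
rewrite (eq_bigr (fun x => half_walk k x * half_walk k (x + y)
    - N^-1 * half_walk k x - N^-1 * half_walk k (x + y) + N^-1 * N^-1)); last first.
  by move=> x _; rewrite /g; ring.
rewrite big_split !sumrB /= -!mulr_sumr (sum_shift (half_walk k)) sum_half_walk.
rewrite sumr_const card_ord -[N^-1 *+ _]mulr_natl mulfV ?pnatr_eq0// -/(lazy_kernel k y).
by ring.
Qed.

Lemma lazy_kernel_excess k y : `|lazy_kernel k y - N^-1| <= kernel_excess k.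
Proof.
rewrite lazy_kernelE (le_trans (ler_norm_sum _ _ _))//.
apply: (@le_trans _ _ (\sum_x (g k x ^+ 2 + g k (x + y) ^+ 2) / 2)).
  apply: ler_sum => x _; rewrite ler_norml; have := sqr_ge0 (g k x + g k (x + y)).
  by have := sqr_ge0 (g k x - g k (x + y)); rewrite !expr2; nra.
rewrite -mulr_suml big_split /= (sum_shift (fun x => g k x ^+ 2)) -/(kernel_excess k).
by rewrite le_eqVlt; apply/orP; left; apply/eqP; field.
Qed.

Lemma kernel_excess_ge0 k : 0 <= kernel_excess k.
Proof. by apply: sumr_ge0 => x _; exact: sqr_ge0. Qed.

Let energy k : R := \sum_x (g k x - g k (x - e)) ^+ 2.

(** Parallelogram identity: a step averages [g k] with its translate, and the loss in square norm is
    a quarter of the Dirichlet form. *)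
Let kernel_excessS k : 4 * (kernel_excess k - kernel_excess k.+1) = energy k.
Proof.
have gS x : g k.+1 x = (g k x + g k (x - e)) / 2 by rewrite /g /=; field.
have h : 4 * kernel_excess k.+1 + energy k = 4 * kernel_excess k.
  rewrite /kernel_excess /energy mulr_sumr -big_split /=.
  rewrite (eq_bigr (fun x => 2 * g k x ^+ 2 + 2 * g k (x - e) ^+ 2)); last first.
    by move=> x _; rewrite gS; field.
  by rewrite big_split /= -!mulr_sumr (sum_shift (fun x => g k x ^+ 2)); ring.
by rewrite mulrBr -h; ring.
Qed.

Lemma kernel_excess_le1 k : kernel_excess k <= 1.
Proof.
elim: k => [|k IH]; last first.
  apply: le_trans IH; rewrite -subr_ge0 -(pmulr_rge0 (x := 4))// kernel_excessS.
  by apply: sumr_ge0 => x _; exact: sqr_ge0.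
rewrite /kernel_excess (eq_bigr (fun x => g 0 x * g 0 (x + 0))).
  rewrite -lazy_kernelE lazy_kernel0 eqxx lerBlDr lerDl invr_ge0.
  by rewrite ler0n.
by move=> x _; rewrite addr0.
Qed.

(** Telescoping along the indices between [b] and [a], an arc that avoids the edge joining [n] to
    0. *)
Let oscillation (F : cyc -> R) a b : `|F a - F b| <= \sum_x `|F x - F (x - e)|.
Proof.
wlog ba : a b / (b <= a)%N.
  move=> h; case: (leqP b a) => [|/ltnW]; first exact: h.
  by rewrite distrC; exact: h.
pose f i := F (inord i).
have -> : F a - F b = \sum_(b <= k < a) (f k.+1 - f k).
  by rewrite telescope_sumr// /f !inord_val.
rewrite (le_trans (ler_norm_sum _ _ _))// big_ord_recl.
apply: (@le_trans _ _ (\sum_(0 <= k < n) `|f k.+1 - f k|)).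
  have an : (a <= n)%N by rewrite -ltnS.
  rewrite [leRHS](big_cat_nat (n := b))//=; last exact: leq_trans an.
  rewrite [X in _ + X](big_cat_nat (n := a))//=.
  have h m1 m2 : 0 <= \sum_(m1 <= k < m2) `|f k.+1 - f k| by exact: sumr_ge0.
  by have := h 0%N b; have := h a n; lra.
rewrite big_mkord; apply: (@le_trans _ _ (\sum_(i < n) `|F (lift ord0 i) - F (lift ord0 i - e)|)).
  apply: ler_sum => i _; rewrite /f le_eqVlt; apply/orP; left; apply/eqP.
  congr (`|F _ - F _|).
    by apply: val_inj; rewrite /= inordK// ltnS.
  apply: val_inj; rewrite /= inordK; last by rewrite ltnS ltnW.
  rewrite modnDmr /bump leq0n /=.
  case: n i => [[]//|m] i.
  have -> : (1 + i + (m.+2 - 1 %% m.+2) = i + m.+2)%N by rewrite modn_small//; lia.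
  by rewrite modnDr modn_small// ltnS ltnW// ltn_ord.
by rewrite lerDr.
Qed.

Let sum_abs_g k : \sum_x `|g k x| <= 2.
Proof.
apply: (@le_trans _ _ (\sum_x (half_walk k x + N^-1))).
  apply: ler_sum => x _; rewrite (le_trans (ler_normB _ _))//.
  by rewrite !ger0_norm ?half_walk_ge0// invr_ge0 ler0n.
rewrite big_split /= sum_half_walk sumr_const card_ord -[N^-1 *+ _]mulr_natl.
by rewrite mulfV ?pnatr_eq0//; lra.
Qed.

(** Otherwise [g k a] times the sum of [g k], which is zero, would be positive. *)
Let opposite_sign k a : exists b, g k a * g k b <= 0.
Proof.
apply: contrapT => /forallNP h.
have : 0 < \sum_x g k a * g k x.
  rewrite (bigD1 a)//= ltr_wpDr//; first by apply: sumr_ge0 => x _; rewrite leNgt; apply/negP => /ltW; exact: h.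
  by rewrite ltNge; apply/negP; exact: h.
by rewrite -mulr_sumr g_sum mulr0 ltxx.
Qed.

(** Poincare inequality: [g k] changes sign, so it is bounded by its total variation [V]; the excess
    is then at most [2 V], and [V ^ 2] is at most [N] times the energy by Cauchy-Schwarz. The
    resulting decay [N / k] is what is needed when the excess is multiplied by [1 / N]. *)
Lemma kernel_excess_spectral k : kernel_excess k ^+ 2 <= (16 * N) * (kernel_excess k - kernel_excess k.+1).
Proof.
set V := \sum_x `|g k x - g k (x - e)|.
have V0 : 0 <= V by exact: sumr_ge0.
have gV a : `|g k a| <= V.
  have [b gb] := opposite_sign k a; apply: le_trans (oscillation (g k) a b).
  exact: norm_opposite.
have eV : kernel_excess k <= 2 * V.
  apply: (@le_trans _ _ (\sum_x `|g k x| * V)).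
    by apply: ler_sum => x _; rewrite -real_normK ?num_real// expr2 ler_wpM2l.
  by rewrite -mulr_suml ler_wpM2r.
have V2 : V ^+ 2 <= N * energy k.
  have := cauchy_schwarz_sum (fun=> 1) (fun x => `|g k x - g k (x - e)|).
  rewrite (eq_bigr (fun x => `|g k x - g k (x - e)|)) => [|x _]; last by rewrite mul1r.
  rewrite [X in X * _](eq_bigr (fun=> 1)) => [|x _]; last by rewrite expr1n.
  rewrite sumr_const card_ord; congr (_ <= _ * _).
  by apply: eq_bigr => x _; rewrite real_normK// num_real.
rewrite -kernel_excessS in V2.
have := kernel_excess_ge0 k; nra.
Qed.

(** The total variation argument is applied to the signed square [G], which removes [N]: it gives
    [g ^ 2 <= W], hence [excess ^ 2 <= 4 W], while Cauchy-Schwarz gives [W ^ 2 <= 4 energy excess].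
    One factor of the excess then cancels. *)
Lemma kernel_excess_nash k : kernel_excess k ^+ 3 <= 256 * (kernel_excess k - kernel_excess k.+1).
Proof.
pose G x := g k x * `|g k x|.
set W := \sum_x `|g k x - g k (x - e)| * (`|g k x| + `|g k (x - e)|).
have W0 : 0 <= W by apply: sumr_ge0 => x _; rewrite mulr_ge0// addr_ge0.
have GW : \sum_x `|G x - G (x - e)| <= W.
  by apply: ler_sum => x _; exact: norm_signed_sqr.
have gW a : g k a ^+ 2 <= W.
  have [b gb] := opposite_sign k a; apply: le_trans GW; apply: le_trans (oscillation G a b).
  rewrite (_ : g k a ^+ 2 = `|G a|); last first.
    by rewrite /G normrM normr_id -expr2 real_normK// num_real.
  apply: norm_opposite; rewrite /G mulrACA -normrM; have := normr_ge0 (g k a * g k b); nra.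
have gsW a : `|g k a| <= Num.sqrt W by rewrite -sqrtr_sqr ler_wsqrtr.
have e2W : kernel_excess k <= 2 * Num.sqrt W.
  apply: (@le_trans _ _ (\sum_x `|g k x| * Num.sqrt W)).
    by apply: ler_sum => x _; rewrite -real_normK ?num_real// expr2 ler_wpM2l.
  by rewrite -mulr_suml ler_wpM2r// sqrtr_ge0.
have e4W : kernel_excess k ^+ 2 <= 4 * W.
  rewrite (_ : 4 * W = (2 * Num.sqrt W) ^+ 2); last by rewrite exprMn sqr_sqrtr//; ring.
  by rewrite lerXn2r// nnegrE ?kernel_excess_ge0// mulr_ge0// sqrtr_ge0.
have W2 : W ^+ 2 <= energy k * (4 * kernel_excess k).
  have := cauchy_schwarz_sum (fun x => `|g k x - g k (x - e)|) (fun x => `|g k x| + `|g k (x - e)|).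
  move=> /le_trans; apply; apply: ler_pM.
  - by apply: sumr_ge0 => x _; exact: sqr_ge0.
  - by apply: sumr_ge0 => x _; exact: sqr_ge0.
  - by apply: ler_sum => x _; rewrite real_normK// num_real.
  apply: (@le_trans _ _ (\sum_x (2 * g k x ^+ 2 + 2 * g k (x - e) ^+ 2))).
    apply: ler_sum => x _; rewrite -[g k x ^+ 2]real_normK ?num_real//.
    rewrite -[g k (x - e) ^+ 2]real_normK ?num_real//.
    have := sqr_ge0 (`|g k x| - `|g k (x - e)|); nra.
  by rewrite big_split /= -!mulr_sumr (sum_shift (fun x => g k x ^+ 2)) -/(kernel_excess k); lra.
rewrite -kernel_excessS in W2.
have E0 : 0 <= energy k by apply: sumr_ge0 => x _; exact: sqr_ge0.
rewrite -kernel_excessS in E0.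
have := kernel_excess_ge0 k; rewrite le_eqVlt => /orP[/eqP e0|e0].
  by rewrite -e0 in E0 *; rewrite expr0n /=; lra.
rewrite -(ler_pM2r e0) -exprSr.
apply: (@le_trans _ _ (16 * W ^+ 2)).
  rewrite (_ : kernel_excess k ^+ 4 = (kernel_excess k ^+ 2) ^+ 2); last by rewrite -exprM.
  rewrite (_ : 16 * W ^+ 2 = (4 * W) ^+ 2); last by ring.
  by rewrite lerXn2r// nnegrE ?sqr_ge0// mulr_ge0.
lra.
Qed.

Lemma kernel_excess_le_inv k : kernel_excess k <= 16 * N / k.+1%:R.
Proof.
have N1 : 1 <= N by rewrite ler1n.
have c1 : 1 <= 16 * N by lra.
have e01 j : 0 <= kernel_excess j <= 1 by rewrite kernel_excess_ge0 kernel_excess_le1.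
have := harmonic_decay c1 e01 kernel_excess_spectral k.
rewrite ler_pdivlMr//; apply: le_trans; rewrite ler_wpM2l ?kernel_excess_ge0//.
by rewrite -natr1; lra.
Qed.

(** [harmonic_decay] is applied to the square of the excess: the Nash bound is multiplied by [x],
    and [x (x - y) <= x ^ 2 - y ^ 2]. *)
Lemma kernel_excess_le_sqrt k : kernel_excess k <= 16 / Num.sqrt k.+1%:R.
Proof.
have e01 j : 0 <= kernel_excess j ^+ 2 <= 1.
  by rewrite sqr_ge0 expr_le1// ?kernel_excess_ge0 ?kernel_excess_le1.
have c1 : (1:R) <= 256 by lra.
have /(harmonic_decay c1 e01) h j : (kernel_excess j ^+ 2) ^+ 2 <=
    256 * (kernel_excess j ^+ 2 - kernel_excess j.+1 ^+ 2).
  have := kernel_excess_nash j; have := kernel_excess_ge0 j; have := kernel_excess_ge0 j.+1.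
  have := kernel_excess_le1 j; set x := kernel_excess j; set y := kernel_excess j.+1.
  move=> x1 y0 x0 h.
  have yx : y <= x by have : 0 <= x ^+ 3 by [rewrite exprn_ge0|]; lra.
  have : x * x ^+ 3 <= x * (256 * (x - y)) by rewrite ler_wpM2l.
  have : 0 <= y * (x - y) by rewrite mulr_ge0// subr_ge0.
  rewrite !expr2 exprS expr2; nra.
have s0 : 0 < Num.sqrt (k.+1%:R : R) by rewrite sqrtr_gt0.
rewrite ler_pdivlMr// -[leRHS]ger0_norm// -ler_sqr ?nnegrE//; last first.
  by rewrite mulr_ge0// ?kernel_excess_ge0// ltW.
rewrite ger0_norm// exprMn sqr_sqrtr//; apply: (@le_trans _ _ (kernel_excess k ^+ 2 * (k%:R + 256))).
  by rewrite ler_wpM2l ?sqr_ge0// -natr1; lra.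
by apply: le_trans (h k) _; lra.
Qed.

End cycle.

(** * Coordinates of the lazy walk on the cylinder *)

Section lazy_steps.
Context {R : realType}.

Definition line_step (G : zmodType) (e : G) (ba : bool * bool) : G :=
  if ba.2 then (if ba.1 then - e else e) else 0.

(* The lazy version of the walk with steps [st]: the second bit says whether
   the walk moves. *)
Definition lazy_step (G : zmodType) (C : finType) (st : C * bool -> G)
    (j : C * (bool * bool)) : G :=
  if j.2.2 then st (j.1, j.2.1) else 0.

Lemma avg_bool2 (F : bool * bool -> R) :
  avg F = (F (true, true) + F (true, false) + F (false, true) + F (false, false)) / 4.
Proof.
rewrite /avg card_prod card_bool; congr (_ / _).
rewrite (eq_bigr (fun p => (fun b a => F (b, a)) p.1 p.2)); last by case.
by rewrite -(pair_bigA _ (fun b a => F (b, a))) /= !big_bool /= !addrA.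
Qed.

Lemma avg_pair (I J : finType) (F : I * J -> R) :
  avg F = avg (fun i => avg (fun j => F (i, j))).
Proof.
rewrite /avg card_prod natrM invfM (eq_bigr (fun p => (fun i j => F (i, j)) p.1 p.2)); last by case.
by rewrite -(pair_bigA _ (fun i j => F (i, j))) /= -mulr_suml mulrAC mulrA.
Qed.

Lemma avg_lazy_step (G : zmodType) (C : finType) (st : C * bool -> G) (f : G -> R) x :
  (0 < #|C|)%N ->
  avg (fun j => f (x + lazy_step st j)) = (f x + avg (fun i => f (x + st i))) / 2.
Proof.
move=> C0; rewrite !avg_pair -[f x](avg_cst C0) -avgD mulrC -avgZ.
apply: eq_avg => c; rewrite avg_bool2 /lazy_step /= !addr0 /avg card_bool big_bool /=.
by field.
Qed.

(** A homomorphic image can only merge endpoints, which adds mass at the image of [y]. *)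
Lemma walk_prob_hom (G G' : zmodType) (I : finType) (st : I -> G) (st' : I -> G')
    (p : G -> G') : (forall x i, p (x + st i) = p x + st' i) ->
  forall n x y, walk_prob R st n x y <= walk_prob R st' n (p x) (p y).
Proof.
move=> hp; elim=> [|n IH] x y /=.
  by case: (eqVneq x y) => [->|_]; rewrite ?eqxx// ler0n.
by rewrite ler_wpM2r ?invr_ge0// ler_sum// => i _; rewrite -hp.
Qed.

(** [D k] is a region in which [k] more steps can be made without the projection confusing [y] with
    another point; one step leads from [D k.+1] into [D k]. *)
Lemma walk_prob_hom_eq (G G' : zmodType) (I : finType) (st : I -> G) (st' : I -> G')
    (p : G -> G') (y : G) (D : nat -> G -> Prop) :
  (forall x i, p (x + st i) = p x + st' i) ->
  (forall k x i, D k.+1 x -> D k (x + st i)) ->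
  (forall x, D 0%N x -> p x = p y -> x = y) ->
  forall n x, D n x -> walk_prob R st n x y = walk_prob R st' n (p x) (p y).
Proof.
move=> hp DS D0; elim=> [|n IH] x Dx /=.
  by congr (nat_of_bool _)%:R; apply/eqP/eqP => [->//|]; exact: D0.
by congr (_ / _); apply: eq_bigr => i _; rewrite -hp IH//; exact: DS.
Qed.

Lemma walk_prob_cycle n k (x y : 'I_n.+1) :
  walk_prob R (line_step (inZp 1)) k x y = lazy_kernel k (y - x).
Proof.
rewrite walk_probE; elim: k x => [|k IH] x /=; first by rewrite lazy_kernel0 subr_eq0 eq_sym.
rewrite avg_bool2 !IH lazy_kernelS /line_step /= !opprD !opprK !oppr0 !addr0 !addrA.
by congr (_ / _); ring.
Qed.

(** The bound on cycles does not depend on their length, so it passes to the line: project on a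
    cycle longer than [1 / eps], where the uniform part is at most [eps]. *)
Lemma walk_prob_int k (x y : int) :
  walk_prob R (line_step (1 : int)) k x y <= 16 / Num.sqrt k.+1%:R.
Proof.
apply/ler_addgt0Pr => eps eps0.
pose n := Num.trunc eps^-1; pose p (z : int) : 'I_n.+1 := inZp 1 *~ z.
have hp z ba : p (z + line_step (1 : int) ba) = p z + line_step (inZp 1) ba.
  rewrite /p mulrzDr; congr (_ + _); rewrite /line_step.
  by case: ifP => _; [case: ifP => _; rewrite ?mulrNz mulr1z|rewrite mulr0z].
apply: le_trans (walk_prob_hom hp _ _ _) _; rewrite walk_prob_cycle.
have := lazy_kernel_excess k (p y - p x) (R := R).
rewrite ler_norml => /andP[_]; rewrite lerBlDl => /le_trans; apply.
rewrite addrC lerD ?kernel_excess_le_sqrt//.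
rewrite invf_ple ?posrE// ltW//.
by have := truncnS_gt eps^-1.
Qed.

(** Every error term contains either [c * e j] or a product of two excesses, both linear in [a]. An
    isolated [e j], which in the application is only of the order of the square root of [a j], is
    avoided because there are two factors at least. The bounds add up to [16 + 128], rounded up to
    200. *)
Lemma prod_excess_le (d : nat) (c : R) (u e a : 'I_d -> R) : (2 <= d)%N ->
  0 <= c -> c <= 1 -> (forall j, 0 <= u j <= 1) -> (forall j, `|u j - c| <= e j) ->
  (forall j, 0 <= e j) -> (forall j, c * e j <= 16 * a j) ->
  (forall i j, e i * e j <= 128 * a i + 128 * a j) -> (forall j, 0 <= a j) ->
  `|\prod_(j < d) u j - c ^+ d| <= \sum_(j < d) 200 * a j.
Proof.
case: d u e a => [//|[//|m]] u e a _ c0 c1 u01 ue e0 ce ee P.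
rewrite big_ord_recl [in X in _ - X]exprS.
set p := \prod_(i < m.+1) _.
have hp : `|p - c ^+ m.+1| <= \sum_(i < m.+1) e (lift ord0 i).
  apply: le_trans (_ : \sum_(i < m.+1) `|u (lift ord0 i) - c| <= _); last by apply: ler_sum => i _; exact: ue.
  rewrite (_ : c ^+ m.+1 = \prod_(i < m.+1) c); last by rewrite prodr_const card_ord.
  by apply: (prod_diff_le _ (u := fun i => u (lift ord0 i))) => //; rewrite c0.
have p1 : p <= c + e (lift ord0 ord0).
  have := ue (lift ord0 ord0); rewrite ler_norml => /andP[_]; rewrite lerBlDl => h.
  apply: le_trans h; rewrite /p big_ord_recl ler_piMr//; first by case/andP: (u01 (lift ord0 ord0)).
  elim/big_rec: _ => // i z _ z1; have /andP[v0 v1] := u01 (lift ord0 (lift ord0 i)).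
  case: (lerP 0 z) => hz; first by rewrite mulr_ile1.
  by apply: le_trans ler01; rewrite mulr_ge0_le0// ltW.
have p0 : 0 <= p by apply: prodr_ge0 => i _; case/andP: (u01 (lift ord0 i)).
rewrite (_ : _ - _ = (u ord0 - c) * p + c * (p - c ^+ m.+1)); last by ring.
rewrite (le_trans (ler_normD _ _))// !normrM (ger0_norm p0) (ger0_norm c0).
have h1 : `|u ord0 - c| * p <= e ord0 * (c + e (lift ord0 ord0)).
  by rewrite ler_pM.
have h2 : c * `|p - c ^+ m.+1| <= \sum_(i < m.+1) 16 * a (lift ord0 i).
  apply: le_trans (ler_wpM2l c0 hp) _; rewrite mulr_sumr; apply: ler_sum => i _; exact: ce.
rewrite [leRHS]big_ord_recl.
have h3 := ce ord0; have h4 := ee ord0 (lift ord0 ord0).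
have h5 : \sum_(i < m.+1) 16 * a (lift ord0 i) + 128 * a (lift ord0 ord0)
   <= \sum_(i < m.+1) 200 * a (lift ord0 i) :> R.
  rewrite big_ord_recl [leRHS]big_ord_recl.
  have : \sum_(i < m) 16 * a (lift ord0 (lift ord0 i)) <=
    \sum_(i < m) 200 * a (lift ord0 (lift ord0 i)) :> R.
    by apply: ler_sum => i _; have := P (lift ord0 (lift ord0 i)); lra.
  have := P (lift ord0 ord0); lra.
have := P ord0; lra.
Qed.

End lazy_steps.

(** * Multinomial counts of the moves along each coordinate *)

Section counts.
Context {R : realType} {C : finType}.
Hypothesis C0 : (0 < #|C|)%N.

Definition incr (c : C) (kappa : C -> nat) : C -> nat := fun c' => (kappa c' + (c == c'))%N.

(* The expectation of Theta at the counts of n uniform letters, added to kappa. *)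
Fixpoint count_mean (n : nat) (Theta : (C -> nat) -> R) (kappa : C -> nat) : R :=
  if n is m.+1 then avg (fun c => count_mean m Theta (incr c kappa)) else Theta kappa.

Lemma ler_count_mean n Theta Theta' kappa : (forall k, Theta k <= Theta' k) ->
  count_mean n Theta kappa <= count_mean n Theta' kappa.
Proof. by move=> h; elim: n kappa => [|n IH] kappa //=; exact: ler_avg. Qed.

Lemma count_meanD n Theta Theta' kappa :
  count_mean n (fun k => Theta k + Theta' k) kappa =
  count_mean n Theta kappa + count_mean n Theta' kappa.
Proof. by elim: n kappa => [|n IH] kappa //=; rewrite -avgD; apply: eq_avg => c. Qed.

Lemma count_meanZ n a Theta kappa :
  count_mean n (fun k => a * Theta k) kappa = a * count_mean n Theta kappa.
Proof. by elim: n kappa => [|n IH] kappa //=; rewrite -avgZ; apply: eq_avg => c. Qed.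

Lemma count_mean_sum n (J : Type) (r : seq J) (Theta : J -> (C -> nat) -> R) kappa :
  count_mean n (fun k => \sum_(j <- r) Theta j k) kappa =
  \sum_(j <- r) count_mean n (Theta j) kappa.
Proof.
by elim: n kappa => [|n IH] kappa //=; rewrite -avg_sum; apply: eq_avg => c.
Qed.

Lemma count_mean_norm n Theta Theta' kappa : (forall k, `|Theta k| <= Theta' k) ->
  `|count_mean n Theta kappa| <= count_mean n Theta' kappa.
Proof.
move=> h; rewrite ler_norml -mulN1r -count_meanZ; apply/andP; split;
 apply: ler_count_mean => k; have := h k; rewrite ler_norml ?mulN1r => /andP[]//.
Qed.

(** The order of the moves is irrelevant once their numbers are known: adding a letter [c] to the
    counts amounts to averaging over one move of class [c]. Any family [W] with this property
    computes the walk by conditioning on the counts. *)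
Lemma count_mean_walk_op (G : zmodType) (J : finType) (st : C * J -> G)
    (W : (C -> nat) -> G -> R) :
  (forall kappa x c, W (incr c kappa) x = avg (fun j => W kappa (x + st (c, j)))) ->
  forall n kappa x, count_mean n (W ^~ x) kappa = walk_op st n (W kappa) x.
Proof.
move=> hW; elim=> [//|n IH] kappa x; rewrite walk_opSr /=.
rewrite (_ : walk_op st n _ x = walk_op st n (fun z => avg (fun c => W (incr c kappa) z)) x); last first.
  by apply: eq_walk_op => z; rewrite avg_pair; apply: eq_avg => c; rewrite hW.
have -> : walk_op st n (fun z => avg (fun c => W (incr c kappa) z)) x =
    avg (fun c => walk_op st n (W (incr c kappa)) x).
  elim: n x {IH} => [//|n IH] x /=.
  rewrite (eq_avg (H := fun i => avg (fun c => walk_op st n (W (incr c kappa)) (x + st i)))) => [|i]; last exact: IH.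
  exact: avg_exchange.
by apply: eq_avg => c; exact: IH.
Qed.

(* The mean of F(k + K) with K binomial of parameters n and 1/|C|. *)
Fixpoint binom_mean (n : nat) (F : nat -> R) (k : nat) : R :=
  if n is m.+1 then #|C|%:R^-1 * binom_mean m F k.+1 + (1 - #|C|%:R^-1) * binom_mean m F k
  else F k.

Lemma count_mean_marginal n F c kappa :
  count_mean n (fun k => F (k c)) kappa = binom_mean n F (kappa c).
Proof.
elim: n kappa => [//|n IH] kappa /=; rewrite (eq_avg (fun c' => IH (incr c' kappa))).
rewrite /avg (bigD1 c)//= {1}/incr eqxx addn1.
rewrite (eq_bigr (fun=> binom_mean n F (kappa c))); last first.
  by move=> c' /negbTE cc'; rewrite /incr cc' addn0.
rewrite sumr_const -[binom_mean _ _ _ *+ _]mulr_natl cardC1.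
have : (#|C|.-1%:R : R) = #|C|%:R - 1 by rewrite -[in RHS](prednK C0) -natr1 addrK.
have : (#|C|%:R : R) != 0 by rewrite pnatr_eq0 -lt0n.
by move=> h ->; field.
Qed.

Lemma binom_mean_shift n F k : binom_mean n (F \o S) k = binom_mean n F k.+1.
Proof. by elim: n k => [//|n IH] k /=; rewrite !IH. Qed.

Let p : R := #|C|%:R^-1.
Let p01 : 0 < p <= 1.
Proof. by rewrite invr_gt0 ltr0n C0 invf_le1 ?ler1n ?ltr0n. Qed.

Lemma ler_binom_mean n F H k : (forall j, F j <= H j) -> binom_mean n F k <= binom_mean n H k.
Proof.
move=> FH; have /andP[p0 p1] := p01; elim: n k => [//|n IH] k /=.
by apply: lerD; apply: ler_wpM2l => //; rewrite ?subr_ge0 ?(ltW p0).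
Qed.

Lemma binom_mean_cst n (c : R) k : binom_mean n (fun=> c) k = c.
Proof. by elim: n k => [//|n IH] k /=; rewrite !IH; ring. Qed.

Lemma binom_meanD n F H k :
  binom_mean n (fun j => F j + H j) k = binom_mean n F k + binom_mean n H k.
Proof. by elim: n k => [//|n IH] k /=; rewrite !IH; ring. Qed.

(** The starting count [k] is arbitrary because the recursion of [binom_mean] changes it. *)
Let size_bias m (f : nat -> R) k :
  binom_mean m.+1 (fun j => (j%:R - k%:R) * f j) k = m.+1%:R * p * binom_mean m f k.+1.
Proof.
elim: m k => [|m IH] k; first by rewrite /= subrr -natr1 /p; ring.
set F := fun j : nat => (j%:R - k%:R) * f j.
have E : binom_mean m.+1 F k.+1 = binom_mean m.+1 (fun j => (j%:R - k.+1%:R) * f j) k.+1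
    + binom_mean m.+1 f k.+1.
  rewrite -binom_meanD; congr binom_mean.
  by apply/funext => j; rewrite /F -[k.+1%:R]natr1; ring.
have -> : binom_mean m.+2 F k = p * binom_mean m.+1 F k.+1 + (1 - p) * binom_mean m.+1 F k by [].
rewrite E !IH -[in RHS]natr1 /= -/p; ring.
Qed.

(** The identity [k C(n, k) = n C(n - 1, k - 1)]. Taking for [g] an inverse of [k] turns it into a
    bound on inverse moments. *)
Lemma binom_size_bias n (g : nat -> R) :
  binom_mean n.+1 (fun k => k%:R * g k) 0 = n.+1%:R * p * binom_mean n (fun k => g k.+1) 0.
Proof.
have := size_bias n g 0; rewrite -binom_mean_shift => <-; congr binom_mean.
by apply/funext => j; rewrite subr0.
Qed.

Lemma binom_mean_inv n : binom_mean n (fun k => k.+1%:R^-1) 0 <= #|C|%:R / n.+1%:R.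
Proof.
have := binom_size_bias n (fun k => k%:R^-1).
have : binom_mean n.+1 (fun k => k%:R * k%:R^-1) 0 <= binom_mean n.+1 (fun=> 1) 0.
  apply: ler_binom_mean => -[|j]; first by rewrite mul0r.
  by rewrite mulfV// pnatr_eq0.
move=> h1 h2; rewrite h2 binom_mean_cst /p in h1.
have c0 : 0 < (#|C|%:R : R) by rewrite ltr0n.
by rewrite mulrAC ler_pdivrMr// mul1r in h1; rewrite ler_pdivlMr// mulrC.
Qed.

Lemma binom_mean_inv2 n :
  binom_mean n (fun k => (k.+1%:R * k.+2%:R)^-1) 0 <= #|C|%:R ^+ 2 / (n.+1%:R * n.+2%:R).
Proof.
have := binom_size_bias n (fun k => (k%:R * k.+1%:R)^-1).
have : binom_mean n.+1 (fun k => k%:R * (k%:R * k.+1%:R)^-1) 0 <= binom_mean n.+1 (fun k => k.+1%:R^-1) 0.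
  apply: ler_binom_mean => -[|j]; first by rewrite mul0r invr_ge0.
  by rewrite invfM mulrA mulfV ?mul1r// pnatr_eq0.
move=> h1 h2; have := le_trans h1 (binom_mean_inv n.+1); rewrite h2 /p => h.
have c0 : 0 < (#|C|%:R : R) by rewrite ltr0n.
have n0 : 0 < (n.+1%:R : R) by rewrite ltr0n.
rewrite mulrAC ler_pdivrMr// mulrAC ler_pdivlMr// in h.
rewrite ler_pdivlMr ?mulr_gt0// expr2; apply: le_trans h.
by rewrite le_eqVlt; apply/orP; left; apply/eqP; ring.
Qed.

Lemma count_mean_heat n (c c' : C) :
  count_mean n (fun k => (k c).+1%:R^-1 / Num.sqrt (k c').+1%:R) (fun=> 0%N) <=
  2 * #|C|%:R ^+ 2 / (n.+1%:R * Num.sqrt n.+1%:R).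
Proof.
set q := Num.sqrt (n.+1%:R : R).
have q0 : 0 < q by rewrite sqrtr_gt0 ltr0n.
have qq : q ^+ 2 = n.+1%:R by rewrite sqr_sqrtr.
(* Weighted AM-GM with [q = sqrt (n + 1)] separates the two dependent counts, so that marginals
   suffice; both terms have order [n ^ (-3/2)]. *)
apply: (@le_trans _ _ (count_mean n (fun k => q * ((k c).+1%:R * (k c).+2%:R)^-1
    + (2 * q)^-1 * (k c').+1%:R^-1) (fun=> 0%N))).
  apply: ler_count_mean => k; set a := (k c).+1%:R^-1; set b := (k c').+1%:R.
  have a0 : 0 <= a by rewrite invr_ge0.
  have b0 : 0 < b by rewrite ltr0n.
  have s0 : 0 < (Num.sqrt b)^-1 by rewrite invr_gt0 sqrtr_gt0.
  have bs : b^-1 = (Num.sqrt b)^-1 ^+ 2 by rewrite exprVn sqr_sqrtr// ltW.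
  have h : a ^+ 2 / 2 <= ((k c).+1%:R * (k c).+2%:R)^-1.
    rewrite expr2 invfM -mulrA ler_wpM2l// /a -invfM lef_pV2 ?posrE ?mulr_gt0//.
    by rewrite -natrM ler_nat; lia.
  apply: (@le_trans _ _ (q * (a ^+ 2 / 2) + (2 * q)^-1 * b^-1)); last first.
    by rewrite lerD2r ler_wpM2l// ltW.
  rewrite bs -(ler_pM2l q0) mulrDr invfM; set t := (Num.sqrt b)^-1 in s0 bs *.
  rewrite (_ : q * (2^-1 * q^-1 * _) = t ^+ 2 / 2); last by field; rewrite gt_eqF.
  have := sqr_ge0 (q * a - t); rewrite !expr2; nra.
rewrite count_meanD !count_meanZ (count_mean_marginal n (fun j => (j.+1%:R * j.+2%:R)^-1)).
rewrite (count_mean_marginal n (fun j => j.+1%:R^-1)).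
have h1 := binom_mean_inv2 n; have h2 := binom_mean_inv n.
set x := binom_mean _ _ _ in h1 *; set y := binom_mean _ _ _ in h2 *.
have c1 : 1 <= (#|C|%:R : R) by rewrite ler1n.
have n1 : 1 <= (n.+1%:R : R) by rewrite ler1n.
apply: (@le_trans _ _ (q * (#|C|%:R ^+ 2 / n.+1%:R ^+ 2) + (2 * q)^-1 * (#|C|%:R / n.+1%:R))).
  rewrite lerD// ler_wpM2l ?invr_ge0 ?mulr_ge0 ?(ltW q0)//.
  apply: le_trans h1 _; rewrite ler_wpM2l ?sqr_ge0// lef_pV2 ?posrE ?mulr_gt0//.
  by rewrite expr2 ler_wpM2l// ler_nat.
rewrite -qq (_ : q * _ + _ = (#|C|%:R ^+ 2 + #|C|%:R / 2) / (q ^+ 2 * q)); last first.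
  by field; rewrite gt_eqF.
rewrite ler_wpM2r ?invr_ge0 ?mulr_ge0 ?sqr_ge0 ?ltW//.
rewrite expr2; nra.
Qed.

End counts.

(** * Equidistribution of the lazy kernel over the torus *)

Section cylinder_kernel.
Context {R : realType} (d N : nat).
Notation lst := (lazy_step (@cylinder_step d N)).
Notation n := N.-1.

Let cyc (k : nat) (x y : 'I_n.+1) : R := walk_prob R (line_step (inZp 1)) k x y.
Let lin (k : nat) (x y : int) : R := walk_prob R (line_step (1 : int)) k x y.

Notation C := (option 'I_d).
Let C0 : (0 < #|{: C}|)%N. Proof. by rewrite card_option. Qed.

Let cycS k x y : cyc k.+1 x y = avg (fun ba => cyc k (x + line_step (inZp 1) ba) y).
Proof. by []. Qed.
Let linS k x y : lin k.+1 x y = avg (fun ba => lin k (x + line_step (1:int) ba) y).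
Proof. by []. Qed.

(** The kernel given the counts [kappa]: a product over coordinates. At [kappa = 0] it is the
    indicator of [y], and [W_incr] is the hypothesis of [count_mean_walk_op]. *)
Let W (y : cylinder d N) (kappa : C -> nat) (x : cylinder d N) : R :=
  (\prod_(j < d) cyc (kappa (Some j)) (x.1 0 j) (y.1 0 j)) * lin (kappa None) x.2 y.2.

Let lstSome (x : cylinder d N) k ba j :
  (x + lst (Some k, ba)).1 0 j = x.1 0 j + (if j == k then line_step (inZp 1) ba else 0).
Proof.
case: ba => b [] /=; rewrite /lazy_step /line_step /=; last by rewrite mxE mxE; case: ifP.
by rewrite !mxE; case: ifP => //; case: b.
Qed.

Let lstSome2 (x : cylinder d N) k ba : (x + lst (Some k, ba)).2 = x.2.
Proof. by case: ba => b [] /=; rewrite /lazy_step /= addr0. Qed.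

Let lstNone (x : cylinder d N) ba : (x + lst (None, ba)).1 = x.1.
Proof. by case: ba => b [] /=; rewrite /lazy_step /= addr0. Qed.

Let lstNone2 (x : cylinder d N) ba : (x + lst (None, ba)).2 = x.2 + line_step (1:int) ba.
Proof. by case: ba => [[]] [] /=; rewrite /lazy_step /line_step //= ?expr0 ?expr1. Qed.

Let W_incr y kappa x c : W y (incr c kappa) x = avg (fun ba => W y kappa (x + lst (c, ba))).
Proof.
case: c => [k|]; rewrite /W.
  rewrite (bigD1 k)// {1}/incr eqxx addn1 cycS -mulrA mulrC -avgZ.
  apply: eq_avg => ba; rewrite lstSome2 [in RHS](bigD1 k)// lstSome eqxx.
  rewrite (eq_bigr (fun i => cyc (kappa (Some i)) ((x + lst (Some k, ba)).1 0 i) (y.1 0 i))).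
    have -> : incr (Some k) kappa None = kappa None by exact: addn0.
    set A := \big[_/_]_(i | _) _; set B := cyc _ _ _; set D := lin _ _ _.
    by rewrite [RHS](_ : _ = B * A * D)//; ring.
  move=> j /andP[_ jk]; rewrite lstSome (negbTE jk) addr0 /incr.
  by rewrite (_ : (Some k == Some j) = false) ?addn0//; apply: contraNF jk => /eqP [->].
rewrite {2}/incr eqxx addn1 linS -avgZ; apply: eq_avg => ba.
by rewrite lstNone lstNone2; congr (_ * _); apply: eq_bigr => j _; rewrite /incr /= addn0.
Qed.

(* The vertical part of the walk, as a function on the cylinder. *)
Definition vertical_kernel (k : nat) (x y : cylinder d N) : R :=
  walk_op lst k (fun z => (z.2 == y.2)%:R) x.

Let walk_prob_W k x y : walk_prob R lst k x y = count_mean k (fun kappa => W y kappa x) (fun=> 0%N).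
Proof.
rewrite (count_mean_walk_op (st := lst) (W_incr y)) walk_probE.
apply: eq_walk_op => z; rewrite /W /= /cyc /lin /=.
have [->|zy] := eqVneq z y.
  by rewrite eqxx mulr1 big1// => j _; rewrite eqxx.
have [h|_] := eqVneq z.2 y.2; last by rewrite mulr0.
rewrite mulr1; have : z.1 != y.1.
  by apply: contraNneq zy => h1; apply/eqP; rewrite [z]surjective_pairing h1 h -surjective_pairing.
move=> z1; have /existsP[j zj] : [exists j, z.1 0 j != y.1 0 j].
  rewrite -[X in is_true X]negbK negb_exists; apply/negP => /forallP h'; move/negP: z1; apply.
  by apply/eqP/rowP => j; apply/eqP; have := h' j; rewrite negbK.
by rewrite (bigD1 j)//= (negbTE zj) mul0r.
Qed.

Let vertical_W k x y : vertical_kernel k x y = count_mean k (fun kappa : C -> nat => lin (kappa None) x.2 y.2) (fun=> 0%N).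
Proof.
rewrite (count_mean_walk_op (st := lst) (W := fun (kappa : C -> nat) x => lin (kappa None) x.2 y.2)).
  by apply: eq_walk_op => z.
move=> kappa z [j|].
  rewrite (_ : incr (Some j) kappa None = kappa None); last exact: addn0.
  rewrite (eq_avg (H := fun=> lin (kappa None) z.2 y.2)).
    by rewrite avg_cst// card_prod card_bool.
  by move=> ba; rewrite lstSome2.
rewrite {1}/incr eqxx addn1 linS; apply: eq_avg => ba.
by rewrite lstNone2.
Qed.

Let c : R := n.+1%:R^-1.
Let c01 : 0 <= c <= 1.
Proof. by rewrite invr_ge0 ler0n invf_le1 ?ltr0n// ler1n. Qed.

Let cyc01 k x y : 0 <= cyc k x y <= 1.
Proof. by apply: walk_prob01; rewrite card_prod card_bool. Qed.

Let cyc_excess k x y : `|cyc k x y - c| <= kernel_excess n k (R := R).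
Proof. by rewrite /cyc walk_prob_cycle lazy_kernel_excess. Qed.

Let c_excess k : c * kernel_excess n k <= 16 / k.+1%:R.
Proof.
have /andP[c0 _] := c01; apply: le_trans (ler_wpM2l c0 (kernel_excess_le_inv n k)) _.
by rewrite mulrA (mulrCA c) /c mulVf ?pnatr_eq0// mulr1.
Qed.

Let prod_cyc_le (kappa : 'I_d -> nat) (x y : 'rV['I_n.+1]_d) : (2 <= d)%N ->
  `|\prod_(j < d) cyc (kappa j) (x 0 j) (y 0 j) - c ^+ d| <= \sum_(j < d) 200 / (kappa j).+1%:R.
Proof.
move=> d2; pose u j := cyc (kappa j) (x 0 j) (y 0 j).
pose e j := kernel_excess n (kappa j) (R := R).
have /andP[c0 c1] := c01.
have u01 j : 0 <= u j <= 1 by exact: cyc01.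
have ue j : `|u j - c| <= e j by exact: cyc_excess.
have e0 j : 0 <= e j by exact: kernel_excess_ge0.
have ce j : c * e j <= 16 / (kappa j).+1%:R by exact: c_excess.
have ee i j : e i * e j <= 128 / (kappa i).+1%:R + 128 / (kappa j).+1%:R.
  have h k : e k ^+ 2 <= 256 / (kappa k).+1%:R.
    have := kernel_excess_le_sqrt n (kappa k) (R := R); rewrite -/(e k).
    move=> h; apply: (@le_trans _ _ ((16 / Num.sqrt (kappa k).+1%:R) ^+ 2)).
      by rewrite lerXn2r// nnegrE ?e0// divr_ge0.
    by rewrite expr_div_n sqr_sqrtr// ler_wpM2r// ?invr_ge0//; lra.
  apply: (@le_trans _ _ ((e i ^+ 2 + e j ^+ 2) / 2)).
    by have := sqr_ge0 (e i - e j); nra.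
  by move: (h i) (h j); move: (e i ^+ 2) (e j ^+ 2) ((kappa i).+1%:R^-1) ((kappa j).+1%:R^-1) => *; lra.
apply: (@prod_excess_le _ _ c u e (fun j => (kappa j).+1%:R^-1)) => //.
Qed.

(** For each torus coordinate [80 * 80 = 200 * 16 * 2]: 200 from [prod_excess_le], 16 from
    [walk_prob_int] for the height, 2 from [count_mean_heat], which also brings the square of the
    number of letters. *)
Definition heat_const : R := d%:R * (80 * 80 * d.+1%:R ^+ 2).

Lemma heat_const_ge0 : 0 <= heat_const.
Proof. by rewrite /heat_const !mulr_ge0 ?sqr_ge0 ?ler0n. Qed.

(* Uniform in N: the law of the walk is its vertical part spread evenly over
   the torus, up to a summable error. *)
Lemma heat_kernel_bound k (x y : cylinder d N) : (2 <= d)%N ->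
  `|walk_prob R lst k x y - c ^+ d * vertical_kernel k x y| <=
  heat_const / (k.+1%:R * Num.sqrt k.+1%:R).
Proof.
move=> d2; rewrite walk_prob_W vertical_W -count_meanZ -mulN1r -count_meanZ -count_meanD.
have H (kappa : C -> nat) : `|W y kappa x + -1 * (c ^+ d * lin (kappa None) x.2 y.2)| <=
    \sum_(j < d) 3200 * ((kappa (Some j)).+1%:R^-1 / Num.sqrt (kappa None).+1%:R).
  rewrite mulN1r /W -mulrBl normrM.
  have lin0 : 0 <= lin (kappa None) x.2 y.2.
    have B0 : (0 < #|{: bool * bool}|)%N by rewrite card_prod card_bool.
    by case/andP: (walk_prob01 (R := R) (line_step (1:int)) B0 (kappa None) x.2 y.2).
  rewrite (ger0_norm lin0).
  apply: le_trans (ler_pM _ _ (prod_cyc_le (fun j => kappa (Some j)) x.1 y.1 d2) (walk_prob_int (kappa None) x.2 y.2)) _ => //.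
  rewrite mulr_suml; apply: ler_sum => j _.
  by rewrite le_eqVlt; apply/orP; left; apply/eqP; ring.
apply: le_trans (count_mean_norm _ _ H) _.
rewrite count_mean_sum /heat_const -mulrA mulr_natl.
apply: (@le_trans _ _ (\sum_(j < d) 80 * 80 * d.+1%:R ^+ 2 / (k.+1%:R * Num.sqrt k.+1%:R))).
  apply: ler_sum => j _; rewrite count_meanZ.
  have := count_mean_heat C0 k (Some j) None (R := R); rewrite card_option card_ord.
  by move=> h; apply: le_trans (ler_wpM2l _ h) _; [lra|rewrite le_eqVlt; apply/orP; left; apply/eqP; ring].
by rewrite sumr_const card_ord mulr_natl.
Qed.

Lemma vertical_kernel01 k x y : 0 <= vertical_kernel k x y <= 1.
Proof.
have L0 : (0 < #|{: option 'I_d * (bool * bool)}|)%N.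
  by rewrite !card_prod card_bool muln_gt0 C0.
rewrite /vertical_kernel; elim: k x => [|k IH] x /=; first by case: eqP; rewrite ?lexx ?ler01.
apply/andP; split; first by apply: avg_ge0 => i; case/andP: (IH (x + lst i)).
by rewrite -[leRHS](avg_cst L0); apply: ler_avg => i; case/andP: (IH (x + lst i)).
Qed.

End cylinder_kernel.

(** * Killed Green functions *)

Section summable_tails.
Context {R : realType}.

Definition heat_tail (k : nat) : R := (k.+1%:R * Num.sqrt k.+1%:R)^-1.

Lemma heat_tail_le1 k : heat_tail k <= 1.
Proof.
rewrite invf_le1 ?mulr_gt0 ?sqrtr_gt0// mulr_ege1 ?ler1n//.
by rewrite -[leLHS]sqrtr1 ler_wsqrtr// ler1n.
Qed.

(** [k ^ (-3/2)] is comparable to an increment of [k ^ (-1/2)]. Since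
    [q ^ 2 = p ^ 2 + 1 <= 2 p ^ 2], the constant 6 leaves room in [(q + p) q <= 6 p ^ 2]. *)
Lemma heat_tail_telescope k :
  heat_tail k <= 6 * ((Num.sqrt k.+1%:R)^-1 - (Num.sqrt k.+2%:R)^-1).
Proof.
rewrite /heat_tail; set p := Num.sqrt (k.+1%:R : R); set q := Num.sqrt (k.+2%:R : R).
have p0 : 0 < p by rewrite sqrtr_gt0.
have q0 : 0 < q by rewrite sqrtr_gt0.
have pp : p ^+ 2 = k.+1%:R by rewrite sqr_sqrtr.
have qq : q ^+ 2 = p ^+ 2 + 1 by rewrite pp sqr_sqrtr// natr1.
have p1 : 1 <= p ^+ 2 by rewrite pp ler1n.
have pq : (q - p) * (q + p) = 1 by rewrite -subr_sqr qq addrC addKr.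
rewrite -pp.
have h : (q + p) * q <= 6 * p ^+ 2.
  by have := sqr_ge0 (q - p); rewrite !expr2 in qq p1 *; nra.
rewrite -(ler_pM2r (_ : 0 < (p ^+ 2 * p) * (q * (q + p)))); last first.
  by rewrite !mulr_gt0// ?addr_gt0// exprn_gt0.
rewrite mulKf; last by rewrite gt_eqF// mulr_gt0// exprn_gt0.
rewrite [leRHS](_ : _ = 6 * p ^+ 2 * ((q - p) * (q + p))).
  by rewrite pq mulr1 mulrC.
by field; rewrite !gt_eqF.
Qed.

Lemma sum_heat_tail m n : (m <= n)%N ->
  \sum_(m <= k < n) heat_tail k <= 6 / Num.sqrt m.+1%:R.
Proof.
move=> mn; apply: (@le_trans _ _ (\sum_(m <= k < n) 6 * ((Num.sqrt k.+1%:R)^-1 - (Num.sqrt k.+2%:R)^-1))).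
  by apply: ler_sum => k _; exact: heat_tail_telescope.
rewrite -mulr_sumr ler_wpM2l//.
rewrite (eq_bigr (fun k => - (Num.sqrt k.+2%:R)^-1 - - (Num.sqrt k.+1%:R)^-1)); last first.
  by move=> k _; rewrite opprK addrC.
rewrite (telescope_sumr (fun k => - (Num.sqrt k.+1%:R)^-1))// opprK addrC.
by rewrite gerDl oppr_le0 invr_ge0 sqrtr_ge0.
Qed.

(** The bound is free of [t], so it survives the limit of vanishing killing. *)
Lemma gsum_tail (t A : R) (a : R^nat) m : 0 <= t < 1 ->
  (forall k, `|a k| <= A * heat_tail k) ->
  `|gsum t a - \sum_(0 <= k < m) t ^+ k * a k| <= 6 * A / Num.sqrt m.+1%:R.
Proof.
move=> t01 aA; have /andP[t0 t1] := t01.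
have A0 : 0 <= A.
  have := le_trans (normr_ge0 _) (aA 0%N).
  by rewrite pmulr_lge0// /heat_tail invr_gt0 mulr_gt0// sqrtr_gt0.
have aB k : `|a k| <= A by apply: le_trans (aA k) _; rewrite ler_piMr// heat_tail_le1.
have cv := gsum_is_cvg t01 aB.
set S := \sum_(0 <= k < m) _; set B := 6 * A / _.
have : forall n, (m <= n)%N -> `|series (fun k => t ^+ k * a k) n - S| <= B.
  move=> n mn; rewrite /series/= (big_cat_nat (n := m))//= -/S addrAC subrr add0r.
  rewrite (le_trans (ler_norm_sum _ _ _))//.
  apply: (@le_trans _ _ (\sum_(m <= k < n) A * heat_tail k)).
    apply: ler_sum => k _; rewrite normrM normrX (ger0_norm t0).
    apply: le_trans (aA k); rewrite ler_piMl// exprn_ile1// ltW//.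
  rewrite -mulr_sumr /B -mulrA mulrCA ler_wpM2l//; exact: sum_heat_tail.
move=> h; rewrite ler_norml; apply/andP; split.
  rewrite lerBrDr; apply: limr_ge => //; near=> n.
  by have := h n; rewrite ler_norml lerBrDr => /(_ _)/andP[]//; near: n; exact: nbhs_infty_ge.
rewrite lerBlDr; apply: limr_le => //; near=> n.
by have := h n; rewrite ler_norml lerBlDr => /(_ _)/andP[]//; near: n; exact: nbhs_infty_ge.
Unshelve. all: by end_near. Qed.

End summable_tails.

(** * Hitting transforms as ratios of lazy Green functions *)

Section lazy_green.
Context {R : realType} {G : zmodType} {C : finType} (st : C * bool -> G).
Hypothesis C0 : (0 < #|C|)%N.

(** The solution [t] of [1 - t (1 + P) / 2 = (1 - s P) / (1 + s)]. *)
Definition lazy_rate (s : R) : R := 2 * s / (1 + s).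

Lemma lazy_rate01 s : 0 <= s < 1 -> 0 <= lazy_rate s < 1.
Proof.
move=> /andP[s0 s1]; have s2 : 0 < 1 + s by lra.
by apply/andP; split; [rewrite divr_ge0 ?mulr_ge0// ltW|rewrite ltr_pdivrMr//; lra].
Qed.

Definition lazy_green (t : R) (x y : G) : R := gsum t (fun k => walk_prob R (lazy_step st) k x y).

Let L0 : (0 < #|{: C * (bool * bool)}|)%N.
Proof. by rewrite !card_prod card_bool muln_gt0 C0. Qed.
Let I0 : (0 < #|{: C * bool}|)%N.
Proof. by rewrite card_prod card_bool muln_gt0 C0. Qed.

Lemma indicator_norm (T : eqType) (y x : T) : `|(x == y)%:R| <= 1 :> R.
Proof. by case: eqP => _; rewrite ?normr1 ?normr0 ?ler01. Qed.

Lemma lazy_greenE t x y : lazy_green t x y = resolvent (lazy_step st) t (fun z => (z == y)%:R) x.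
Proof. by congr gsum; apply/funext => k; rewrite walk_probE. Qed.

Lemma lazy_green_rec t x y : 0 <= t < 1 -> lazy_green t x y =
  (x == y)%:R + t * ((lazy_green t x y + avg (fun i => lazy_green t (x + st i) y)) / 2).
Proof.
move=> t01; rewrite {1}lazy_greenE (resolvent_rec (lazy_step st) L0 x t01 (indicator_norm y)).
congr (_ + _ * _); rewrite -(avg_lazy_step st (fun z => lazy_green t z y))//.
by apply: eq_avg => j; rewrite lazy_greenE.
Qed.

Lemma lazy_green_bound t x y : 0 <= t < 1 -> `|lazy_green t x y| <= 1 / (1 - t).
Proof. by move=> t01; rewrite lazy_greenE; apply: resolvent_norm => //; exact: indicator_norm. Qed.

Lemma walk_prob_norm (J : finType) (st' : J -> G) k x y : (0 < #|J|)%N -> `|walk_prob R st' k x y| <= 1.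
Proof. by move=> J0; case/andP: (walk_prob01 (R := R) st' J0 k x y) => a b; rewrite ger0_norm. Qed.

Lemma lazy_green_diag_ge1 t y : 0 <= t < 1 -> 1 <= lazy_green t y y.
Proof.
move=> t01; rewrite /lazy_green (gsum_recl t01 (fun k => walk_prob_norm (lazy_step st) k y y L0)).
rewrite /= eqxx lerDl mulr_ge0//; first by case/andP: t01.
apply: (gsum_ge0 t01 (fun k => walk_prob_norm (lazy_step st) k.+1 y y L0)) => k.
by case/andP: (walk_prob01 (R := R) (lazy_step st) L0 k.+1 y y).
Qed.

(* (1 + s) (1 - s P)^{-1} is the resolvent of the lazy walk at [lazy_rate s]. *)
Lemma lazy_green_step s x y : 0 <= s < 1 ->
  lazy_green (lazy_rate s) x y =
  (1 + s) * (x == y)%:R + s * avg (fun i => lazy_green (lazy_rate s) (x + st i) y).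
Proof.
move=> s01; have /andP[s0 s1] := s01.
have := lazy_green_rec x y (lazy_rate01 s01).
set g := lazy_green _ x y; set a := avg _; set i := (_ == _)%:R => h.
have s2 : 1 + s != 0 by rewrite gt_eqF//; lra.
have {}h : (1 + s) * g = (1 + s) * i + s * (g + a).
  by rewrite {1}h /lazy_rate; field.
lra.
Qed.

(** The quotient is 1 at [y] and, by [lazy_green_step], solves the recursion elsewhere, as
    [coverL1_eq] requires. *)
Lemma coverL1_green s x y : 0 <= s < 1 ->
  coverL st s x [fset y]%fset = lazy_green (lazy_rate s) x y / lazy_green (lazy_rate s) y y.
Proof.
move=> s01; have t01 := lazy_rate01 s01.
have g1 := lazy_green_diag_ge1 y t01.
have g0 : lazy_green (lazy_rate s) y y != 0 by rewrite gt_eqF// (lt_le_trans ltr01).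
apply: (@coverL1_eq _ _ _ st I0 s (fun z => lazy_green (lazy_rate s) z y / lazy_green (lazy_rate s) y y)
   (1 / (1 - lazy_rate s))) => // [z||z zy].
- rewrite normrM [leRHS](_ : _ = (1 / (1 - lazy_rate s)) * 1); last by rewrite mulr1.
  rewrite ler_pM//; first exact: lazy_green_bound.
  by rewrite normfV ger0_norm ?(le_trans ler01)// invf_le1// (lt_le_trans ltr01).
- exact: mulfV.
- rewrite {1}(lazy_green_step z y s01) (negbTE zy) mulr0 add0r -mulrA; congr (_ * _).
  by rewrite mulrC -avgZ; apply: eq_avg => i; rewrite mulrC.
Qed.

(** As [s] tends to 1 the factor [1 + s] tends to 2: the lazy walk stays twice as long everywhere.
    This identity carries the lazy estimates back to [g(0)]. *)
Lemma green_lazy_green s x y : 0 <= s < 1 ->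
  (1 + s) * gsum s (fun k => walk_prob R st k x y) = lazy_green (lazy_rate s) x y.
Proof.
move=> s01; have t01 := lazy_rate01 s01; have /andP[s0 s1] := s01.
have s2 : 1 + s != 0 by rewrite gt_eqF//; lra.
have H : forall z, lazy_green (lazy_rate s) z y / (1 + s) = resolvent st s (fun w => (w == y)%:R) z.
  apply: (@walk_op_resolvent_unique _ _ _ st I0 s _ _ 1 (1 / (1 - lazy_rate s))) => // [z|z|z].
  - exact: indicator_norm.
  - rewrite normrM [leRHS](_ : _ = (1 / (1 - lazy_rate s)) * 1); last by rewrite mulr1.
    rewrite ler_pM//; first exact: lazy_green_bound.
    by rewrite normfV ger0_norm ?invf_le1//; lra.
  - rewrite {1}(lazy_green_step z y s01) mulrDl mulrAC mulfV// mul1r; congr (_ + _).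
    by rewrite -mulrA; congr (_ * _); rewrite mulrC -avgZ; apply: eq_avg => i; rewrite mulrC.
rewrite [X in _ * X](_ : _ = lazy_green (lazy_rate s) x y / (1 + s)); first by field.
by rewrite H /resolvent; congr gsum; apply/funext => k; rewrite walk_probE.
Qed.

End lazy_green.

(** * Geometric height profile and increments of the killed Green function *)

Section cylinder_green.
Context {R : realType} (d N : nat).
Hypothesis d2 : (2 <= d)%N.
Notation lst := (lazy_step (@cylinder_step d N)).
Notation n := N.-1.
Let c : R := (n.+1%:R^-1) ^+ d.
Notation D := (d.+1%:R : R).

Let C0 : (0 < #|{: option 'I_d}|)%N. Proof. by rewrite card_option. Qed.
Let L0 : (0 < #|{: option 'I_d * (bool * bool)}|)%N.
Proof. by rewrite !card_prod card_bool muln_gt0 C0. Qed.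

Let c01 : 0 <= c <= 1.
Proof. by rewrite exprn_ge0 ?invr_ge0//= exprn_ile1// ?invr_ge0// invf_le1 ?ltr0n// ler1n. Qed.

Lemma avg_cylinder_vertical (f : int -> R) (x : cylinder d N) :
  avg (fun i => f (x + cylinder_step N i).2) =
  (d%:R * f x.2 + (f (x.2 + 1) + f (x.2 - 1)) / 2) / D.
Proof.
rewrite avg_pair {1}/avg card_option card_ord; congr (_ / _).
rewrite (bigD1 None)//= (eq_bigr (fun=> f x.2)) => [|[k|]//]; last first.
  move=> _; rewrite (eq_avg (H := fun=> f x.2)) => [|b /=]; last by rewrite addr0.
  by rewrite avg_cst// card_bool.
rewrite sumr_const -[_ *+ _]mulr_natl addrC; congr (_%:R * _ + _).
  by rewrite cardC1 card_option card_ord.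
by rewrite /avg card_bool big_bool /= expr1 expr0 addrC.
Qed.

(** The height of the lazy walk moves up or down with probability [1 / (4 D)] each, so its resolvent
    is a two-sided geometric function. The relation between [t] and [rho] is the characteristic
    equation away from height difference 0; the source at 0 fixes the prefactor. *)
Lemma vertical_resolvent (t rho : R) (x y : cylinder d N) : 0 < t < 1 -> 0 < rho < 1 ->
  4 * D * rho * (1 - t) = t * (1 - rho) ^+ 2 ->
  gsum t (fun k => vertical_kernel k x y) =
  4 * D * rho / (t * (1 - rho) * (1 + rho)) * rho ^+ absz (x.2 - y.2).
Proof.
move=> /andP[t0 t1] /andP[r0 r1] hrho.
set A := 4 * D * rho / _.
have D0 : 0 < D by rewrite ltr0n.
have A0 : 0 <= A by rewrite divr_ge0 ?mulr_ge0// ?ltW//; lra.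
have t01 : 0 <= t < 1 by rewrite ltW.
apply/esym; rewrite -/(resolvent lst t (fun z => (z.2 == y.2)%:R) x).
move: x; apply: (@walk_op_resolvent_unique _ _ _ lst L0 t _ _ 1 A) => // [z|z|z].
- exact: indicator_norm.
- rewrite ger0_norm; last by rewrite mulr_ge0// exprn_ge0// ltW.
  by rewrite ler_piMr// exprn_ile1// ltW.
rewrite (avg_lazy_step (@cylinder_step d N) (fun w : cylinder d N => A * rho ^+ absz (w.2 - y.2)))//.
rewrite (avg_cylinder_vertical (fun v => A * rho ^+ absz (v - y.2))).
have AE : A * (t * (1 - rho) * (1 + rho)) = 4 * D * rho.
  by rewrite /A mulfVK// !mulf_neq0// gt_eqF//; lra.
have tE : 4 * D * rho = t * (4 * D * rho + (1 - rho) ^+ 2) by lra.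
have dE : d%:R = D - 1 by rewrite -natr1 addrK.
(* [q], [qp], [qm] stand for the power of [rho] at a height and at its two neighbours. Once
   denominators are cleared, only a second difference of [rho ^ |z|] is left, computed according to
   the sign of [z]. *)
have key (q qp qm i : R) : (1 - rho) ^+ 2 * q = (1 - rho) * (1 + rho) * i + rho * (qp + qm - 2 * q) ->
    A * q = i + t * ((A * q + (d%:R * (A * q) + (A * qp + A * qm) / 2) / D) / 2).
  move=> K; apply/eqP; rewrite -subr_eq0.
  have nz : 4 * D * rho != 0 by rewrite !mulf_neq0// gt_eqF.
  rewrite -[_ == 0]orFb -(negbTE nz) -mulf_eq0 dE; apply/eqP.
  rewrite [LHS](_ : _ = (4 * D * rho * (1 - t)) * (A * q) - (4 * D * rho) * i
      - t * A * rho * (qp + qm - 2 * q)); last by field; rewrite gt_eqF.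
  rewrite hrho -AE.
  rewrite [LHS](_ : _ = t * A * ((1 - rho) ^+ 2 * q - ((1 - rho) * (1 + rho) * i + rho * (qp + qm - 2 * q)))); last by ring.
  by rewrite K subrr mulr0.
apply: key; rewrite (addrAC z.2 1) (addrAC z.2 (-1)) -subr_eq0.
move: (z.2 - y.2) => [[|m]|m].
- by rewrite eqxx (_ : absz (0 + 1) = 1%N)// (_ : absz (0 - 1) = 1%N)//=; ring.
- have -> : absz (Posz m.+1 + 1) = m.+2 by lia.
  have -> : absz (Posz m.+1 - 1) = m by lia.
  by rewrite /= !exprS; ring.
- have -> : absz (Negz m + 1) = m by lia.
  have -> : absz (Negz m - 1) = m.+2 by lia.
  by rewrite /= !exprS; ring.
Qed.

Section comparison.
Variables (t rho : R) (m : nat).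
Hypothesis t01 : 0 < t < 1.
Hypothesis rho01 : 0 < rho < 1.
Hypothesis hrho : 4 * D * rho * (1 - t) = t * (1 - rho) ^+ 2.

Definition vertical_green (z : int) : R :=
  (n.+1%:R^-1) ^+ d * (4 * D * rho / (t * (1 - rho) * (1 + rho)) * rho ^+ absz z).

Let K : R := heat_const d.
Let t01' : 0 <= t < 1. Proof. by case/andP: t01 => a b; rewrite ltW. Qed.

Let vk_norm k (x y : cylinder d N) : `|vertical_kernel (R := R) k x y| <= 1.
Proof. by apply: walk_op_norm => // z; exact: indicator_norm. Qed.

Let p_norm k (x y : cylinder d N) : `|walk_prob R lst k x y| <= 1.
Proof. exact: walk_prob_norm. Qed.

Let cvk_norm k (x y : cylinder d N) : `|c * vertical_kernel k x y| <= 1 :> R.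
Proof.
have /andP[c0 c1] := c01; rewrite normrM (ger0_norm c0) mulr_ile1//; exact: vk_norm.
Qed.

Let gsum_diff (x y : cylinder d N) : gsum t (fun k => walk_prob R lst k x y - c * vertical_kernel k x y) =
  lazy_green (@cylinder_step d N) t x y - vertical_green (x.2 - y.2).
Proof.
rewrite -mulN1r /vertical_green -vertical_resolvent// -/c.
rewrite -(gsumZ c t01' (fun k => vk_norm k x y)) -(gsumZ (-1) t01' (fun k => cvk_norm k x y)).
rewrite -(gsumD t01' (fun k => p_norm k x y) (M' := 1)).
  by congr gsum; apply/funext => k; rewrite mulN1r.
by move=> k; rewrite mulN1r normrN.
Qed.

Let heat (x y : cylinder d N) k : `|walk_prob R lst k x y - c * vertical_kernel k x y| <= K * heat_tail k.
Proof. exact: heat_kernel_bound. Qed.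

Lemma lazy_green_vertical (x y : cylinder d N) :
  `|lazy_green (@cylinder_step d N) t x y - vertical_green (x.2 - y.2)| <= 6 * K.
Proof.
have := gsum_tail 0 t01' (heat x y).
by rewrite big_geq// subr0 gsum_diff sqrtr1 divr1.
Qed.

(** The first [m] terms are kept because they carry the Green function at 0. Beyond them each series
    is replaced by its vertical part at the cost of one tail, whence 12 instead of 6. The two
    vertical sums differ by the profile, and [c * m] pays for the vertical part inside the first [m]
    terms. *)
Lemma lazy_green_increment (x y : cylinder d N) :
  `|lazy_green (@cylinder_step d N) t y y - lazy_green (@cylinder_step d N) t x y
    - \sum_(0 <= k < m) t ^+ k * (walk_prob R lst k y y - walk_prob R lst k x y)|
  <= 12 * K / Num.sqrt m.+1%:R + (vertical_green 0 - vertical_green (x.2 - y.2)) + c * m%:R.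
Proof.
have h1 := gsum_tail m t01' (heat y y); have h2 := gsum_tail m t01' (heat x y).
rewrite !gsum_diff subrr in h1 h2.
set Gy := lazy_green _ t y y in h1 *; set Gx := lazy_green _ t x y in h2 *.
set V0 := vertical_green 0 in h1 *; set Vz := vertical_green _ in h2 *.
have E z : \sum_(0 <= k < m) t ^+ k * (walk_prob R lst k z y - c * vertical_kernel k z y) =
    \sum_(0 <= k < m) t ^+ k * walk_prob R lst k z y - c * \sum_(0 <= k < m) t ^+ k * vertical_kernel k z y.
  by rewrite mulr_sumr -sumrB; apply: eq_bigr => k _; ring.
rewrite !E in h1 h2.
have Ep : \sum_(0 <= k < m) t ^+ k * (walk_prob R lst k y y - walk_prob R lst k x y) =
    \sum_(0 <= k < m) t ^+ k * walk_prob R lst k y y - \sum_(0 <= k < m) t ^+ k * walk_prob R lst k x y.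
  by rewrite -sumrB; apply: eq_bigr => k _; ring.
rewrite Ep.
have /andP[c0 c1] := c01; have /andP[t0 t1] := t01.
have vk01 k z := vertical_kernel01 k z y (R := R).
have B z : 0 <= \sum_(0 <= k < m) t ^+ k * vertical_kernel k z y <= m%:R.
  have t0' := ltW t0; have t1' := ltW t1; rewrite big_mkord; apply/andP; split.
    by apply: sumr_ge0 => k _; case/andP: (vk01 k z) => *; rewrite mulr_ge0 ?exprn_ge0.
  apply: (@le_trans _ _ (\sum_(k < m) 1)); last by rewrite sumr_const card_ord.
  by apply: ler_sum => k _; case/andP: (vk01 k z) => *; rewrite mulr_ile1 ?exprn_ge0 ?exprn_ile1.
have /andP[by0 by1] := B y; have /andP[bx0 bx1] := B x.
have V : 0 <= V0 - Vz.
  rewrite subr_ge0 /V0 /Vz /vertical_green -/c ler_wpM2l// expr0 mulr1.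
  have /andP[r0 r1] := rho01.
  rewrite ler_piMr ?exprn_ile1 ?ltW// divr_gt0 ?mulr_gt0// ?subr_gt0//; lra.
move: h1 h2; rewrite !ler_norml => /andP[h1 h1'] /andP[h2 h2'].
have E12 : 12 * K / Num.sqrt m.+1%:R = 2 * (6 * K / Num.sqrt m.+1%:R) by ring.
rewrite E12; move: h1 h1' h2 h2'; set T := 6 * K / _.
set py := \sum_(0 <= k < m) t ^+ k * walk_prob R lst k y y.
set px := \sum_(0 <= k < m) t ^+ k * walk_prob R lst k x y.
move: by0 by1 bx0 bx1; set sy := \sum_(0 <= k < m) t ^+ k * vertical_kernel k y y.
set sx := \sum_(0 <= k < m) t ^+ k * vertical_kernel k x y.
move=> by0 by1 bx0 bx1 h1 h1' h2 h2'.
have cy : 0 <= c * sy <= c * m%:R by rewrite mulr_ge0//= ler_wpM2l.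
have cx : 0 <= c * sx <= c * m%:R by rewrite mulr_ge0//= ler_wpM2l.
apply/andP; split; lra.
Qed.

End comparison.

End cylinder_green.

(** * The Green function of the lattice *)

Section lattice_projection.
Context {R : realType}.

Lemma walk_prob_reindex (G : zmodType) (I I' : finType) (st : I -> G) (h : I' -> I) :
  bijective h -> forall n x y, walk_prob R (fun i => st (h i)) n x y = walk_prob R st n x y.
Proof.
move=> bh; elim=> [//|n IH] x y /=; rewrite (bij_eq_card bh); congr (_ / _).
rewrite [RHS](reindex h) /=; last exact: onW_bij.
by apply: eq_bigr => i _; rewrite IH.
Qed.

Lemma inZp_mulz_eq0 n (z : int) : (absz z < n.+1)%N -> (inZp 1 : 'I_n.+1) *~ z = 0 -> z = 0.
Proof.
have key k : (k < n.+1)%N -> (inZp 1 : 'I_n.+1) *+ k = 0 -> k = 0%N.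
  move=> kn; rewrite Zp_mulrn => /(congr1 val) /=.
  by rewrite modnMml mul1n modn_small.
case: z => k /= hk; first by move/(key _ hk) => ->.
by rewrite NegzE mulrNz => /eqP; rewrite oppr_eq0 => /eqP /(key _ hk).
Qed.

Variables (d N : nat).
Notation n := N.-1.
Notation cst := (lazy_step (@cylinder_step d N)).
Notation zst := (lazy_step (@lattice_step d.+1)).

(** Wraps the lattice onto the cylinder with 0 sent to [y]; coordinate [ord0] becomes the height,
    and [h] matches the indices of the steps. *)
Let p (y : cylinder d N) (v : 'rV[int]_d.+1) : cylinder d N :=
  y + (\row_j (inZp 1 *~ v 0 (lift ord0 j)), v 0 ord0).

Let h (c : 'I_d.+1 * (bool * bool)) : option 'I_d * (bool * bool) := (unlift ord0 c.1, c.2).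

Let h_bij : bijective h.
Proof.
exists (fun c => (oapp (lift ord0) ord0 c.1, c.2)); rewrite /h.
  by case=> c ba /=; case: unliftP => [j ->|->].
by case=> -[j|] ba /=; rewrite ?liftK ?unlift_none.
Qed.

Let hp y x i : p y (x + zst i) = p y x + cst (h i).
Proof.
rewrite /p -addrA; congr (y + _); case: i => c [b []]; rewrite /lazy_step /h /=; last first.
  by rewrite !addr0.
case: (unliftP ord0 c) => [k ->|->] /=; congr (_, _).
- apply/rowP => j; rewrite !mxE mulrzDr; congr (_ + _).
  rewrite (inj_eq lift_inj); case: eqP => _; last by rewrite mulr0z.
  by case: b; rewrite ?expr1 ?expr0 ?mulrN1z ?mulr1z.
- by rewrite !mxE; case: eqP => // /eqP; rewrite (negbTE (neq_lift _ _)).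
- by apply/rowP => j; rewrite !mxE [lift _ _ == _]eq_sym (negbTE (neq_lift _ _)) !addr0.
- by rewrite !mxE eqxx.
Qed.

Let p0 y : p y 0 = y.
Proof.
rewrite /p [X in _ + X](_ : _ = 0) ?addr0//; congr (_, _); last by rewrite mxE.
by apply/rowP => j; rewrite !mxE mulr0z.
Qed.

Lemma lattice_le_cylinder k y : walk_prob R zst k 0 0 <= walk_prob R cst k y y.
Proof.
rewrite -[in leRHS](p0 y) -(walk_prob_reindex cst h_bij).
exact: (walk_prob_hom (hp y)).
Qed.

(** In fewer than [N] steps the walk cannot wind around the torus. The invariant is that each torus
    coordinate plus the number of steps left stays below [N], so that in the end only 0 is wrapped
    onto [y]. *)
Lemma lattice_eq_cylinder k y : (k < N)%N -> walk_prob R zst k 0 0 = walk_prob R cst k y y.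
Proof.
move=> kN; rewrite -[in RHS](p0 y) -(walk_prob_reindex cst h_bij).
have N0 : (n.+1 = N)%N by rewrite prednK//; case: N kN.
apply: (@walk_prob_hom_eq R _ _ _ zst (fun i => cst (h i)) (p y) 0
  (fun k x => forall j, (absz (x 0%R (lift ord0 j)) + k < N)%N)) => //.
- move=> l x i hx j; have := hx j; rewrite !mxE.
  rewrite /lazy_step; case: ifP => _; last first.
    by rewrite mxE addr0; apply: leq_trans; rewrite ltnS leq_add2l.
  rewrite /lattice_step mxE; move: (x 0 (lift ord0 j)) => z.
  case: ifP => _; last by rewrite addr0; apply: leq_trans; rewrite ltnS leq_add2l.
  by case: i.2.1; rewrite ?expr0 ?expr1; lia.
- move=> x hx; rewrite p0 /p => /eqP; rewrite -[X in _ == X]addr0 (inj_eq (addrI y)).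
  move=> /eqP [/rowP h1 h2]; apply/rowP => j; rewrite mxE.
  case: (unliftP ord0 j) => [l ->|->//].
  have := h1 l; rewrite !mxE; apply: inZp_mulz_eq0.
  by have := hx l; rewrite addn0 N0.
- by move=> j; rewrite mxE.
Qed.

End lattice_projection.

(** * Lazy return probabilities on the lattice sum to twice the Green function *)

Section green_lattice.
Context {R : realType} (d : nat).
Hypothesis d2 : (2 <= d)%N.
Notation zst := (lazy_step (@lattice_step d.+1)).

Let q k : R := walk_prob R zst k 0 0.
Let p k : R := walk_prob R (@lattice_step d.+1) k 0 0.

Let C0 : (0 < #|{: 'I_d.+1}|)%N. Proof. by rewrite card_ord. Qed.
Let L0 : (0 < #|{: 'I_d.+1 * (bool * bool)}|)%N.
Proof. by rewrite !card_prod card_bool card_ord. Qed.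
Let I0 : (0 < #|{: 'I_d.+1 * bool}|)%N.
Proof. by rewrite card_prod card_bool card_ord. Qed.

Let q01 k : 0 <= q k <= 1. Proof. exact: walk_prob01. Qed.
Let p01 k : 0 <= p k <= 1. Proof. exact: walk_prob01. Qed.

(** Inherited from a large cylinder: for [N > k] the return probabilities agree, and the vertical
    part is at most [1 / N]. *)
Lemma lattice_heat k : walk_prob R zst k 0 0 <= heat_const d * heat_tail k.
Proof.
apply/ler_addgt0Pr => eps eps0.
have [N kN epsN] : exists2 N, (k < N)%N & N.-1.+1%:R^-1 <= eps.
  exists (maxn k (Num.trunc eps^-1)).+1; first by rewrite ltnS leq_maxl.
  rewrite invf_ple ?posrE// ltW// (lt_le_trans (truncnS_gt eps^-1))// ler_nat.
  by rewrite ltnS leq_maxr.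
rewrite (@lattice_eq_cylinder _ _ N _ 0 kN).
have := heat_kernel_bound k (0 : cylinder d N) 0 d2 (R := R).
rewrite ler_norml => /andP[_]; rewrite lerBlDr => /le_trans; apply; rewrite lerD2l.
have v01 := vertical_kernel01 k (0 : cylinder d N) 0 (R := R).
have /andP[v0 v1] := v01.
have N0 : 0 < N.-1.+1%:R^-1 :> R by rewrite invr_gt0.
have N1 : N.-1.+1%:R^-1 <= 1 :> R by rewrite invf_le1 ?ltr0n// ler1n.
apply: le_trans epsN.
case: d d2 v0 v1 => [//|d'] _ v0 v1; rewrite exprS -mulrA ler_piMr ?(ltW N0)//.
  by rewrite mulr_ile1// ?exprn_ge0 ?exprn_ile1 ?(ltW N0).
Qed.

Let K : R := heat_const d.

Let q_sum m : \sum_(0 <= k < m) q k <= 6 * K.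
Proof.
have K0 : 0 <= K by exact: heat_const_ge0.
apply: (@le_trans _ _ (K * \sum_(0 <= k < m) heat_tail k)).
  by rewrite mulr_sumr; apply: ler_sum => k _; exact: lattice_heat.
rewrite [leRHS]mulrC ler_wpM2l//.
by apply: le_trans (sum_heat_tail (leq0n m)) _; rewrite sqrtr1 divr1.
Qed.

Let q_cvg : cvgn (series q).
Proof.
apply: nondecreasing_is_cvgn.
  by apply: nondecreasing_series => k _; case/andP: (q01 k).
by exists (6 * K) => _ [m _ <-]; exact: q_sum.
Qed.

Let gt := limn (series q).

Let q_le m : \sum_(0 <= k < m) q k <= gt.
Proof.
apply: (nondecreasing_cvgn_le _ q_cvg).
by apply: nondecreasing_series => k _; case/andP: (q01 k).
Qed.

(** Quantitative Abel summation over [m] terms, from [1 - s ^ k <= k (1 - s)]. *)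
Lemma abel_diff (a : R^nat) m s : 0 <= s <= 1 -> (forall k, 0 <= a k <= 1) ->
  \sum_(0 <= k < m) a k <= \sum_(0 <= k < m) s ^+ k * a k + m%:R * (m%:R * (1 - s)).
Proof.
move=> /andP[s0 s1] a01.
have bern k : 1 - s ^+ k <= k%:R * (1 - s).
  elim: k => [|k IH]; first by rewrite expr0 subrr mul0r.
  rewrite exprS -[k.+1%:R]natr1.
  have : 0 <= (1 - s) * (1 - s ^+ k) by rewrite mulr_ge0 ?subr_ge0// exprn_ile1.
  by nra.
rewrite -lerBlDl -sumrB.
apply: (@le_trans _ _ (\sum_(0 <= k < m) m%:R * (1 - s))); last first.
  by rewrite big_const_nat iter_addr_0 subn0 [leRHS]mulr_natl.
rewrite !big_nat; apply: ler_sum => k /andP[_ km].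
have /andP[a0 a1] := a01 k.
apply: (@le_trans _ _ (1 - s ^+ k)).
  rewrite (_ : _ - _ = (1 - s ^+ k) * a k); last by ring.
  by rewrite ler_piMr// subr_ge0 exprn_ile1.
apply: le_trans (bern k) _; rewrite ler_wpM2r ?subr_ge0// ler_nat; exact: ltnW.
Qed.

Let gsum_ge (a : R^nat) m s : 0 <= s < 1 -> (forall k, 0 <= a k <= 1) ->
  \sum_(0 <= k < m) s ^+ k * a k <= gsum s a.
Proof.
move=> s01 a01; have /andP[s0 s1] := s01.
apply: (nondecreasing_cvgn_le (u_ := series (fun k => s ^+ k * a k))).
  by apply: nondecreasing_series => k _; rewrite mulr_ge0 ?exprn_ge0//; case/andP: (a01 k).
apply: (gsum_is_cvg s01 (M := 1)) => k.
by case/andP: (a01 k) => x y; rewrite ger0_norm.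
Qed.

Let gsum_le (a : R^nat) M s : 0 <= s < 1 -> (forall k, 0 <= a k <= 1) ->
  (forall m, \sum_(0 <= k < m) a k <= M) -> gsum s a <= M.
Proof.
move=> s01 a01 aM; have /andP[s0 s1] := s01.
apply: limr_le.
  apply: (gsum_is_cvg s01 (M := 1)) => k.
  by case/andP: (a01 k) => x y; rewrite ger0_norm.
apply: nearW => m; apply: le_trans (aM m); apply: ler_sum => k _.
by case/andP: (a01 k) => x y; rewrite ler_piMl// exprn_ile1// ltW.
Qed.

Let link s : 0 <= s < 1 -> (1 + s) * gsum s p = gsum (lazy_rate s) q.
Proof. by move=> s01; rewrite (green_lazy_green (@lattice_step d.+1) C0 0 0 s01). Qed.

(* Let s tend to 1 in (1 + s) sum s^k p_k = sum (lazy_rate s)^k q_k. *)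
Let p_le m : \sum_(0 <= k < m) p k <= gt / 2.
Proof.
apply/ler_addgt0Pr => eps eps0.
have gt0 : 0 <= gt by have := q_le 0; rewrite big_geq.
pose e := Num.min (1 / 2) (eps / (m%:R * m%:R + gt + 1)).
have den : 0 < m%:R * m%:R + gt + 1 by rewrite ltr_wpDl// addr_ge0// mulr_ge0.
have e0 : 0 < e by rewrite lt_min divr_gt0// divr_gt0.
have e1 : e <= 1 / 2 by rewrite ge_min lexx.
have e2 : e * (m%:R * m%:R + gt + 1) <= eps by rewrite -ler_pdivlMr// ge_min lexx orbT.
have s01 : 0 <= 1 - e < 1 by apply/andP; split; lra.
have s01' : 0 <= 1 - e <= 1 by apply/andP; split; lra.
have h1 := abel_diff m s01' p01; have h2 := gsum_ge m s01 p01.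
have h3 := link s01; have h4 := gsum_le (lazy_rate01 s01) q01 q_le.
rewrite -h3 in h4; move: h2 h4; set P := gsum _ _ => h2 h4.
have Pgt : P <= gt by case: (lerP 0 P) => hP; nra.
have eP : e * P <= e * gt by rewrite ler_wpM2l// ltW.
have eg : 0 <= e * gt by rewrite mulr_ge0// ltW.
lra.
Qed.

Let p_cvg : cvgn (series p).
Proof.
apply: nondecreasing_is_cvgn.
  by apply: nondecreasing_series => k _; case/andP: (p01 k).
by exists (gt / 2) => _ [m _ <-]; exact: p_le.
Qed.

Let greenE : fine (green R (0 : 'rV[int]_d.+1)) = limn (series p).
Proof.
(* Taking [fine] loses nothing: by [p_cvg] the series has a real sum. *)
rewrite /green (_ : (fun m => _) = EFin \o series p); first by rewrite EFin_lim.
by apply/funext => m /=; rewrite /series /= sumEFin.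
Qed.

(** The converse comparison, with the Abel error now on the lazy side; it vanishes since
    [1 - lazy_rate (1 - e) <= e]. *)
Let q_le_green m : \sum_(0 <= k < m) q k <= 2 * limn (series p).
Proof.
have pl l : \sum_(0 <= k < l) p k <= limn (series p).
  apply: (nondecreasing_cvgn_le _ p_cvg).
  by apply: nondecreasing_series => k _; case/andP: (p01 k).
set g := limn _ in pl *.
apply/ler_addgt0Pr => eps eps0.
have g0 : 0 <= g by have := pl 0%N; rewrite big_geq.
pose e := Num.min (1 / 2) (eps / (m%:R * m%:R + 1)).
have den : 0 < m%:R * m%:R + 1 :> R by rewrite ltr_wpDl// mulr_ge0.
have e0 : 0 < e by rewrite lt_min divr_gt0// divr_gt0.
have e1 : e <= 1 / 2 by rewrite ge_min lexx.
have e2 : e * (m%:R * m%:R + 1) <= eps by rewrite -ler_pdivlMr// ge_min lexx orbT.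
have s01 : 0 <= 1 - e < 1 by apply/andP; split; lra.
have /andP[t0 t1] := lazy_rate01 s01.
have t01' : 0 <= lazy_rate (1 - e) <= 1 by rewrite t0 ltW.
have h1 := abel_diff m t01' q01; have h2 := gsum_ge m (lazy_rate01 s01) q01.
have h3 := link s01; have h4 := gsum_le s01 p01 pl.
have te : 1 - lazy_rate (1 - e) <= e.
  rewrite /lazy_rate lerBlDr -lerBlDl ler_pdivlMr; last by lra.
  by nra.
have mm : 0 <= (m%:R * m%:R : R) by rewrite mulr_ge0.
nra.
Qed.

Lemma lazy_lattice_sum_le m :
  \sum_(0 <= k < m) walk_prob R zst k 0 0 <= 2 * fine (green R (0 : 'rV[int]_d.+1)).
Proof. by rewrite greenE; exact: q_le_green. Qed.

Lemma lazy_lattice_sum_cvg (eps : R) : 0 < eps -> exists m0, forall m, (m0 <= m)%N ->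
  2 * fine (green R (0 : 'rV[int]_d.+1)) - eps <= \sum_(0 <= k < m) walk_prob R zst k 0 0.
Proof.
move=> eps0; rewrite greenE.
have h : 2 * limn (series p) <= gt.
  rewrite mulrC -ler_pdivlMr//; apply: limr_le => //.
  by apply: nearW => m; exact: p_le.
have : gt - eps < limn (series q) by rewrite -/gt gtrDl oppr_lt0.
have /cvgrPdist_lt/(_ eps eps0) : series q @ \oo --> gt by [].
move=> [m0 _ hm] _; exists m0 => m mm0; have := hm _ mm0.
by rewrite ltr_norml => /andP[_]; rewrite /series/=; lra.
Qed.

End green_lattice.

(** * Asymptotics of the Matthews products and of the rates *)

Section matthews_asymptotics.
Context {R : realType}.
Implicit Types (gamma : R) (n : nat).

Lemma ln_step n : ln n.+2%:R - ln n.+1%:R <= n.+1%:R^-1 :> R.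
Proof.
rewrite -ln_div ?posrE//.
rewrite (_ : n.+2%:R / n.+1%:R = 1 + n.+1%:R^-1 :> R).
  by apply: le_ln1Dx; rewrite (lt_le_trans (_ : -1 < 0))// ?oppr_lt0// invr_ge0.
by rewrite -[n.+2%:R]natr1 mulrDl mulfV ?pnatr_eq0// mul1r.
Qed.

Lemma ln_step_ge n : n.+2%:R^-1 <= ln n.+2%:R - ln n.+1%:R :> R.
Proof.
rewrite -lerN2 opprB -ln_div ?posrE//.
rewrite (_ : n.+1%:R / n.+2%:R = 1 + - n.+2%:R^-1 :> R).
  by apply: le_ln1Dx; rewrite ltrN2 invf_lt1 ?ltr0n// ltr1n.
by rewrite (_ : n.+1%:R = n.+2%:R - 1) ?mulrBl ?mulfV ?pnatr_eq0 ?mul1r// -[n.+2%:R]natr1 addrK.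
Qed.

(** [(1 + gamma)^-1] supplies the factor [j = 1]. Each factor [1 / (1 + gamma / j)] is at least
    [exp (- gamma / j)], and the harmonic sum is at most [1 + ln n]. *)
Lemma matthews_prod_ge gamma n : 0 <= gamma -> (0 < n)%N ->
  expR (- gamma * (1 + ln n%:R)) <= (1 + gamma)^-1 * matthews_prod gamma n.
Proof.
move=> g0; case: n => [//|n] _; elim: n => [|n IH].
  rewrite /matthews_prod big_geq// mulr1 ln1 addr0 mulr1 expRN.
  by rewrite lef_pV2 ?posrE ?expR_gt0 ?ltr_pwDl// expR_ge1Dx.
rewrite matthews_prodS// mulrA.
apply: (@le_trans _ _ (expR (- gamma * (1 + ln n.+1%:R)) * expR (- (gamma / n.+2%:R)))).
  rewrite -expRD ler_expR; have := ln_step_ge n; rewrite -subr_ge0 => h.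
  by have := mulr_ge0 g0 h; set v := n.+2%:R^-1; lra.
apply: ler_pM; rewrite ?expR_ge0//.
have p1 : 0 < n.+2%:R + gamma by rewrite ltr_wpDr// ltr0n.
rewrite expRN -[leRHS]invrK lef_pV2 ?posrE ?expR_gt0 ?invr_gt0 ?divr_gt0//.
by rewrite invf_div mulrDl mulfV ?pnatr_eq0// expR_ge1Dx.
Qed.

Lemma inv1D_le (w : R) : 0 <= w -> (1 + w)^-1 <= expR (- w + w ^+ 2).
Proof.
move=> w0; rewrite -[X in expR X]opprK expRN lef_pV2 ?posrE ?expR_gt0 ?ltr_pwDl//.
rewrite opprD opprK; have := expR_ge1Dx (- (w - w ^+ 2)); rewrite expRN.
have pos : 0 < 1 - (w - w ^+ 2) by have := sqr_ge0 (w - 1); nra.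
move=> h; rewrite -[leLHS]invrK -[leRHS]invrK lef_pV2 ?posrE ?invr_gt0 ?expR_gt0 ?ltr_pwDl//.
apply: le_trans h; rewrite -(ler_pM2l (_ : 0 < 1 + w)) ?ltr_pwDl// mulfV; last by rewrite gt_eqF// ltr_pwDl.
have : 0 <= w ^+ 3 by exact: exprn_ge0.
rewrite !exprS expr0; nra.
Qed.

(** From [1 / (1 + w) <= exp (- w + w ^ 2)] at [w = gamma / j]. In the application [gamma] is of
    order [1 / log |F|], so its square is negligible. *)
Lemma matthews_prod_le gamma n : 0 <= gamma -> (0 < n)%N ->
  matthews_prod gamma n <= expR (- gamma * (ln n.+1%:R - ln 2) + gamma ^+ 2).
Proof.
move=> g0; case: n => [//|n] _.
(* Strengthened for the induction: [1 - 1 / (n + 1)] absorbs the sum of the [1 / j ^ 2] by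
   telescoping. *)
suff h : matthews_prod gamma n.+1 <=
    expR (- gamma * (ln n.+2%:R - ln 2) + gamma ^+ 2 * (1 - n.+1%:R^-1)).
  apply: le_trans h _; rewrite ler_expR lerD2l ler_piMr ?sqr_ge0//.
elim: n => [|n IH].
  rewrite /matthews_prod big_geq// subrr mulr0 invr1 subrr mulr0 addr0.
  by rewrite expR0.
rewrite matthews_prodS//.
apply: (@le_trans _ _ (expR (- gamma * (ln n.+2%:R - ln 2) + gamma ^+ 2 * (1 - n.+1%:R^-1)) *
   expR (- (gamma / n.+2%:R) + (gamma / n.+2%:R) ^+ 2))).
  apply: ler_pM => //.
  - apply: prodr_ge0 => i _; rewrite divr_ge0// addr_ge0//.
  - by rewrite divr_ge0// addr_ge0.
  apply: le_trans (inv1D_le _); last by rewrite divr_ge0.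
  have p1 : 0 < n.+2%:R + gamma by rewrite ltr_wpDr// ltr0n.
  have p2 : 0 < 1 + gamma / n.+2%:R by rewrite ltr_wpDr// divr_ge0.
  rewrite -[leLHS]invrK lef_pV2 ?posrE ?invr_gt0 ?divr_gt0//.
  by rewrite invf_div mulrDl mulfV ?pnatr_eq0.
rewrite -expRD ler_expR.
have h1 := ln_step n.+1; rewrite -subr_ge0 in h1; have {}h1 := mulr_ge0 g0 h1.
have h2 : n.+2%:R^-1 ^+ 2 <= n.+1%:R^-1 - n.+2%:R^-1 :> R.
  have -> : n.+1%:R^-1 - n.+2%:R^-1 = n.+1%:R^-1 * n.+2%:R^-1 :> R.
    have a0 : n.+1%:R != 0 :> R by rewrite pnatr_eq0.
    have b0 : n.+2%:R != 0 :> R by rewrite pnatr_eq0.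
    have : n.+2%:R = n.+1%:R + 1 :> R by rewrite natr1.
    move: a0 b0; move: (n.+1%:R : R) (n.+2%:R : R) => a b a0 b0 ab.
    by rewrite -[RHS]mul1r (_ : 1 = b - a); [field; rewrite a0 b0|rewrite ab addrC addKr].
  by rewrite expr2 ler_wpM2r ?invr_ge0// lef_pV2 ?posrE// ler_nat.
rewrite -subr_ge0 in h2; have {}h2 := mulr_ge0 (sqr_ge0 gamma) h2.
rewrite exprMn; move: h1 h2; set v := n.+2%:R^-1; set w := n.+1%:R^-1; lra.
Qed.

End matthews_asymptotics.

(** * Thinning a finite set to points far apart *)

Section separation.
Context {R : realType} {G : zmodType} {I : finType} (st : I -> G).

Fixpoint step_sums (k : nat) : seq G :=
  if k is l.+1 then [seq st i + z | i <- enum I, z <- step_sums l] else [:: 0].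

Lemma size_step_sums k : size (step_sums k) = (#|I| ^ k)%N.
Proof. by elim: k => [//|k IH] /=; rewrite size_allpairs IH -cardE expnS. Qed.

Lemma walk_prob_eq0 k x y : y - x \notin step_sums k -> walk_prob R st k x y = 0.
Proof.
elim: k x => [|k IH] x /=.
  by rewrite inE subr_eq0 eq_sym => /negbTE ->.
move=> h; rewrite big1 ?mul0r// => i _; apply: IH; apply: contra h => h.
apply/allpairsP; exists (i, y - (x + st i)); rewrite mem_enum /=; split => //.
by rewrite opprD [RHS]addrC addrA subrK.
Qed.

(** Counts the point itself and its translates by sums of fewer than [m] steps, with both signs
    because closeness is symmetrised. It does not depend on the set to be thinned, so thinning costs
    an additive constant in the logarithm of the size. *)
Definition close_bound (m : nat) : nat := (2 * \sum_(k < m) #|I| ^ k).+1.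

(* Greedy choice of [A']: each point excludes at most [close_bound m] others. *)
Lemma separated_subset m (A : {fset G}) : exists2 A' : {fset G}, (A' `<=` A)%fset &
  (#|` A| <= close_bound m * #|` A'|)%N /\
  forall x y, x \in A' -> y \in A' -> x != y -> forall k, (k < m)%N -> walk_prob R st k x y = 0.
Proof.
pose S := flatten [seq step_sums k | k <- iota 0 m].
have sS : size S = (\sum_(k < m) #|I| ^ k)%N.
  rewrite /S size_flatten /shape -map_comp sumnE big_map -[m in iota 0 m]subn0 -/(index_iota 0 m).
  by rewrite big_mkord; apply: eq_bigr => k _; rewrite /= size_step_sums.
pose close x y := (y - x \in S) || (x - y \in S).
have closeP x y : ~~ close x y -> forall k, (k < m)%N -> walk_prob R st k x y = 0.
  rewrite negb_or => /andP[h _] k km; apply: walk_prob_eq0; apply: contra h => h.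
  by apply/flattenP; exists (step_sums k) => //; apply: map_f; rewrite mem_iota.
pose nb y : {fset G} := seq_fset tt (y :: [seq y - z | z <- S] ++ [seq y + z | z <- S]).
have nbP x y : x \notin nb y -> x != y /\ ~~ close x y.
  rewrite seq_fsetE inE mem_cat !negb_or => /and3P[xy h1 h2]; split => //; apply/andP; split.
    apply: contra h1 => h; apply/mapP; exists (y - x) => //; by rewrite opprB addrC subrK.
  apply: contra h2 => h; apply/mapP; exists (x - y) => //; by rewrite addrC subrK.
have cnb y : (#|` nb y| <= close_bound m)%N.
  rewrite /nb size_seq_fset; apply: leq_trans (size_undup _) _.
  by rewrite /= size_cat !size_map sS /close_bound mul2n addnn.
have closeC x y : close x y = close y x by rewrite /close orbC.
suff : exists2 A' : {fset G}, (A' `<=` A)%fset & (#|` A| <= close_bound m * #|` A'|)%N /\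
    forall x y, x \in A' -> y \in A' -> x != y -> ~~ close x y.
  move=> [A' s [c h]]; exists A' => //; split => // x y xA yA xy; apply: closeP; exact: h.
have [n] := ubnP #|` A|; elim: n A => [//|n IH] A nA.
have [->|/fset0Pn[y yA]] := eqVneq A fset0.
  by exists fset0; rewrite ?cardfs0.
have yA0 : (A `\` nb y `<=` A)%fset by exact: fsubsetDl.
have ynb : y \in nb y by rewrite seq_fsetE inE eqxx.
have lt : (#|` (A `\` nb y)%fset| < #|` A|)%N.
  rewrite -(cardfsID (nb y) A) addnC -[ltnLHS]addn0 ltn_add2l cardfs_gt0.
  by apply/fset0Pn; exists y; rewrite in_fsetI yA.
have [A1 s1 [c1 h1]] := IH _ (leq_trans lt nA).
exists (y |` A1)%fset.
  by rewrite fsubUset fsub1set yA (fsubset_trans s1).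
have yA1 : y \notin A1.
  by apply/negP => /(fsubsetP s1); rewrite inE ynb.
split.
  rewrite cardfsU1 yA1 mulnDr muln1 -(cardfsID (nb y) A) leq_add//.
  by apply: leq_trans (cnb y); apply: fsubset_leq_card; exact: fsubsetIr.
have far x : x \in A1 -> ~~ close x y.
  by move=> /(fsubsetP s1); rewrite inE => /andP[/nbP[]].
move=> x z; rewrite !inE => /orP[/eqP ->|xA1] /orP[/eqP ->|zA1].
- by rewrite eqxx.
- by rewrite closeC => _; exact: far.
- by move=> _; exact: far.
- exact: h1.
Qed.

End separation.

(** * Decay rate of the height profile under small killing *)

Section rate_asymptotics.
Context {R : realType} (D : R) (x : R^nat).
Hypothesis D0 : 0 < D.
Hypothesis x0 : \forall N \near \oo, 0 < x N.
Hypothesis xc : x @ \oo --> (0:R).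

Let s N := expR (- x N).
Let kap N := 2 * D * (expR (x N) - 1).
(** This is [1 - rho]. With [k = D (exp y - 1)] it is the positive root [sqrt (2 k + k ^ 2) - k] of
    [r ^ 2 = 2 k (1 - r)], which is the characteristic equation at [t = lazy_rate (exp (- y))]. *)
Definition root_gap (y : R) : R :=
  Num.sqrt (2 * D * (expR y - 1) * (1 + D * (expR y - 1) / 2)) - D * (expR y - 1).

Let r N := root_gap (x N).

Lemma root_gap_eq y : 0 < y -> root_gap y ^+ 2 = 2 * D * (expR y - 1) * (1 - root_gap y).
Proof.
move=> y0; rewrite /root_gap; set k := D * (expR y - 1).
have k0 : 0 < k by rewrite mulr_gt0// subr_gt0 expR_gt1.
rewrite -[2 * D * _]mulrA -/k.
have pos : 0 <= 2 * k * (1 + k / 2) by rewrite mulr_ge0//; lra.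
set q := Num.sqrt _; have qq : q ^+ 2 = 2 * k * (1 + k / 2) by rewrite sqr_sqrtr.
by rewrite sqrrB qq expr2; field.
Qed.

Lemma root_gap01 y : 0 < y -> 0 < root_gap y < 1.
Proof.
move=> y0; rewrite /root_gap; set k := D * (expR y - 1).
have k0 : 0 < k by rewrite mulr_gt0// subr_gt0 expR_gt1.
rewrite -[2 * D * _]mulrA -/k.
have pos : 0 <= 2 * k * (1 + k / 2) by rewrite mulr_ge0//; lra.
set q := Num.sqrt _; have qq : q ^+ 2 = 2 * k * (1 + k / 2) by rewrite sqr_sqrtr.
have q0 : 0 <= q by exact: sqrtr_ge0.
rewrite expr2 in qq.
apply/andP; split.
  rewrite subr_gt0 ltNge; apply/negP => h; have : q * q <= k * k by rewrite ler_pM.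
  by nra.
rewrite ltrBlDr ltNge; apply/negP => h; have : (1 + k) * (1 + k) <= q * q by rewrite ler_pM//; lra.
by nra.
Qed.

Lemma root_gap_rate y : 0 < y ->
  4 * D * (1 - root_gap y) * (1 - lazy_rate (expR (- y))) = lazy_rate (expR (- y)) * (1 - (1 - root_gap y)) ^+ 2.
Proof.
move=> y0; rewrite subKr root_gap_eq// /lazy_rate expRN.
have e0 : 0 < expR y by exact: expR_gt0.
by field; rewrite gt_eqF//= gt_eqF// ltr_wpDr.
Qed.

Let expx : expR (x N) @[N --> \oo] --> (1:R).
Proof. by rewrite -[X in _ --> X]expR0; apply: continuous_cvg => //; exact: continuous_expR. Qed.

Lemma rate_cvg1 : lazy_rate (s N) @[N --> \oo] --> (1:R).
Proof.
have h : s N @[N --> \oo] --> (1:R).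
  rewrite /s -[X in _ --> X]invr1.
  under eq_fun do rewrite expRN.
  by apply: cvgV => //; exact: oner_neq0.
suff : 2 * s N / (1 + s N) @[N --> \oo] --> 2 * (1:R) / (1 + 1).
  by rewrite (_ : 2 * 1 / (1 + 1) = 1 :> R)//; field.
apply: cvgM; first by apply: cvgM => //; exact: cvg_cst.
by apply: cvgV; [rewrite gt_eqF|apply: cvgD => //; exact: cvg_cst].
Qed.

Let k1 : D * (expR (x N) - 1) @[N --> \oo] --> (0:R).
Proof.
rewrite (_ : 0 = D * (1 - 1)); last by rewrite subrr mulr0.
apply: cvgM; first exact: cvg_cst.
by apply: cvgB => //; exact: cvg_cst.
Qed.

Let kx : 2 * D * (expR (x N) - 1) / x N @[N --> \oo] --> 2 * D.
Proof.
apply: (@squeeze_cvgr _ _ _ _ (fun=> 2 * D) (fun N => 2 * D * expR (x N))).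
- near=> N; have xN : 0 < x N by near: N.
  have D2 : 0 < 2 * D by rewrite mulr_gt0.
    have h1 := expR_ge1Dx (x N); have h2 := expR_ge1Dx (- x N).
  have e0 := expR_gt0 (x N).
  have h3 : expR (x N) * expR (- x N) = 1 by rewrite -expRD subrr expR0.
  apply/andP; split; first by rewrite ler_pdivlMr// ler_pM2l//; lra.
  rewrite ler_pdivrMr// -!mulrA ler_pM2l// ler_pM2l//.
  have : expR (x N) * (1 + - x N) <= 1 by rewrite -[leRHS]h3 ler_pM2l.
  by lra.
- exact: cvg_cst.
- rewrite -[X in _ --> X]mulr1; apply: cvgM => //; exact: cvg_cst.
Unshelve. all: by end_near. Qed.

Lemma root_gap_cvg0 : root_gap (x N) @[N --> \oo] --> (0:R).
Proof.
rewrite /root_gap (_ : 0 = Num.sqrt (2 * 0 * (1 + 0 / 2)) - 0); last first.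
  by rewrite mulr0 mul0r sqrtr0 subrr.
apply: cvgB => //; apply: continuous_cvg; first exact: sqrt_continuous.
under eq_fun do rewrite -[2 * D * _]mulrA.
apply: cvgM; first by apply: cvgM => //; exact: cvg_cst.
by apply: cvgD; [exact: cvg_cst|apply: cvgM => //; exact: cvg_cst].
Qed.

Let sq : Num.sqrt (x N) @[N --> \oo] --> Num.sqrt (0:R).
Proof. by apply: continuous_cvg => //; exact: sqrt_continuous. Qed.

(** To leading order [r ^ 2 = 2 D x], the rate for a walk of variance [1 / D] per step killed at
    rate [x]. *)
Lemma root_gap_sqrt : root_gap (x N) / Num.sqrt (x N) @[N --> \oo] --> Num.sqrt (2 * D).
Proof.
have : Num.sqrt (2 * D * (expR (x N) - 1) / x N * (1 + D * (expR (x N) - 1) / 2)) -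
    (2 * D * (expR (x N) - 1) / x N) * Num.sqrt (x N) / 2 @[N --> \oo] -->
    Num.sqrt (2 * D * (1 + 0 / 2)) - 2 * D * Num.sqrt 0 / 2.
  apply: cvgB; last first.
    apply: cvgM; last exact: cvg_cst.
    exact: cvgM kx sq.
  apply: continuous_cvg; first exact: sqrt_continuous.
  apply: (cvgM kx); apply: cvgD; first exact: cvg_cst.
  by apply: (cvgM k1); exact: cvg_cst.
rewrite sqrtr0 mulr0 !mul0r addr0 mulr1 subr0; apply: cvg_trans.
apply: near_eq_cvg; near=> N.
have xN : 0 < x N by near: N.
have sx : 0 < Num.sqrt (x N) by rewrite sqrtr_gt0.
have sxx : Num.sqrt (x N) ^+ 2 = x N by rewrite sqr_sqrtr// ltW.
have e1 : 0 <= D * (expR (x N) - 1) by rewrite mulr_ge0 ?ltW// subr_gt0 expR_gt1.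
rewrite /root_gap mulrBl; congr (_ - _).
  move: e1; rewrite -[2 * D * _]mulrA; set k := D * _ => e1.
  rewrite (_ : 2 * k / x N * (1 + k / 2) = 2 * k * (1 + k / 2) * (x N)^-1); last by ring.
  by rewrite sqrtrM ?sqrtrV ?(ltW xN)// mulr_ge0//; lra.
have -> : (x N)^-1 = (Num.sqrt (x N))^-1 ^+ 2 by rewrite exprVn sxx.
by field; rewrite gt_eqF.
Unshelve. all: by end_near. Qed.

End rate_asymptotics.

(** * The Laplace transform of the cover time *)

Section cover_laplace.
Context {R : realType} (d : nat).
Hypothesis d2 : (2 <= d)%N.
Variable (F : forall N : nat, {fset cylinder d N}).
Hypothesis hF : forall N : nat, (0 < N)%N -> forall x, x \in F N ->
  - (N%:R / 2) <= (x.2%:~R : R) <= N%:R / 2.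
Hypothesis hFoo : (fun N : nat => (#|` F N|)%fset) @ \oo --> \oo.
Variable lam : R.
Hypothesis lam0 : 0 < lam.

Notation D := (d.+1%:R : R).
Let K : R := heat_const d.
Let ell N : R := ln (#|` F N|)%fset%:R.
Let b N := N%:R ^+ d * ell N.
Let x N := lam / b N ^+ 2.
Let s N := expR (- x N).
Let t N := lazy_rate (s N).
Let r N := root_gap D (x N).
Let rho N := 1 - r N.
Let c N : R := N.-1.+1%:R^-1 ^+ d.
Let A N := c N * (4 * D * rho N / (t N * (1 - rho N) * (1 + rho N))).
(** Largest variation of the vertical profile over height differences up to [N]. *)
Let W N := A N * (1 - rho N ^+ N).
Let g : R := fine (green R (0 : 'rV[int]_d.+1)).
(** The limit of [A N / ell N], equal to [sqrt (2 D / lam)]; it is written as the limits of the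
    factors of [A N] produce it. *)
Let alpha := 4 * D * 1 / (1 * Num.sqrt (2 * D) * (1 + 1)) / Num.sqrt lam.

Let alpha0 : 0 < alpha.
Proof. by rewrite !divr_gt0// ?mulr_gt0// ?sqrtr_gt0 ?mulr_gt0//; lra. Qed.

Let near_pos : \forall N \near \oo, (0 < N)%N.
Proof. exact: nbhs_infty_gt. Qed.

Let ell_cvg : ell N @[N --> \oo] --> +oo.
Proof.
apply/cvgryPge => a; have /cvgnyPge/(_ (Num.trunc (expR a)).+1) := hFoo.
apply: filterS => N hN; rewrite -(expRK a) /ell ler_ln ?posrE ?expR_gt0//.
  by rewrite ltW// (lt_le_trans (truncnS_gt _))// ler_nat.
by rewrite ltr0n; apply: leq_trans hN.
Qed.

Let ell_ge1 : \forall N \near \oo, 1 <= ell N.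
Proof. by move/cvgryPge : ell_cvg; exact. Qed.

Let b_ge : \forall N \near \oo, ell N <= b N.
Proof.
near=> N; rewrite /b ler_peMl//; first by apply: le_trans ler01 _; near: N.
by rewrite exprn_ege1// ler1n; near: N.
Unshelve. all: by end_near. Qed.

Let b_gt0 : \forall N \near \oo, 0 < b N.
Proof.
near=> N; apply: (@lt_le_trans _ _ (ell N)); last by near: N.
by apply: lt_le_trans ltr01 _; near: N.
Unshelve. all: by end_near. Qed.

Let ellV : (ell N)^-1 @[N --> \oo] --> (0:R).
Proof.
apply/gtr0_cvgV0 => //; near=> N; apply: lt_le_trans ltr01 _; near: N; exact: ell_ge1.
Unshelve. all: by end_near. Qed.

Let bV : (b N)^-1 @[N --> \oo] --> (0:R).
Proof.
apply/gtr0_cvgV0 => //; apply/cvgryPge => a.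
near=> N; apply: (@le_trans _ _ (ell N)); last by near: N.
by near: N; move/cvgryPge : ell_cvg; exact.
Unshelve. all: by end_near. Qed.

Let x_cvg : x @ \oo --> (0:R).
Proof.
rewrite /x (_ : 0 = lam * (0 * 0)); last by rewrite !mulr0.
apply: cvgM; first exact: cvg_cst.
under eq_fun do rewrite expr2 invfM.
exact: cvgM.
Qed.

Let x_gt0 : \forall N \near \oo, 0 < x N.
Proof. by apply: filterS b_gt0 => N bN; rewrite divr_gt0// exprn_gt0. Qed.

(** As [d >= 2], the weight [N ^ (- d)] of the vertical part beats the height [N] of the band. *)
Let c_le : \forall N \near \oo, c N * N%:R <= N%:R^-1.
Proof.
apply: filterS near_pos => N N0; rewrite /c prednK//.
have N1 : 0 < N%:R :> R by rewrite ltr0n.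
have N2 : N%:R^-1 <= 1 :> R by rewrite invf_le1// ler1n.
have [d' dE] : exists d', d = d'.+2 by exists (d - 2)%N; lia.
have v0 : 0 <= N%:R^-1 :> R by rewrite invr_ge0.
have p1 : N%:R^-1 ^+ d' <= 1 :> R by rewrite exprn_ile1.
have vN : N%:R^-1 * N%:R = 1 :> R by rewrite mulVf// gt_eqF.
rewrite dE !exprS (_ : _ * _ * _ = N%:R^-1 * N%:R^-1 ^+ d' * (N%:R^-1 * N%:R)); last by ring.
by rewrite vN mulr1 ler_piMr.
Qed.

Let NV : N%:R^-1 @[N --> \oo] --> (0:R).
Proof.
apply/gtr0_cvgV0; first by apply: filterS near_pos => N N0; rewrite ltr0n.
exact/cvgrnyP.
Qed.

Let c_ge0 N : 0 <= c N. Proof. by rewrite exprn_ge0// invr_ge0. Qed.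

Let c_cvg (m : nat) : c N * m%:R @[N --> \oo] --> (0:R).
Proof.
apply: (@squeeze_cvgr _ _ _ _ (fun=> 0) (fun N => N%:R^-1 * m%:R)); last 2 first.
- exact: cvg_cst.
- by rewrite -[X in _ --> X](mul0r m%:R); apply: cvgM => //; exact: cvg_cst.
near=> N; rewrite mulr_ge0//= ler_wpM2r//; apply: le_trans (_ : c N * N%:R <= _).
  by rewrite ler_peMr// ler1n; near: N.
by near: N.
Unshelve. all: by end_near. Qed.

Let t_cvg : t N @[N --> \oo] --> (1:R).
Proof. exact: rate_cvg1 x_cvg. Qed.

Let r_cvg : r N @[N --> \oo] --> (0:R).
Proof. exact: root_gap_cvg0 x_cvg. Qed.

Let rho_cvg : rho N @[N --> \oo] --> (1:R).
Proof. by rewrite -[X in _ --> X]subr0; apply: cvgB => //; exact: cvg_cst. Qed.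

Let s01 : \forall N \near \oo, 0 <= s N < 1.
Proof. by apply: filterS x_gt0 => N xN; rewrite expR_ge0 expR_lt1 oppr_lt0. Qed.

Let t01 : \forall N \near \oo, 0 < t N < 1.
Proof.
apply: filterS s01 => N sN; have /andP[_ ->] := lazy_rate01 sN; rewrite andbT.
by rewrite divr_gt0// ?mulr_gt0// ?expR_gt0// ltr_pwDl// expR_ge0.
Qed.

Let r01 : \forall N \near \oo, 0 < r N < 1.
Proof. by apply: filterS x_gt0 => N xN; exact: root_gap01. Qed.

Let rho01 : \forall N \near \oo, 0 < rho N < 1.
Proof. by apply: filterS r01 => N /andP[? ?]; rewrite subr_gt0 gtrBl; apply/andP. Qed.

Let A_cvg : A N / ell N @[N --> \oo] --> alpha.
Proof.
have : 4 * D * rho N / (t N * (r N / Num.sqrt (x N)) * (1 + rho N)) / Num.sqrt lam @[N --> \oo] --> alpha.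
  apply: cvgM; last exact: cvg_cst.
  apply: cvgM; first by apply: cvgM => //; exact: cvg_cst.
  apply: cvgV; first by rewrite !mulf_neq0// ?gt_eqF// sqrtr_gt0 mulr_gt0.
  apply: cvgM; last by apply: cvgD => //; exact: cvg_cst.
  by apply: cvgM => //; exact: root_gap_sqrt.
apply: cvg_trans; apply: near_eq_cvg; near=> N.
have N0 : (0 < N)%N by near: N.
have bN : 0 < b N by near: N.
have l0 : 0 < ell N by apply: lt_le_trans ltr01 _; near: N.
have /andP[r0 r1] : 0 < r N < 1 by near: N.
have /andP[q0 q1] : 0 < rho N < 1 by near: N.
have /andP[t0 t1] : 0 < t N < 1 by near: N.
have sx : Num.sqrt (x N) = Num.sqrt lam / b N.
  by rewrite /x sqrtrM ?ltW// sqrtrV ?sqr_ge0// sqrtr_sqr gtr0_norm.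
have sl : 0 < Num.sqrt lam by rewrite sqrtr_gt0.
have NR : 0 < N%:R ^+ d :> R by rewrite exprn_gt0// ltr0n.
rewrite /A sx /c prednK// exprVn /b [1 - rho N]subKr.
by field; rewrite !gt_eqF//; lra.
Unshelve. all: by end_near. Qed.

Let A_gt0 : \forall N \near \oo, 0 < A N.
Proof.
near=> N.
have /andP[q0 q1] : 0 < rho N < 1 by near: N.
have /andP[t0 t1] : 0 < t N < 1 by near: N.
have c0 : 0 < c N by rewrite exprn_gt0// invr_gt0.
have p1 : 0 < 1 - rho N by rewrite subr_gt0.
have p2 : 0 < 1 + rho N by rewrite addr_gt0.
have h1 : 0 < 4 * D * rho N by rewrite pmulr_rgt0 ?pmulr_rgt0.
have h2 : 0 < t N * (1 - rho N) * (1 + rho N) by exact: (mulr_gt0 (mulr_gt0 t0 p1) p2).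
exact: mulr_gt0 c0 (divr_gt0 h1 h2).
Unshelve. all: by end_near. Qed.

Let bern (q : R) k : 0 <= q <= 1 -> 1 - q ^+ k <= k%:R * (1 - q).
Proof.
move=> /andP[q0 q1]; elim: k => [|k IH]; first by rewrite expr0 subrr mul0r.
rewrite exprS -[k.+1%:R]natr1.
have : 0 <= (1 - q) * (1 - q ^+ k) by rewrite mulr_ge0 ?subr_ge0// exprn_ile1.
by nra.
Qed.

(** The denominator of [A N] contains [1 - rho N], which cancels the Bernoulli bound [N (1 - rho N)]
    on the variation; what is left is of order [c N * N]. *)
Let W_cvg : W N @[N --> \oo] --> (0:R).
Proof.
apply: (@squeeze_cvgr _ _ _ _ (fun=> 0) (fun N => N%:R^-1 * (4 * D / t N))); last 2 first.
- exact: cvg_cst.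
- rewrite -[X in _ --> X](mul0r (4 * D / 1)); apply: cvgM => //.
  by apply: cvgM; [exact: cvg_cst|apply: cvgV => //; exact: oner_neq0].
near=> N.
have /andP[q0 q1] : 0 < rho N < 1 by near: N.
have /andP[t0 t1] : 0 < t N < 1 by near: N.
have AN : 0 < A N by near: N.
have q01 : 0 <= rho N <= 1 by rewrite !ltW.
apply/andP; split; first by rewrite mulr_ge0 ?(ltW AN)// subr_ge0 exprn_ile1// ltW.
apply: (@le_trans _ _ (A N * (N%:R * (1 - rho N)))).
  by rewrite ler_wpM2l ?(ltW AN)// bern.
rewrite (_ : _ * _ = (c N * N%:R) * (4 * D / t N * (rho N / (1 + rho N)))); last first.
  by rewrite /A; field; rewrite !gt_eqF//; lra.
apply: ler_pM.
- by rewrite mulr_ge0.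
- by rewrite !mulr_ge0 ?invr_ge0//; lra.
- by near: N.
- apply: ler_piMr; first by apply: divr_ge0; [exact: mulr_ge0|exact: ltW].
  by rewrite ler_pdivrMr; lra.
Unshelve. all: by end_near. Qed.

Let vertical_green_near : \forall N \near \oo, forall z : int, (absz z <= N)%N ->
  vertical_green d N (t N) (rho N) 0 = A N /\
  0 <= vertical_green d N (t N) (rho N) 0 - vertical_green d N (t N) (rho N) z <= W N.
Proof.
near=> N => z zN.
have /andP[q0 q1] : 0 < rho N < 1 by near: N.
have AN : 0 < A N by near: N.
have E y : vertical_green d N (t N) (rho N) y = A N * rho N ^+ absz y.
  by rewrite /vertical_green /A /c !mulrA.
rewrite !E expr0 mulr1; split => //; rewrite -{1 3}[A N]mulr1 -mulrBr mulr_ge0 ?(ltW AN)//=.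
  by rewrite /W ler_wpM2l ?(ltW AN)// lerD2l lerN2 ler_wiXn2l// ltW.
by rewrite subr_ge0 exprn_ile1// ltW.
Unshelve. all: by end_near. Qed.

Let green_estimates m N (y z : cylinder d N) : Prop :=
  let G := lazy_green (@cylinder_step d N) (t N) in
  [/\ A N - W N - 6 * K <= G y z, G y z <= A N + 6 * K &
   `|G z z - G y z - \sum_(0 <= k < m) (t N) ^+ k *
        (walk_prob R (lazy_step (@cylinder_step d N)) k z z - walk_prob R (lazy_step (@cylinder_step d N)) k y z)|
    <= 12 * K / Num.sqrt m.+1%:R + W N + c N * m%:R].

Let green_near m : \forall N \near \oo, forall y z : cylinder d N, (absz (y.2 - z.2) <= N)%N ->
  green_estimates m y z.
Proof.
near=> N.
have rN : 0 < rho N < 1 by near: N.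
have tN : 0 < t N < 1 by near: N.
have xN : 0 < x N by near: N.
have hr : 4 * D * rho N * (1 - t N) = t N * (1 - rho N) ^+ 2 by exact: root_gap_rate.
have VN : forall z : int, (absz z <= N)%N ->
  vertical_green d N (t N) (rho N) 0 = A N /\
  0 <= vertical_green d N (t N) (rho N) 0 - vertical_green d N (t N) (rho N) z <= W N by near: N.
move=> y z yz; rewrite /green_estimates; set G := lazy_green _ _.
have [V0 /andP[V1 V2]] := VN _ yz; rewrite V0 in V1 V2.
have := lazy_green_vertical d2 tN rN hr y z; rewrite -/G -/K ler_norml => /andP[h1 h2].
have h3 := lazy_green_increment d2 m tN rN hr y z; rewrite -/G -/K V0 in h3.
by split; [lra|lra|apply: le_trans h3 _; rewrite lerD2r lerD2l].
Unshelve. all: by end_near. Qed.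

Let height_diff N (y z : cylinder d N) : (0 < N)%N -> z \in F N -> (y \in F N \/ y.2 = 0) ->
  (absz (y.2 - z.2) <= N)%N.
Proof.
move=> N0 zF yF; have := hF N0 zF; move=> /andP[z1 z2].
have [y1 y2] : - (N%:R / 2) <= (y.2%:~R : R) /\ (y.2%:~R : R) <= N%:R / 2.
  case: yF => [/(hF N0)/andP//|->]; have : 0 <= N%:R :> R by [].
  by split; lra.
have : `|(y.2 - z.2)%:~R : R| <= N%:R by rewrite rmorphB ler_norml; apply/andP; split; lra.
by rewrite -intr_norm -[N%:R]/(N%:Z%:~R) ler_int -abszE lez_nat.
Qed.

Let C0 : (0 < #|{: option 'I_d}|)%N. Proof. by rewrite card_option. Qed.
Let I0 : (0 < #|{: option 'I_d * bool}|)%N.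
Proof. by rewrite card_prod card_bool muln_gt0 C0. Qed.
Let L0 : (0 < #|{: option 'I_d * (bool * bool)}|)%N.
Proof. by rewrite !card_prod card_bool muln_gt0 C0. Qed.

Let F_gt0 : \forall N \near \oo, (0 < #|` F N|)%N.
Proof. by have /cvgnyPge/(_ 1%N) := hFoo. Qed.

Let K0 : 0 <= K. Proof. exact: heat_const_ge0. Qed.

Let sqrt_small (eps : R) : 0 < eps -> exists m0, forall m, (m0 <= m)%N -> 12 * K / Num.sqrt m.+1%:R < eps.
Proof.
move=> e0; exists (Num.trunc ((12 * K / eps) ^+ 2)) => m hm.
have q0 : 0 < Num.sqrt (m.+1%:R : R) by rewrite sqrtr_gt0.
rewrite ltr_pdivrMr// [ltRHS]mulrC -ltr_pdivrMr//.
have h : (12 * K / eps) ^+ 2 < m.+1%:R.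
  by apply: lt_le_trans (truncnS_gt _) _; rewrite ler_nat.
have k0 : 0 <= 12 * K / eps by apply: divr_ge0; [apply: mulr_ge0 => //; exact: K0|exact: ltW].
rewrite -[ltLHS]ger0_norm// -sqrtr_sqr ltr_sqrt//.
Qed.

Let ell_ratio (a : R) : (ell N + a) / ell N @[N --> \oo] --> (1:R).
Proof.
have : 1 + a * (ell N)^-1 @[N --> \oo] --> 1 + a * 0.
  by apply: cvgD; [exact: cvg_cst|apply: cvgM => //; exact: cvg_cst].
rewrite mulr0 addr0; apply: cvg_trans; apply: near_eq_cvg; near=> N.
have l0 : 0 < ell N by apply: lt_le_trans ltr01 _; near: N.
by field; rewrite gt_eqF.
Unshelve. all: by end_near. Qed.

(** [U] bounds the drop from above and [B] the Green function off the diagonal from below, so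
    [gam = U / B] is admissible in [matthews_lower], with [c = (1 + gam)^-1] because the start is
    also within height [N] of [F]. The limit of [gam (1 + ell)] is below [v] by the choice of
    [m]. *)
Lemma cover_laplace_lower (v : R) : 2 * g / alpha < v ->
  \forall N \near \oo, forall y : cylinder d N, y.2 = 0 ->
  expR (- v) <= coverL (@cylinder_step d N) (s N) y (F N).
Proof.
move=> gv; have e0 : 0 < v * alpha - 2 * g by rewrite subr_gt0 -ltr_pdivrMr.
have [m /(_ m (leqnn m)) hm] := sqrt_small e0.
pose U N := 2 * g + 12 * K / Num.sqrt m.+1%:R + W N + c N * m%:R.
pose B N := A N - W N - 6 * K.
have Ucvg : U N @[N --> \oo] --> 2 * g + 12 * K / Num.sqrt m.+1%:R + 0 + 0.
  exact: (cvgD (cvgD (cvg_cst _) W_cvg) (c_cvg m)).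
have Bcvg : B N / ell N @[N --> \oo] --> alpha.
  have : A N / ell N - W N * (ell N)^-1 - 6 * K * (ell N)^-1 @[N --> \oo] --> alpha - 0 * 0 - 6 * K * 0.
    exact: (cvgB (cvgB A_cvg (cvgM W_cvg ellV)) (cvgM (cvg_cst _) ellV)).
  by rewrite !mulr0 !subr0; under eq_fun do rewrite -!mulrBl.
have Bpos : \forall N \near \oo, 0 < B N.
  near=> N; have l0 : 0 < ell N by apply: lt_le_trans ltr01 _; near: N.
  rewrite -(pmulr_lgt0 _ (_ : 0 < (ell N)^-1)) ?invr_gt0//.
  by near: N; exact: (cvgr_gt _ Bcvg).
have Gcvg : U N / (B N / ell N) * ((ell N + 1) / ell N) @[N --> \oo] -->
    (2 * g + 12 * K / Num.sqrt m.+1%:R + 0 + 0) / alpha * 1.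
  apply: cvgM => //; apply: cvgM => //; apply: cvgV => //; by rewrite gt_eqF.
rewrite mulr1 !addr0 in Gcvg.
have lim_lt : (2 * g + 12 * K / Num.sqrt m.+1%:R) / alpha < v by rewrite ltr_pdivrMr//; lra.
have near_v : \forall N \near \oo, U N / (B N / ell N) * ((ell N + 1) / ell N) < v by apply: (cvgr_lt _ Gcvg).
have gm := green_near m.
near=> N => y y0.
have N0 : (0 < N)%N by near: N.
have mN : (m <= N)%N by near: N; exact: nbhs_infty_ge.
have BN : 0 < B N by near: N.
have l0 : 0 < ell N by apply: lt_le_trans ltr01 _; near: N.
have sN : 0 <= s N < 1 by near: N.
have tN : 0 < t N < 1 by near: N.
have F0 : (0 < #|` F N|)%N by near: N.
have W0 : 0 <= W N.
  have AN : 0 < A N by near: N.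
  have /andP[q0 q1] : 0 < rho N < 1 by near: N.
  by rewrite mulr_ge0 ?(ltW AN)// subr_ge0 exprn_ile1// ltW.
have g0 : 0 <= g.
  by have := lazy_lattice_sum_le d2 0 (R := R); rewrite big_geq// pmulr_rge0.
have U0 : 0 <= U N by rewrite !addr_ge0// ?mulr_ge0 ?invr_ge0 ?sqrtr_ge0.
pose gam := U N / B N.
have gam0 : 0 <= gam by rewrite divr_ge0// ltW.
have GN : forall y z : cylinder d N, (absz (y.2 - z.2) <= N)%N -> green_estimates m y z by near: N.
have phi u z : (absz (u.2 - z.2) <= N)%N ->
    1 <= (1 + gam) * coverL (@cylinder_step d N) (s N) u [fset z]%fset.
  move=> uz; have [h1 _ h3] := GN _ _ uz.
  rewrite coverL1_green// -/(t N); set Gzz := lazy_green _ _ z z; set Guz := lazy_green _ _ u z.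
  have Gp : 0 < Gzz.
    apply: lt_le_trans ltr01 _; apply: lazy_green_diag_ge1 => //.
    by case/andP: tN => a1 a2; rewrite ltW.
  rewrite mulrA ler_pdivlMr// mul1r mulrDl mul1r -lerBlDl.
  (* Removing the factors [t ^ k] and the off-diagonal terms only increases the sum, and for
     [k < m <= N] the diagonal terms are those of the lattice. *)
  have S : \sum_(0 <= k < m) t N ^+ k * (walk_prob R (lazy_step (@cylinder_step d N)) k z z -
     walk_prob R (lazy_step (@cylinder_step d N)) k u z) <= 2 * g.
    apply: le_trans (lazy_lattice_sum_le d2 m); rewrite !big_nat; apply: ler_sum => k /andP[_ km].
    rewrite (@lattice_eq_cylinder _ _ N _ z); last exact: leq_trans km mN.
    have /andP[p0 p1] := walk_prob01 (R := R) (lazy_step (@cylinder_step d N)) L0 k z z.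
    have /andP[q0 q1] := walk_prob01 (R := R) (lazy_step (@cylinder_step d N)) L0 k u z.
    have /andP[t0 t1] := tN.
    have [tk0 tk1] : 0 <= t N ^+ k /\ t N ^+ k <= 1 by rewrite exprn_ge0 ?exprn_ile1// ltW.
    by nra.
  have hU : Gzz - Guz <= U N.
    by move: h3; rewrite -/Gzz -/Guz ler_norml => /andP[_]; rewrite /U; lra.
  apply: le_trans hU _; rewrite /gam mulrAC ler_pdivlMr//.
  by rewrite ler_wpM2l.
apply: (@le_trans _ _ ((1 + gam)^-1 * matthews_prod gam #|` F N|)).
  apply: le_trans (matthews_prod_ge gam0 F0); rewrite ler_expR mulNr lerN2 ltW//.
  have : U N / (B N / ell N) * ((ell N + 1) / ell N) < v by near: N.
  rewrite (_ : _ * _ = gam * (1 + ell N))//.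
  by rewrite /gam; field; rewrite !gt_eqF.
apply: matthews_lower => //.
- by move=> u z uF zF _; apply: phi; apply: height_diff => //; left.
- move=> z zF; rewrite -(ler_pM2l (_ : 0 < 1 + gam)) ?ltr_pwDl// mulfV; last by rewrite gt_eqF// ltr_pwDl.
  by apply: phi; apply: height_diff => //; right.
Unshelve. all: by end_near. Qed.

(** Now the drop must be almost [2 g] from below, which fails for neighbouring points. On a subset
    whose distinct points do not communicate in fewer than [m] steps, the first [m] off-diagonal
    terms vanish, and such a subset retains a fraction [1 / M] of [F]. *)
Lemma cover_laplace_upper (v : R) : v < 2 * g / alpha ->
  \forall N \near \oo, forall y : cylinder d N,
  coverL (@cylinder_step d N) (s N) y (F N) <= expR (- v).
Proof.
(* For negative [v] the bound follows from [coverL <= 1]. Otherwise the limit of [U] is positive,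
   which makes [gam] nonnegative. *)
have [v0 _|v0 gv] := ltrP v 0.
  near=> N => y; have sN : 0 <= s N < 1 by near: N.
  have /andP[_ h] := coverL01 (@cylinder_step d N) I0 y (F N) sN.
  by apply: le_trans h _; rewrite -expR0 ler_expR; lra.
pose q m : R := \sum_(0 <= k < m) walk_prob R (lazy_step (@lattice_step d.+1)) k 0 0.
have e0 : 0 < (2 * g - v * alpha) / 2.
  by rewrite divr_gt0// subr_gt0 -ltr_pdivlMr.
have [m1 hm1] := sqrt_small e0; have [m2 hm2] := lazy_lattice_sum_cvg d2 e0.
pose m := maxn m1 m2.
have {hm1} hm1 := hm1 m (leq_maxl _ _); have {hm2} hm2 := hm2 m (leq_maxr _ _).
have hq : v * alpha < q m - 12 * K / Num.sqrt m.+1%:R by rewrite -/g -/(q m) in hm2; lra.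
pose U N := q m - m%:R * (m%:R * (1 - t N)) - 12 * K / Num.sqrt m.+1%:R - W N - c N * m%:R.
pose B N := A N + 6 * K.
pose M := @close_bound (option 'I_d * (bool * bool))%type m.
(* Shift of the logarithm: [ln M] is lost by thinning, [ln 2] in [matthews_prod_le]. *)
pose a : R := - ln M%:R - ln 2.
have M0 : 0 < M%:R :> R by rewrite ltr0n.
have Ucvg : U N @[N --> \oo] --> q m - m%:R * (m%:R * (1 - 1)) - 12 * K / Num.sqrt m.+1%:R - 0 - 0.
  apply: cvgB (c_cvg m); apply: cvgB W_cvg; apply: cvgB; last exact: cvg_cst.
  apply: cvgB; first exact: cvg_cst.
  apply: cvgM; first exact: cvg_cst.
  apply: cvgM; first exact: cvg_cst.
  by apply: cvgB => //; exact: cvg_cst.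
rewrite subrr !mulr0 !subr0 in Ucvg.
have Bcvg : B N / ell N @[N --> \oo] --> alpha.
  have : A N / ell N + 6 * K * (ell N)^-1 @[N --> \oo] --> alpha + 6 * K * 0.
    by apply: cvgD => //; apply: cvgM => //; exact: cvg_cst.
  by rewrite mulr0 addr0; under eq_fun do rewrite -mulrDl.
have Gcvg : U N / (B N / ell N) @[N --> \oo] --> (q m - 12 * K / Num.sqrt m.+1%:R) / alpha.
  apply: cvgM => //; apply: cvgV => //; by rewrite gt_eqF.
set L := (_ / alpha) in Gcvg.
have Lv : v < L by rewrite ltr_pdivlMr.
have Ecvg : U N / (B N / ell N) * ((ell N + a) / ell N) -
    (U N / (B N / ell N) * (ell N)^-1) * (U N / (B N / ell N) * (ell N)^-1) @[N --> \oo] --> L * 1 - (L * 0) * (L * 0).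
  by apply: cvgB; [exact: cvgM|apply: cvgM; exact: cvgM].
rewrite mulr1 !mulr0 subr0 in Ecvg.
have near_v : \forall N \near \oo, v < U N / (B N / ell N) * ((ell N + a) / ell N) - (U N / (B N / ell N) * (ell N)^-1) * (U N / (B N / ell N) * (ell N)^-1) by apply: (cvgr_gt _ Ecvg).
have Upos : \forall N \near \oo, 0 < U N.
  by apply: (cvgr_gt _ Ucvg); apply: le_lt_trans hq; rewrite mulr_ge0// ltW.
have gm := green_near m.
near=> N => y.
have N0 : (0 < N)%N by near: N.
have AN : 0 < A N by near: N.
have BN : 0 < B N by apply: ltr_wpDr => //; apply: mulr_ge0.
have l0 : 0 < ell N by apply: lt_le_trans ltr01 _; near: N.
have sN : 0 <= s N < 1 by near: N.
have tN : 0 < t N < 1 by near: N.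
have F0 : (0 < #|` F N|)%N by near: N.
have UN : 0 < U N by near: N.
pose gam := U N / B N.
have gam0 : 0 <= gam by rewrite divr_ge0// ltW.
have GN : forall y z : cylinder d N, (absz (y.2 - z.2) <= N)%N -> green_estimates m y z by near: N.
have [F' subF [cF sep]] := separated_subset (R := R) (lazy_step (@cylinder_step d N)) m (F N).
have F'0 : (0 < #|` F'|)%N by move: F0; rewrite lt0n; apply: contraNT; rewrite -leqNgt leqn0 => /eqP h; rewrite h muln0 in cF; rewrite -leqn0.
have phi u z : u \in F' -> z \in F' -> u != z ->
    (1 + gam) * coverL (@cylinder_step d N) (s N) u [fset z]%fset <= 1.
  move=> uF zF uz.
  have uz2 : (absz (u.2 - z.2) <= N)%N.
    by apply: height_diff => //; [exact: (fsubsetP subF)|left; exact: (fsubsetP subF)].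
  have [_ h1 h3] := GN _ _ uz2.
  rewrite coverL1_green// -/(t N); set Gzz := lazy_green _ _ z z; set Guz := lazy_green _ _ u z.
  have Gp : 0 < Gzz.
    apply: lt_le_trans ltr01 _; apply: lazy_green_diag_ge1 => //.
    by case/andP: tN => a1 a2; rewrite ltW.
  rewrite mulrA ler_pdivrMr// mul1r mulrDl mul1r -lerBrDl.
  have S : q m - m%:R * (m%:R * (1 - t N)) <= \sum_(0 <= k < m) t N ^+ k * (walk_prob R (lazy_step (@cylinder_step d N)) k z z -
     walk_prob R (lazy_step (@cylinder_step d N)) k u z).
    have t01' : 0 <= t N <= 1 by case/andP: tN => *; rewrite !ltW.
    have q01 k : 0 <= walk_prob R (lazy_step (@lattice_step d.+1)) k 0 0 <= 1.
      by apply: walk_prob01; rewrite !card_prod card_bool card_ord.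
    rewrite lerBlDr; apply: le_trans (abel_diff m t01' q01) _; rewrite lerD2r.
    rewrite !big_nat; apply: ler_sum => k /andP[_ km].
    rewrite (sep _ _ uF zF uz k km) subr0 ler_wpM2l ?exprn_ge0//; first by case/andP: t01'.
    exact: lattice_le_cylinder.
  have hU : U N <= Gzz - Guz.
    by move: h3; rewrite -/Gzz -/Guz ler_norml => /andP[+ _]; rewrite /U; lra.
  apply: le_trans hU; rewrite /gam mulrAC ler_pdivrMr//.
  by rewrite ler_wpM2l// ltW.
apply: le_trans (coverL_sub (@cylinder_step d N) I0 y sN subF) _.
apply: le_trans (matthews_upper (st := @cylinder_step d N) I0 y sN gam0 phi F'0) _.
apply: le_trans (matthews_prod_le gam0 F'0) _; rewrite ler_expR.
have : v < U N / (B N / ell N) * ((ell N + a) / ell N) -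
    (U N / (B N / ell N) * (ell N)^-1) * (U N / (B N / ell N) * (ell N)^-1) by near: N.
rewrite (_ : U N / (B N / ell N) * ((ell N + a) / ell N) = gam * (ell N + a)); last first.
  by rewrite /gam; field; rewrite !gt_eqF.
rewrite (_ : U N / (B N / ell N) * (ell N)^-1 = gam); last by rewrite /gam; field; rewrite !gt_eqF.
have le_ell : ell N - ln M%:R <= ln #|` F'|.+1%:R.
  rewrite lerBlDr -lnM ?posrE// ler_ln ?posrE ?mulr_gt0 ?ltr0n//.
  by rewrite -natrM ler_nat mulnC (leq_trans cF)// leq_mul2l leqnSn orbT.
have : gam * (ell N - ln M%:R) <= gam * ln #|` F'|.+1%:R by rewrite ler_wpM2l.
rewrite /a expr2; lra.
Unshelve. all: by end_near. Qed.

Lemma cover_laplace (eps : R) : 0 < eps ->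
  \forall N \near \oo, forall y : cylinder d N, y.2 = 0 ->
  `|coverL (@cylinder_step d N) (s N) y (F N) - expR (- (g / Num.sqrt D * Num.sqrt (2 * lam)))| <= eps.
Proof.
move=> eps0.
have q2 : 0 < Num.sqrt (2 * D) by rewrite sqrtr_gt0 mulr_gt0.
have ql : 0 < Num.sqrt lam by rewrite sqrtr_gt0.
have qD : 0 < Num.sqrt D by rewrite sqrtr_gt0.
have -> : g / Num.sqrt D * Num.sqrt (2 * lam) = 2 * g / alpha.
  rewrite /alpha !sqrtrM//.
  have s2 : 0 < Num.sqrt 2 :> R by rewrite sqrtr_gt0.
  have s22 : 2 = Num.sqrt 2 ^+ 2 :> R by rewrite sqr_sqrtr.
  have DD : D = Num.sqrt D ^+ 2 by rewrite sqr_sqrtr.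
  rewrite [in RHS]DD sqrtr_sqr (gtr0_norm qD).
  by field; rewrite !gt_eqF.
set u := 2 * g / alpha.
have ce : expR (- v) @[v --> u] --> expR (- u).
  by apply: continuous_cvg; [exact: continuous_expR|exact: cvgN].
have /cvgrPdist_le/(_ _ eps0) := ce.
move=> /nbhs_ballP[del /= del0 hdel].
have h1 : `|expR (- u) - expR (- (u + del / 2))| <= eps.
  by apply: hdel; rewrite /ball/= opprD addrA subrr add0r normrN gtr0_norm ?divr_gt0//; lra.
have h2 : `|expR (- u) - expR (- (u - del / 2))| <= eps.
  by apply: hdel; rewrite /ball/= opprB addrC subrK gtr0_norm ?divr_gt0//; lra.
have l1 : u < u + del / 2 by lra.
have l2 : u - del / 2 < u by lra.
have n1 := cover_laplace_lower l1; have n2 := cover_laplace_upper l2.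
near=> N => y y0.
have N1 : forall y : cylinder d N, y.2 = 0 -> expR (- (u + del / 2)) <= coverL (@cylinder_step d N) (s N) y (F N) by near: N.
have N2 : forall y : cylinder d N, coverL (@cylinder_step d N) (s N) y (F N) <= expR (- (u - del / 2)) by near: N.
have := N1 y y0; have := N2 y; move: h1 h2; rewrite !ler_norml => /andP[a1 a2] /andP[b1 b2] c1 c2.
apply/andP; split; lra.
Unshelve. all: by end_near. Qed.

End cover_laplace.

(** * The comparison function for Brownian motion *)

Section exp_taylor.
Context {R : realType}.
Implicit Types w : R.

(** Since [(m + i)! >= i!], the tail is dominated by [|w| ^ m] times the series of [exp |w|]. *)
Lemma expR_taylor_bound m w :
  `|expR w - \sum_(0 <= k < m) w ^+ k / k`!%:R| <= `|w| ^+ m * expR `|w|.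
Proof.
have cw : series (exp_coeff w) n @[n --> \oo] --> expR w by exact: is_cvg_series_exp_coeff.
have ca : series (exp_coeff `|w|) n @[n --> \oo] --> expR `|w| by exact: is_cvg_series_exp_coeff.
have part n : series (exp_coeff `|w|) n <= expR `|w|.
  rewrite -(cvg_lim (@Rhausdorff R) ca); apply: nondecreasing_cvgn_le.
    by apply: nondecreasing_series => k _ _; exact: exp_coeff_ge0.
  exact: is_cvg_series_exp_coeff.
have c2 : series (exp_coeff w) (n + m)%N - \sum_(0 <= k < m) w ^+ k / k`!%:R @[n --> \oo] -->
    expR w - \sum_(0 <= k < m) w ^+ k / k`!%:R.
  by apply: cvgB; [rewrite (cvg_shiftn m (series (exp_coeff w)))|exact: cvg_cst].
have c3 : `|series (exp_coeff w) (n + m)%N - \sum_(0 <= k < m) w ^+ k / k`!%:R| @[n --> \oo] -->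
    `|expR w - \sum_(0 <= k < m) w ^+ k / k`!%:R| by exact: cvg_norm.
rewrite -(cvg_lim (@Rhausdorff R) c3); apply: limr_le; first by apply/cvg_ex; eexists; exact: c3.
near=> n.
rewrite /series/= (@big_cat_nat _ _ _ m)//= ?leq_addl//.
rewrite (_ : \sum_(0 <= i < m) exp_coeff w i = \sum_(0 <= k < m) w ^+ k / k`!%:R)//.
rewrite [X in `|X|]addrAC subrr add0r.
rewrite -{1}[m]add0n big_addn addnK.
apply: le_trans (ler_norm_sum _ _ _) _.
apply: (@le_trans _ _ (\sum_(0 <= i < n) `|w| ^+ m * exp_coeff `|w| i)).
  apply: ler_sum => i _; rewrite /exp_coeff/= normrM normrX normfV.
  rewrite mulrA -exprD [(m + i)%N]addnC normr_nat ler_wpM2l ?exprn_ge0//.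
  by rewrite lef_pV2 ?posrE ?ltr0n ?fact_gt0// ler_nat leq_fact// leq_addr.
by rewrite -mulr_sumr ler_wpM2l//; exact: part.
Unshelve. all: by end_near. Qed.

Lemma expR_taylor2 w : `|expR w - 1 - w| <= w ^+ 2 * expR `|w|.
Proof.
have := expR_taylor_bound 2 w; rewrite !big_nat_recr// big_geq//= add0r expr0 expr1 !divr1.
by rewrite opprD addrA real_normK ?num_real.
Qed.

Lemma expR_taylor3 w : `|expR w - 1 - w - w ^+ 2 / 2| <= `|w| ^+ 3 * expR `|w|.
Proof.
have := expR_taylor_bound 3 w; rewrite !big_nat_recr// big_geq//= add0r expr0 expr1 !divr1.
by rewrite !opprD !addrA.
Qed.

End exp_taylor.

(** * Integration against a measure with a density *)

Section density.
Context d (T : measurableType d) (R : realType).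
Variables (mu nu : {measure set T -> \bar R}) (g : T -> R).
Hypothesis mg : measurable_fun [set: T] g.
Hypothesis g0 : forall x, 0 <= g x.
Hypothesis nuE : forall A, measurable A -> nu A = (\int[mu]_(x in A) (g x)%:E)%E.

Variable f : T -> \bar R.
Hypothesis mf : measurable_fun [set: T] f.
Hypothesis f0 : forall x, (0 <= f x)%E.

Import HBNNSimple.

Let integral_density_nnsfun (k : {nnsfun T >-> R}) :
  (\int[nu]_x (k x)%:E = \int[mu]_x ((k x)%:E * (g x)%:E))%E.
Proof.
transitivity (\int[nu]_x (\sum_(y \in range k) (y * \1_(k @^-1` [set y]) x)%:E))%E.
  by apply: eq_integral => x _; rewrite fimfunE -fsumEFin.
rewrite ge0_integral_fsum//; last 2 first.
- by move=> r; exact/measurable_EFinP/measurableT_comp.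
- by move=> n x _; rewrite EFinM nnfun_muleindic_ge0.
transitivity (\int[mu]_x (\sum_(y \in range k) ((y * \1_(k @^-1` [set y]) x)%:E * (g x)%:E)))%E; last first.
  apply: eq_integral => x _; rewrite -ge0_mule_fsuml; last by move=> y; exact: nnfun_muleindic_ge0.
  by rewrite fsumEFin// -(fimfunE _ x).
rewrite ge0_integral_fsum//; last 2 first.
- move=> y; apply: emeasurable_funM; last exact/measurable_EFinP.
  by apply/measurable_EFinP/measurableT_comp.
- by move=> y x _; rewrite mule_ge0 ?lee_fin//; exact: nnfun_muleindic_ge0.
apply: eq_fsbigr => y; rewrite inE => -[x _ <-].
rewrite integralZl_indic_nnsfun// integral_indic// setIT nuE//.
under [in RHS]eq_integral do rewrite EFinM -muleA.
rewrite ge0_integralZl//=; last 3 first.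
- by apply: emeasurable_funM; [apply/measurable_EFinP; exact: measurable_indic|exact/measurable_EFinP].
- by move=> z _; rewrite mule_ge0// lee_fin.
- by rewrite lee_fin.
congr (_ * _)%E; rewrite integral_mkcond; apply: eq_integral => z _.
by rewrite epatch_indic muleC.
Qed.

Lemma integral_density : (\int[nu]_x f x = \int[mu]_x (f x * (g x)%:E))%E.
Proof.
pose f_ := nnsfun_approx measurableT mf.
transitivity (lim (\int[nu]_x (f_ n x)%:E @[n --> \oo])%E).
  rewrite -monotone_convergence//=.
  - apply: eq_integral => ? /[!inE] xD; apply/esym/cvg_lim => //=.
    exact: cvg_nnsfun_approx.
  - by move=> n; exact/measurable_EFinP/measurable_funTS.
  - by move=> n ? _; rewrite lee_fin.
  - by move=> ? _ ? ? mn; rewrite lee_fin; exact/lefP/nd_nnsfun_approx.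
transitivity (lim (\int[mu]_x ((f_ n x)%:E * (g x)%:E) @[n --> \oo])%E).
  by apply: congr_lim; apply/funext => n /=; exact: integral_density_nnsfun.
rewrite -monotone_convergence//=.
- apply: eq_integral => x _; apply/cvg_lim => //=.
  apply: cvgeZr => //; exact: cvg_nnsfun_approx.
- by move=> n; apply: emeasurable_funM; exact/measurable_EFinP.
- by move=> n x _; rewrite mule_ge0// lee_fin.
- by move=> x _ m n mn; rewrite lee_wpmul2r ?lee_fin//; exact/lefP/nd_nnsfun_approx.
Qed.

End density.

(** * Gaussian averages through exponentials *)

Section gauss_exp.
Context {R : realType} (h : R).
Hypothesis h0 : 0 < h.

Let gam := normal_prob 0 (Num.sqrt h).
Let q0 : Num.sqrt h != 0. Proof. by rewrite gt_eqF// sqrtr_gt0. Qed.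
Let qq : Num.sqrt h ^+ 2 = h. Proof. by rewrite sqr_sqrtr// ltW. Qed.

Let measurable_exp (t : R) : measurable_fun [set: R] (fun y => expR (t * y)).
Proof. by apply: measurableT_comp => //; exact: measurable_funM. Qed.

(** Completing the square gives a multiple of the normal density centred at [t h]. *)
Lemma normal_integral_expR (t : R) :
  (\int[gam]_y (expR (t * y))%:E = (expR (t ^+ 2 * h / 2))%:E)%E.
Proof.
rewrite (@integral_density _ _ _ lebesgue_measure gam (normal_pdf 0 (Num.sqrt h)) (measurable_normal_pdf _ _) (normal_pdf_ge0 _ _)); last 3 first.
- by [].
- by apply/measurable_EFinP; exact: measurable_exp.
- by move=> y; rewrite lee_fin expR_ge0.
transitivity (\int[lebesgue_measure]_y ((expR (t ^+ 2 * h / 2))%:E * (normal_pdf (t * h) (Num.sqrt h) y)%:E))%E.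
  apply: eq_integral => y _; rewrite -!EFinM; congr (_%:E).
  rewrite !normal_pdfE// mulrCA [in RHS]mulrCA; congr (_ * _).
  rewrite /normal_fun -!expRD qq; congr expR; field; exact: lt0r_neq0.
rewrite ge0_integralZl//=; first by rewrite integral_normal_pdf mule1.
- by apply/measurable_EFinP; exact: measurable_normal_pdf.
- by move=> y _; rewrite lee_fin normal_pdf_ge0.
Qed.

Let expsum (s : seq (R * R)) (y : R) := \sum_(p <- s) p.1 * expR (p.2 * y).

Let integrable_expR t : gam.-integrable [set: R] (fun y => (expR (t * y))%:E).
Proof.
apply/integrableP; split; first by apply/measurable_EFinP; exact: measurable_exp.
under eq_integral do rewrite /= ger0_norm ?expR_ge0//.
by rewrite normal_integral_expR ltry.
Qed.

Let integral_expsum s : gam.-integrable [set: R] (EFin \o expsum s) /\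
  \int[gam]_y expsum s y = \sum_(p <- s) p.1 * expR (p.2 ^+ 2 * h / 2).
Proof.
elim: s => [|[c t] s [IH1 IH2]].
  rewrite (_ : expsum [::] = cst 0); last by apply/funext => y; rewrite /expsum big_nil.
  split; first exact: (finite_measure_integrable_cst gam 0).
  by rewrite big_nil Rintegral_cst// mul0r.
have i1 : gam.-integrable [set: R] (EFin \o (fun y => c * expR (t * y))).
  by rewrite (_ : EFin \o _ = fun y => c%:E * (expR (t * y))%:E)%E //; apply: integrableZl.
rewrite (_ : expsum _ = fun y => c * expR (t * y) + expsum s y); last first.
  by apply/funext => y; rewrite /expsum big_cons.
split; first by rewrite (_ : EFin \o _ = (EFin \o (fun y => (c * expR (t * y))%R)) \+ (EFin \o expsum s))%E //; apply: integrableD.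
rewrite RintegralD// IH2 big_cons/= RintegralZl//; last exact: integrable_expR.
by rewrite /Rintegral normal_integral_expR.
Qed.

(* The comparison functions are combinations of exponentials, so only the moment
   generating function of the normal law is needed; the exponents +-2/sqrt h
   control the third-order remainder. *)
Lemma normal_second_order (f : R -> R) (x f0 f1 f2 C : R) : h <= 1 ->
  measurable_fun [set: R] f -> (forall y, 0 <= f y <= 1) -> 0 <= C ->
  (forall y, `|f (x + y) - (f0 + f1 * y + f2 * y ^+ 2)| <= C * `|y| ^+ 3) ->
  `|\int[gam]_y f (x + y) - (f0 + f2 * h)| <=
    (12 * expR 2 * (C + `|f1| + 2 * `|f2|) + 2 * `|f2|) * (h * Num.sqrt h).
Proof.
move=> h1 mf f01 C0 fC.
set q := Num.sqrt h; have q0' : 0 < q by rewrite sqrtr_gt0.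
have q1 : q <= 1 by rewrite -[leRHS]sqrtr1 ler_sqrt.
set K := C + `|f1| + 2 * `|f2|.
have K0 : 0 <= K by rewrite !addr_ge0// mulr_ge0.
(* [z ^ 3 / 6 <= exp z] at [z = |y| / q], and [|y| <= |y| / q] because [q <= 1]. *)
have third y : `|y| ^+ 3 * expR `|y| <= 6 * (h * q) * (expR (2 / q * y) + expR (- (2 / q) * y)).
  have e1 : `|y| ^+ 3 <= 6 * (h * q) * expR (`|y| / q).
    have := @expR_ge1Dxn R (`|y| / q) 2 (divr_ge0 (normr_ge0 y) (ltW q0')).
    rewrite expr_div_n (_ : 3`!%:R = 6 :> R)// => e.
    rewrite -ler_pdivrMl ?mulr_gt0//.
    apply: le_trans e; rewrite (_ : (6 * (h * q))^-1 * `|y| ^+ 3 = `|y| ^+ 3 / q ^+ 3 / 6) ?lerDr//.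
    by rewrite -[h]qq -/q; field; rewrite gt_eqF.
  have e2 : expR `|y| <= expR (`|y| / q).
    by rewrite ler_expR ler_pdivlMr// ler_piMr.
  apply: (@le_trans _ _ (6 * (h * q) * expR (`|y| / q) * expR (`|y| / q))).
    by apply: ler_pM.
  rewrite -mulrA ler_wpM2l ?mulr_ge0 ?(ltW h0) ?(ltW q0')// -expRD.
  case: (lerP 0 y) => y0.
    by have -> : `|y| / q + `|y| / q = 2 / q * y; [rewrite ger0_norm//; ring|rewrite lerDl expR_ge0].
  by have -> : `|y| / q + `|y| / q = - (2 / q) * y; [rewrite ltr0_norm//; ring|rewrite lerDr expR_ge0].
(* [y] and [y ^ 2] are replaced by [sinh y] and [2 cosh y - 2], whose Gaussian means are explicit,
   at the cost of a third-order error. *)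
pose m y := f0 + f1 * ((expR y - expR (- y)) / 2) + f2 * (expR y + expR (- y) - 2).
have err y : `|f (x + y) - m y| <= K * (`|y| ^+ 3 * expR `|y|).
  have t1 := expR_taylor3 y; have t2 := expR_taylor3 (- y).
  rewrite normrN sqrrN in t2; set B := `|y| ^+ 3 * expR `|y| in t1 t2 *.
  have B0 : 0 <= B by rewrite mulr_ge0 ?exprn_ge0 ?expR_ge0.
  have s1 : `|(expR y - expR (- y)) / 2 - y| <= B.
    rewrite ler_norml; move: t1 t2; rewrite !ler_norml => /andP[? ?] /andP[? ?]; apply/andP; split; lra.
  have s2 : `|expR y + expR (- y) - 2 - y ^+ 2| <= 2 * B.
    rewrite ler_norml; move: t1 t2; rewrite !ler_norml => /andP[? ?] /andP[? ?]; apply/andP; split; lra.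
  have s3 : C * `|y| ^+ 3 <= C * B.
    by rewrite ler_wpM2l// ler_peMr ?exprn_ge0// -expR0 ler_expR.
  rewrite (_ : f (x + y) - m y = (f (x + y) - (f0 + f1 * y + f2 * y ^+ 2)) -
     f1 * ((expR y - expR (- y)) / 2 - y) - f2 * (expR y + expR (- y) - 2 - y ^+ 2)); last first.
    by rewrite /m; ring.
  apply: le_trans (ler_normB _ _) _; apply: le_trans (lerD (ler_normB _ _) (lexx _)) _.
  rewrite !normrM /K [leRHS]mulrDl [(C + _) * _]mulrDl; apply: lerD; [apply: lerD|].
  - exact: le_trans (fC y) s3.
  - by rewrite ler_wpM2l.
  - by rewrite [2 * _]mulrC -mulrA ler_wpM2l.
(* A majorant for a suitable [e > 0] and a minorant for [- e]. The exponents [2 / q] and [- 2 / q]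
   have Gaussian mean [exp 2] whatever [h] is. *)
pose L e := [:: (f0 - 2 * f2, 0); (f1 / 2 + f2, 1); (f2 - f1 / 2, -1); (e, 2 / q); (e, - (2 / q))].
have LE e y : expsum (L e) y = m y + e * (expR (2 / q * y) + expR (- (2 / q) * y)).
  rewrite /expsum /L !big_cons big_nil/= mul0r expR0 mul1r mulN1r /m.
  by set u := expR y; set v := expR (- y); field.
have IE e : \int[gam]_y expsum (L e) y = f0 + 2 * f2 * (expR (h / 2) - 1) + 2 * e * expR 2.
  have [_ ->] := integral_expsum (L e); rewrite /L !big_cons big_nil/=.
  rewrite !expr0n/= mul0r mul0r expR0 !sqrrN expr1n !mul1r.
  have qz : q != 0 by rewrite gt_eqF.
  rewrite (_ : (2 / q) ^+ 2 * h / 2 = 2); last by rewrite -[h]qq -/q; field.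
  by set u := expR (h / 2); set v := expR 2; field.
have intf : gam.-integrable [set: R] (EFin \o (fun y => f (x + y))).
  apply: measurable_bounded_integrable => //.
  - exact: (le_lt_trans (probability_le1 gam measurableT) (ltry 1)).
  - by apply: measurableT_comp => //; exact: measurable_funD.
  - exists 1; split => // M M1 y _ /=; have /andP[? ?] := f01 (x + y).
    by rewrite ger0_norm// (le_trans _ (ltW M1)).
pose e := K * (6 * (h * q)).
have up : \int[gam]_y f (x + y) <= \int[gam]_y expsum (L e) y.
  apply: le_Rintegral => //; first by have [] := integral_expsum (L e).
  move=> y _; rewrite LE; have := err y; have := third y; rewrite ler_norml => t /andP[_].
  have : K * (`|y| ^+ 3 * expR `|y|) <= e * (expR (2 / q * y) + expR (- (2 / q) * y)) by rewrite /e -mulrA ler_wpM2l.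
  lra.
have dn : \int[gam]_y expsum (L (- e)) y <= \int[gam]_y f (x + y).
  apply: le_Rintegral => //; first by have [] := integral_expsum (L (- e)).
  move=> y _; rewrite LE; have := err y; have := third y; rewrite ler_norml => t /andP[+ _].
  have : K * (`|y| ^+ 3 * expR `|y|) <= e * (expR (2 / q * y) + expR (- (2 / q) * y)) by rewrite /e -mulrA ler_wpM2l.
  rewrite mulNr; lra.
move: up dn; rewrite !IE.
have hexp : `|expR (h / 2) - 1 - h / 2| <= h * q.
  apply: le_trans (expR_taylor2 _) _; rewrite ger0_norm; last by rewrite divr_ge0// ltW.
  have e2 : expR (h / 2) <= 2.
    have : expR (- (h / 2)) >= 1 / 2 by apply: le_trans (expR_ge1Dx _); lra.
    rewrite expRN => i; rewrite -[leLHS]invrK -[leRHS]invrK lef_pV2 ?posrE ?invr_gt0 ?expR_gt0//; lra.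
  apply: (@le_trans _ _ ((h / 2) ^+ 2 * 2)); first by rewrite ler_wpM2l// sqr_ge0.
  have : h * h <= h * q by rewrite ler_wpM2l ?(ltW h0)// -[leLHS]qq expr2 ler_piMr// ltW.
  have := mulr_gt0 h0 h0; rewrite expr2; nra.
have fexp : `|2 * f2 * (expR (h / 2) - 1 - h / 2)| <= 2 * `|f2| * (h * q).
  by rewrite !normrM (ger0_norm (_ : 0 <= 2))// ler_wpM2l// mulr_ge0.
move: fexp; rewrite ler_norml => /andP[a1 a2] b1 b2.
have -> : (12 * expR 2 * K + 2 * `|f2|) * (h * q) = 2 * e * expR 2 + 2 * `|f2| * (h * q).
  by rewrite /e; ring.
rewrite ler_norml; apply/andP; split; lra.
Qed.

End gauss_exp.

(** * Spline smoothing of the absolute value and its potential *)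

Section smooth_kernel.
Context {R : realType} (theta a b : R).
Hypothesis theta0 : 0 < theta.
Hypothesis a0 : 0 < a.
Hypothesis ab : a < b.

Let pp (x : R) := Num.max x 0.

Let ppP x : (pp x = x /\ 0 <= x) \/ (pp x = 0 /\ x <= 0).
Proof. by rewrite /pp; case: (lerP 0 x) => h; [left|right; rewrite ltW]. Qed.

Let pp_le0 x : x <= 0 -> pp x = 0. Proof. by rewrite /pp; case: (ltrgtP x 0) => // ->. Qed.
Let pp_ge0 x : 0 <= x -> pp x = x. Proof. by rewrite /pp; case: (ltrgtP x 0) => // ->. Qed.
Let pp_opp x : pp x = x + pp (- x).
Proof. by case: (ppP x) => -[-> h]; case: (ppP (- x)) => -[-> h']; lra. Qed.
Let pp_mul x : pp x * pp (- x) = 0.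
Proof.
case: (lerP 0 x) => h; first by rewrite [pp (- x)]pp_le0 ?mulr0; lra.
by rewrite pp_le0 ?mul0r; lra.
Qed.

(** The cube of the positive part is twice continuously differentiable; the remainder is checked on
    the four sign patterns of [x] and [x + y]. *)
Let taylor_pp x y : `|pp (x + y) ^+ 3 - pp x ^+ 3 - 3 * pp x ^+ 2 * y - 3 * pp x * y ^+ 2| <= `|y| ^+ 3.
Proof.
rewrite -normrX; case: (ppP x) => -[-> h]; case: (ppP (x + y)) => -[-> h'].
- by rewrite (_ : _ - _ = y ^+ 3) //; ring.
- rewrite (_ : _ - _ = y ^+ 3 - (x + y) ^+ 3); last by ring.
  have u0 : (x + y) ^+ 3 <= 0 by rewrite exprSr expr2 mulr_ge0_le0// -expr2 sqr_ge0.
  have u1 : y ^+ 3 <= (x + y) ^+ 3.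
    rewrite -subr_ge0 (_ : _ - _ = x * ((x / 2 + y) ^+ 2 * 3 + (x / 2) ^+ 2)); last by field.
    apply: mulr_ge0 => //; apply: addr_ge0; last exact: sqr_ge0.
    by apply: mulr_ge0 => //; exact: sqr_ge0.
  by rewrite !ler0_norm; lra.
- rewrite !(expr0n, mul0r, mulr0, subr0)/=.
  have y0 : 0 <= y by lra.
  rewrite !ger0_norm ?exprn_ge0// lerXn2r ?nnegrE//; lra.
- by rewrite !(expr0n, mul0r, mulr0, subr0)/= normr0.
Qed.

(** A combination of truncated powers: a trapezoid for [k = 1], its successive primitives up to
    constant factors for [k = 2] and [k = 3]. *)
Let comb (k : nat) (x : R) := pp (x + b) ^+ k - pp (x + a) ^+ k - pp (x - a) ^+ k + pp (x - b) ^+ k.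
Let kap := (a + b)^-1.
Let del := b - a.
(** Trapezoid of integral 1, equal to [kap] on [[- a, a]] and to 0 outside [[- b, b]]. Up to
    additive constants [slope] is the primitive of [2 ker], chosen odd, and [phi] the primitive of
    [slope], a smooth substitute for the absolute value. *)
Let ker x := kap / del * comb 1 x.
Let slope x := kap / del * comb 2 x - 1.
Let phi x := kap / (3 * del) * comb 3 x - x.

Let b0 : 0 < b. Proof. exact: lt_trans ab. Qed.
Let kap0 : 0 < kap. Proof. by rewrite invr_gt0 addr_gt0. Qed.
Let del0 : 0 < del. Proof. by rewrite subr_gt0. Qed.
Let kapE : kap * (a + b) = 1. Proof. by rewrite mulVf// gt_eqF// addr_gt0. Qed.

(** From [pp x = x + pp (- x)]. By parity all bounds reduce to [x <= 0], where the truncated powers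
    at [a] and [b] vanish. *)
Let comb_opp x : [/\ comb 1 (- x) = comb 1 x, comb 2 (- x) = 2 * (a + b) * del - comb 2 x &
  comb 3 (- x) = comb 3 x - 6 * (a + b) * del * x].
Proof.
rewrite /comb (_ : - x + b = - (x - b)); last by ring.
rewrite (_ : - x + a = - (x - a)); last by ring.
rewrite (_ : - x - a = - (x + a)); last by ring.
rewrite (_ : - x - b = - (x + b)); last by ring.
have := pp_mul (x + b); have := pp_mul (x + a); have := pp_mul (x - a); have := pp_mul (x - b).
rewrite (pp_opp (x + b)) (pp_opp (x + a)) (pp_opp (x - a)) (pp_opp (x - b)).
set u1 := pp _; set u2 := pp _; set u3 := pp _; set u4 := pp _ => e1 e2 e3 e4.
rewrite /del; split; first by ring.
- have E (z u : R) : (z + u) * u = 0 -> (z + u) ^+ 2 = z ^+ 2 - u ^+ 2 by move=> e; rewrite (_ : z ^+ 2 - u ^+ 2 = (z + u) ^+ 2 - 2 * ((z + u) * u)); [rewrite e; ring|ring].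
  by rewrite (E _ _ e1) (E _ _ e2) (E _ _ e3) (E _ _ e4); ring.
- have E (z u : R) : (z + u) * u = 0 -> (z + u) ^+ 3 = z ^+ 3 + u ^+ 3 by move=> e; rewrite (_ : (z + u) ^+ 3 = z ^+ 3 + u ^+ 3 + 3 * z * ((z + u) * u)); [rewrite e; ring|ring].
  by rewrite (E _ _ e1) (E _ _ e2) (E _ _ e3) (E _ _ e4); ring.
Qed.

Let ker_opp x : ker (- x) = ker x. Proof. by rewrite /ker; have [-> _ _] := comb_opp x. Qed.
Let kd : kap / del * ((a + b) * del) = 1.
Proof. by rewrite -[RHS]kapE; field; rewrite gt_eqF. Qed.
Let slope_opp x : slope (- x) = - slope x.
Proof.
rewrite /slope; have [_ -> _] := comb_opp x; rewrite mulrBr.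
by rewrite (_ : kap / del * (2 * (a + b) * del) = 2 * (kap / del * ((a + b) * del))); [rewrite kd; ring|ring].
Qed.
Let phi_opp x : phi (- x) = phi x.
Proof.
rewrite /phi; have [_ _ ->] := comb_opp x; rewrite mulrBr.
rewrite (_ : kap / (3 * del) * (6 * (a + b) * del * x) = 2 * x * (kap / del * ((a + b) * del))); last by field; rewrite gt_eqF.
by rewrite kd; ring.
Qed.

Let neg_case x : x <= 0 -> [/\ 0 <= ker x <= kap, -1 <= slope x <= 0, 0 <= phi x,
  - b <= x -> phi x <= 3 * b &
  (x <= - b -> ker x = 0 /\ slope x = -1) /\ (- a <= x -> ker x = kap)].
Proof.
move=> x0; rewrite /ker /slope /phi /comb [pp (x - a)]pp_le0; last by have := a0; lra.
rewrite [pp (x - b)]pp_le0; last by have := b0; lra.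
rewrite !expr0n/= !expr1 !subr0 !addr0.
set P := pp (x + b); set Q := pp (x + a).
have Q0 : 0 <= Q by rewrite /Q; case: (ppP (x + a)) => -[-> ?].
have QP : Q <= P by rewrite /P /Q; case: (ppP (x + a)) => -[-> ?]; case: (ppP (x + b)) => -[-> ?]; have := ab; lra.
have PQd : P - Q <= del by rewrite /P /Q /del; case: (ppP (x + a)) => -[-> ?]; case: (ppP (x + b)) => -[-> ?]; have := ab; lra.
have Qa : Q <= a by rewrite /Q; case: (ppP (x + a)) => -[-> ?]; have := a0; lra.
have Pb : P <= b by rewrite /P; case: (ppP (x + b)) => -[-> ?]; have := b0; lra.
have kd0 : 0 < kap / del by rewrite divr_gt0.
split.
- rewrite mulr_ge0 ?subr_ge0 ?(ltW kd0)//= mulrAC ler_pdivrMr// ler_wpM2l// ltW//.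
- have h : 0 <= P ^+ 2 - Q ^+ 2 <= (a + b) * del.
    rewrite subr_sqr mulr_ge0 ?subr_ge0 ?addr_ge0 ?(le_trans Q0)//= mulrC.
    by apply: ler_pM; rewrite ?subr_ge0 ?addr_ge0 ?(le_trans Q0)//; lra.
  have /andP[h0 h1] := h; have := ler_wpM2l (ltW kd0) h1; rewrite kd => h2.
  have := mulr_ge0 (ltW kd0) h0 => h3; apply/andP; split; lra.
- have : 0 <= kap / (3 * del) * (P ^+ 3 - Q ^+ 3).
    by rewrite mulr_ge0 ?divr_ge0 ?mulr_ge0 ?(ltW kap0) ?(ltW del0)// subr_ge0 lerXn2r// nnegrE (le_trans Q0).
  by lra.
- move=> xb; have : kap / (3 * del) * (P ^+ 3 - Q ^+ 3) <= b; last by lra.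
  rewrite (_ : P ^+ 3 - Q ^+ 3 = (P - Q) * (P ^+ 2 + P * Q + Q ^+ 2)); last by ring.
  apply: (@le_trans _ _ (kap / (3 * del) * (del * (a + b) ^+ 2))).
    rewrite ler_wpM2l ?divr_ge0 ?mulr_ge0 ?(ltW kap0) ?(ltW del0)//.
    apply: ler_pM; rewrite ?subr_ge0//.
      by rewrite !addr_ge0 ?mulr_ge0 ?sqr_ge0// (le_trans Q0).
    by have := a0; have := b0; nra.
  rewrite (_ : kap / (3 * del) * (del * (a + b) ^+ 2) = (a + b) / 3 * (kap * (a + b))); last by field; rewrite gt_eqF.
  by rewrite kapE; have := ab; have := a0; lra.
split.
- by move=> xb; rewrite /P /Q !pp_le0; [rewrite !expr0n/= !subr0 !mulr0 sub0r|have := ab; lra|lra].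
- move=> xa; rewrite /P /Q !pp_ge0; [|lra|have := ab; lra].
  by rewrite /del; field; rewrite subr_eq0 gt_eqF.
Qed.

Let ker01 x : 0 <= ker x <= kap.
Proof. by case: (lerP x 0) => h; [have [] := neg_case h|rewrite -ker_opp; have [] := @neg_case (- x); lra]. Qed.
Let slope1 x : -1 <= slope x <= 1.
Proof.
case: (lerP x 0) => h; first by have [_ /andP[? ?]] := neg_case h; lra.
by have [|_] := @neg_case (- x); [lra|rewrite slope_opp => /andP[? ?]; lra].
Qed.
Let phi0 x : 0 <= phi x.
Proof. by case: (lerP x 0) => h; [have [] := neg_case h|rewrite -phi_opp; have [] := @neg_case (- x); lra]. Qed.
Let phi3b x : `|x| <= b -> phi x <= 3 * b.
Proof.
rewrite ler_norml => /andP[h1 h2].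
case: (lerP x 0) => h; first by have [_ _ _ p _] := neg_case h; apply: p.
by rewrite -phi_opp; have [|_ _ _ p _] := @neg_case (- x); [lra|apply: p; lra].
Qed.
Let outside x : b <= `|x| -> ker x = 0 /\ slope x ^+ 2 = 1.
Proof.
case: (lerP x 0) => h.
  rewrite ler0_norm// => hb; have [_ _ _ _ [+ _]] := neg_case h.
  by move=> [|-> ->]; [lra|rewrite sqrrN expr1n].
rewrite gtr0_norm// => hb; have [|_ _ _ _ [+ _]] := @neg_case (- x); first lra.
rewrite ker_opp slope_opp => -[|-> e]; first lra.
by rewrite -sqrrN e sqrrN expr1n.
Qed.
Let inside x : `|x| <= a -> ker x = kap.
Proof.
rewrite ler_norml => /andP[h1 h2].
case: (lerP x 0) => h; first by have [_ _ _ _ [_]] := neg_case h; apply.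
by rewrite -ker_opp; have [|_ _ _ _ [_]] := @neg_case (- x); [lra|apply; lra].
Qed.

Let k30 : 0 <= kap / (3 * del).
Proof. by apply: divr_ge0; [exact: ltW|apply: mulr_ge0 => //; exact: ltW]. Qed.
Let C1 := 4 * (kap / (3 * del)).
Let C10 : 0 <= C1. Proof. exact: mulr_ge0. Qed.

Let phi_taylor x y : `|phi (x + y) - phi x - (slope x * y + ker x * y ^+ 2)| <= C1 * `|y| ^+ 3.
Proof.
have t c := taylor_pp (x + c) y.
rewrite (_ : _ - _ = kap / (3 * del) *
  ((pp (x + b + y) ^+ 3 - pp (x + b) ^+ 3 - 3 * pp (x + b) ^+ 2 * y - 3 * pp (x + b) * y ^+ 2) -
   (pp (x + a + y) ^+ 3 - pp (x + a) ^+ 3 - 3 * pp (x + a) ^+ 2 * y - 3 * pp (x + a) * y ^+ 2) -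
   (pp (x + (- a) + y) ^+ 3 - pp (x + (- a)) ^+ 3 - 3 * pp (x + (- a)) ^+ 2 * y - 3 * pp (x + (- a)) * y ^+ 2) +
   (pp (x + (- b) + y) ^+ 3 - pp (x + (- b)) ^+ 3 - 3 * pp (x + (- b)) ^+ 2 * y - 3 * pp (x + (- b)) * y ^+ 2))); last first.
  rewrite /phi /slope /ker /comb !(addrAC x y) !expr1; field; rewrite gt_eqF//=.
rewrite normrM (ger0_norm k30) (_ : C1 * _ = kap / (3 * del) * (4 * `|y| ^+ 3)); last by rewrite /C1; ring.
apply: ler_wpM2l => //.
have := t b; have := t a; have := t (- a); have := t (- b).
set u1 := pp (x + - b + y) ^+ 3 - _ - _ - _; set u2 := pp (x + - a + y) ^+ 3 - _ - _ - _.
set u3 := pp (x + a + y) ^+ 3 - _ - _ - _; set u4 := pp (x + b + y) ^+ 3 - _ - _ - _.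
rewrite !ler_norml => /andP[? ?] /andP[? ?] /andP[? ?] /andP[? ?]; apply/andP; split; lra.
Qed.

Let f x := expR (- (theta * phi x)).
Let f0 x : 0 < f x. Proof. exact: expR_gt0. Qed.
Let f1 x : f x <= 1. Proof. by rewrite expR_le1 oppr_le0 mulr_ge0// ltW. Qed.

Let Z := theta * (1 + kap + C1).
Let Z0 : 0 <= Z. Proof. by rewrite mulr_ge0 ?(ltW theta0)// !addr_ge0// ltW. Qed.
Let C2 := Z ^+ 3 * expR Z + Z + Z ^+ 2 + (2 + theta + theta ^+ 2 + theta * kap).
Let C20 : 0 <= C2.
Proof.
have := ltW theta0; have := ltW kap0 => k0 t0.
rewrite /C2; have z3 := mulr_ge0 (exprn_ge0 3 Z0) (expR_ge0 Z); have z2 := sqr_ge0 Z.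
by have := sqr_ge0 theta; have := mulr_ge0 t0 k0; have := Z0; lra.
Qed.

(** The coefficients come from [phi' = slope] and [phi'' = 2 ker]. For [|y| <= 1] the exponential is
    expanded to third order; for [|y| > 1] each term is at most a multiple of [|y| ^ 3]. *)
Let f_taylor x y : `|f (x + y) - (f x + - (theta * slope x * f x) * y +
  f x * ((theta * slope x) ^+ 2 / 2 - theta * ker x) * y ^+ 2)| <= C2 * `|y| ^+ 3.
Proof.
have /andP[k0 k1] := ker01 x.
have sl : `|slope x| <= 1 by rewrite ler_norml slope1.
have Y0 := normr_ge0 y; have t0 := ltW theta0; have kp := ltW kap0.
set Y := `|y| in Y0 *.
have yY : y ^+ 2 = Y ^+ 2 by rewrite /Y real_normK ?num_real.
have fx0 := f0 x; have fx1 := f1 x.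
have sy : `|slope x * y| <= Y by rewrite normrM ler_piMl.
have ky : `|ker x * y ^+ 2| <= kap * Y ^+ 2.
  rewrite ger0_norm; last by apply: mulr_ge0; [exact: k0|exact: sqr_ge0].
  by rewrite yY ler_wpM2r// sqr_ge0.
case: (lerP Y 1) => Y1.
  pose r := phi (x + y) - phi x - (slope x * y + ker x * y ^+ 2).
  have hr : `|r| <= C1 * Y ^+ 3 := phi_taylor x y.
  pose z := - (theta * (slope x * y + ker x * y ^+ 2 + r)).
  have fz : f (x + y) = f x * expR z.
    rewrite /f -expRD; congr expR; rewrite /z /r; ring.
  have Y21 : Y ^+ 2 <= Y by rewrite expr2 ler_piMl.
  have Y32 : Y ^+ 3 <= Y ^+ 2 by rewrite exprS ler_piMl// sqr_ge0.
  have hkr : `|ker x * y ^+ 2 + r| <= (kap + C1) * Y ^+ 2.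
    apply: le_trans (ler_normD _ _) _; rewrite mulrDl; apply: lerD => //.
    by apply: le_trans hr _; rewrite ler_wpM2l.
  have hz : `|z| <= Z * Y.
    rewrite /z normrN normrM (ger0_norm t0) /Z -mulrA ler_wpM2l// -addrA.
    apply: le_trans (ler_normD _ _) _; rewrite -[1 + kap + C1]addrA [leRHS]mulrDl mul1r; apply: lerD => //.
    by apply: le_trans hkr _; rewrite ler_wpM2l// addr_ge0.
  have zZ : `|z| <= Z by apply: le_trans hz _; rewrite ler_piMr.
  have e1 : `|expR z - 1 - z - z ^+ 2 / 2| <= Z ^+ 3 * expR Z * Y ^+ 3.
    apply: le_trans (expR_taylor3 z) _; rewrite [leRHS]mulrAC -exprMn.
    by apply: ler_pM; rewrite ?exprn_ge0 ?expR_ge0 ?ler_expR// lerXn2r ?nnegrE// mulr_ge0.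
  have e2 : `|z + theta * slope x * y + theta * ker x * y ^+ 2| <= Z * Y ^+ 3.
    rewrite (_ : _ + _ = - (theta * r)); last by rewrite /z; ring.
    rewrite normrN normrM (ger0_norm t0) /Z -mulrA ler_wpM2l//.
    by apply: le_trans hr _; rewrite ler_wpM2r ?exprn_ge0// lerDr addr_ge0.
  have e3 : `|z ^+ 2 / 2 - (theta * slope x) ^+ 2 / 2 * y ^+ 2| <= Z ^+ 2 * Y ^+ 3.
    rewrite (_ : _ - _ = - (theta * (ker x * y ^+ 2 + r)) * ((z - theta * (slope x * y)) / 2)); last first.
      by rewrite /z; field.
    rewrite normrM normrN (_ : Z ^+ 2 * Y ^+ 3 = (Z * Y ^+ 2) * (Z * Y)); last by ring.
    apply: ler_pM => //.
      rewrite normrM (ger0_norm t0) /Z -mulrA ler_wpM2l//; apply: le_trans hkr _.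
      by rewrite ler_wpM2r ?sqr_ge0// -addrA lerDr.
    rewrite normrM (ger0_norm (_ : 0 <= 2^-1))// ler_pdivrMr//.
    apply: le_trans (ler_normB _ _) _; rewrite mulr_natr mulr2n; apply: lerD => //.
    rewrite normrM (ger0_norm t0) /Z -mulrA ler_wpM2l//.
    by apply: le_trans sy _; rewrite ler_peMl// -addrA lerDl addr_ge0.
  rewrite fz (_ : _ - _ = f x * ((expR z - 1 - z - z ^+ 2 / 2) + (z + theta * slope x * y + theta * ker x * y ^+ 2)
    + (z ^+ 2 / 2 - (theta * slope x) ^+ 2 / 2 * y ^+ 2))); last by field.
  rewrite normrM (ger0_norm (ltW fx0)); apply: le_trans (ler_piMl (normr_ge0 _) fx1) _.
  rewrite /C2; apply: (@le_trans _ _ ((Z ^+ 3 * expR Z + Z + Z ^+ 2) * Y ^+ 3)); last first.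
    by rewrite ler_wpM2r ?exprn_ge0// lerDl !addr_ge0 ?mulr_ge0 ?sqr_ge0.
  rewrite !mulrDl; apply: le_trans (ler_normD _ _) _; apply: lerD => //.
  by apply: le_trans (ler_normD _ _) _; apply: lerD.
have Y1' := ltW Y1.
have Y13 : 1 <= Y ^+ 3 by rewrite exprn_ege1.
have YY3 : Y <= Y ^+ 3 by rewrite exprS ler_peMr// exprn_ege1.
have Y23 : Y ^+ 2 <= Y ^+ 3 by rewrite [leRHS]exprS ler_peMl// sqr_ge0.
apply: (@le_trans _ _ (1 + (1 + theta * Y + (theta ^+ 2 + theta * kap) * Y ^+ 2))).
  apply: le_trans (ler_normB _ _) _; apply: lerD; first by rewrite ger0_norm ?f1// ltW.
  apply: le_trans (ler_normD _ _) _; apply: lerD.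
    apply: le_trans (ler_normD _ _) _; apply: lerD; first by rewrite ger0_norm// ltW.
    rewrite mulNr normrN (_ : theta * slope x * f x * y = f x * (theta * (slope x * y))); last by ring.
    rewrite normrM (ger0_norm (ltW fx0)) -[leRHS]mul1r; apply: ler_pM => //; first exact: ltW.
    by rewrite normrM (ger0_norm t0) ler_wpM2l.
  rewrite -mulrA normrM (ger0_norm (ltW fx0)) -[leRHS]mul1r; apply: ler_pM => //; first exact: ltW.
  rewrite normrM (ger0_norm (sqr_ge0 y)) yY ler_wpM2r ?sqr_ge0//.
  apply: le_trans (ler_normB _ _) _; apply: lerD.
    rewrite ger0_norm ?divr_ge0 ?sqr_ge0// exprMn.
    have : slope x ^+ 2 <= 1 by rewrite -[slope x ^+ 2]ger0_norm ?sqr_ge0// normrX exprn_ile1.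
    by have := sqr_ge0 theta; have := sqr_ge0 (slope x); nra.
  by rewrite ger0_norm; [rewrite ler_wpM2l|exact: mulr_ge0].
rewrite /C2 (_ : 1 + _ = 2 + theta * Y + (theta ^+ 2 + theta * kap) * Y ^+ 2); last by ring.
apply: (@le_trans _ _ ((2 + theta + theta ^+ 2 + theta * kap) * Y ^+ 3)); last first.
  rewrite ler_wpM2r ?exprn_ge0// lerDr.
  by have := mulr_ge0 (exprn_ge0 3 Z0) (expR_ge0 Z); have := sqr_ge0 Z; have := Z0; lra.
rewrite -[2 + theta + _ + _]addrA [leRHS]mulrDl; apply: lerD.
  by rewrite mulrDl; apply: lerD; [rewrite ler_peMr|rewrite ler_wpM2l].
by rewrite ler_wpM2l// addr_ge0 ?sqr_ge0 ?mulr_ge0.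
Qed.

Let lam := theta ^+ 2 / 2.
(** Dictated by the differential equation for [f]: the second term compensates for [slope ^ 2]
    falling below 1 near 0, and vanishes outside [[- b, b]]. *)
Let psi x := theta * ker x + lam * (1 - slope x ^+ 2).
Let slope2 x : slope x ^+ 2 <= 1.
Proof. by rewrite -[slope x ^+ 2]ger0_norm ?sqr_ge0// normrX exprn_ile1// ler_norml slope1. Qed.
Let lam0 : 0 <= lam. Proof. by rewrite divr_ge0// sqr_ge0. Qed.
Let M := theta * kap + lam.
Let psi0M x : 0 <= psi x <= M.
Proof.
have /andP[k0 k1] := ker01 x; have s1 := slope2 x; have s0 := sqr_ge0 (slope x).
have s2 : 0 <= 1 - slope x ^+ 2 by rewrite subr_ge0.
apply/andP; split; first by apply: addr_ge0; apply: mulr_ge0 => //; exact: ltW.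
by apply: lerD; [rewrite ler_wpM2l// ltW|rewrite ler_piMr// lerBlDr lerDl].
Qed.

Let measurable_pp c : measurable_fun [set: R] (fun x => pp (x + c)).
Proof.
apply: measurable_funTS; apply: measurable_maxr; last exact: measurable_cst.
exact: measurable_funD.
Qed.
Let measurable_comb k : measurable_fun [set: R] (comb k).
Proof.
have m c := measurable_funX k (measurable_pp c).
exact: (measurable_funD (measurable_funB (measurable_funB (m b) (m a)) (m (- a))) (m (- b))).
Qed.
Let measurable_f : measurable_fun [set: R] f.
Proof.
apply: measurableT_comp => //; apply: measurableT_comp => //; apply: measurable_funM => //.
by apply: measurable_funB => //; apply: measurable_funM => //; exact: measurable_comb.
Qed.
Let measurable_psi : measurable_fun [set: R] psi.
Proof.
have mc k : measurable_fun [set: R] (fun x => kap / del * comb k x).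
  by apply: measurable_funM => //; exact: measurable_comb.
apply: measurable_funD; first by apply: measurable_funM => //; exact: mc.
apply: measurable_funM => //; apply: measurable_funB => //.
by apply: measurable_funX; apply: measurable_funB => //; exact: mc.
Qed.

Let step x (h : R) : 0 < h -> h <= 1 ->
  `|expR ((psi x - lam) * h) * \int[normal_prob 0 (Num.sqrt h)]_y f (x + y) - f x| <=
  ((M + lam) ^+ 2 * (1 + expR (M + lam) * (1 + (M + lam))) + expR (M + lam) *
    (12 * expR 2 * (C2 + theta + 2 * (theta ^+ 2 + theta * kap)) + 2 * (theta ^+ 2 + theta * kap))) * (h * Num.sqrt h).
Proof.
move=> h0 h1.
have t0 := ltW theta0; have kp := ltW kap0; have hh := ltW h0.
have /andP[k0 k1] := ker01 x; have s1 := slope2 x; have s0 := sqr_ge0 (slope x).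
have /andP[p0 pM] := psi0M x.
have fx0 := f0 x; have fx1 := f1 x.
set q := Num.sqrt h; have q0 : 0 < q by rewrite sqrtr_gt0.
have q1 : q <= 1 by rewrite -[leRHS]sqrtr1 ler_sqrt.
have hhq : h * h <= h * q.
  by rewrite ler_wpM2l// -[leLHS]sqr_sqrtr// expr2 ler_piMr// ltW.
have f01 y : 0 <= f y <= 1 by rewrite ltW//= f1.
have := normal_second_order h0 h1 measurable_f f01 C20 (f_taylor x).
set I := \int[_]_y _; set c1 := - (theta * slope x * f x); set c2 := f x * (_ - _); rewrite -/q => hI.
pose v := psi x - lam; pose w := v * h.
(* The Gaussian average is [f x (1 - w)] to first order, and [exp w (1 - w) = 1 + O(w ^ 2)] removes
   the drift. *)
have hc2 : f x + c2 * h = f x * (1 - w) by rewrite /c2 /w /v /psi /lam; field.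
have c1b : `|c1| <= theta.
  rewrite /c1 normrN -mulrA normrM (ger0_norm t0) ler_piMr// normrM (ger0_norm (ltW fx0)).
  by rewrite mulr_ile1// ?(ltW fx0)// ler_norml slope1.
have c2b : `|c2| <= theta ^+ 2 + theta * kap.
  rewrite /c2 normrM (ger0_norm (ltW fx0)) -[leRHS]mul1r; apply: ler_pM => //; first exact: ltW.
  apply: le_trans (ler_normB _ _) _; apply: lerD.
    rewrite ger0_norm ?divr_ge0 ?sqr_ge0// exprMn.
    by have := sqr_ge0 theta; nra.
  by rewrite ger0_norm; [rewrite ler_wpM2l|exact: mulr_ge0].
set K0 := 12 * expR 2 * (C2 + theta + 2 * (theta ^+ 2 + theta * kap)) + 2 * (theta ^+ 2 + theta * kap).
have hI' : `|I - f x * (1 - w)| <= K0 * (h * q).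
  rewrite -hc2; apply: le_trans hI _; rewrite ler_wpM2r ?mulr_ge0 ?(ltW q0)// /K0.
  apply: lerD; last by rewrite ler_wpM2l.
  rewrite ler_wpM2l ?mulr_ge0 ?expR_ge0//; apply: lerD; last by rewrite ler_wpM2l.
  by rewrite lerD2l.
set V := M + lam.
have V0 : 0 <= V by rewrite addr_ge0// (le_trans p0).
have l0 := lam0; have vV : `|v| <= V by rewrite /v /V ler_norml; apply/andP; split; lra.
have wV : `|w| <= V * h by rewrite normrM (ger0_norm hh) ler_wpM2r.
have wV1 : `|w| <= V by apply: le_trans wV _; rewrite ler_piMr.
have ew : expR w <= expR V by rewrite ler_expR (le_trans (ler_norm _)).
have w2 : w ^+ 2 <= V ^+ 2 * (h * q).
  apply: (@le_trans _ _ ((V * h) ^+ 2)).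
    by rewrite -[w ^+ 2]real_normK ?num_real// lerXn2r ?nnegrE// mulr_ge0.
  by rewrite exprMn ler_wpM2l ?sqr_ge0// expr2.
have e1 : `|expR w * (1 - w) - 1| <= V ^+ 2 * (1 + expR V * (1 + V)) * (h * q).
  rewrite (_ : _ - _ = (expR w - 1 - w) * (1 - w) - w ^+ 2); last by ring.
  apply: le_trans (ler_normB _ _) _; rewrite (ger0_norm (sqr_ge0 w)).
  rewrite (_ : V ^+ 2 * _ * _ = V ^+ 2 * (h * q) * expR V * (1 + V) + V ^+ 2 * (h * q)); last by ring.
  apply: lerD => //; rewrite normrM; apply: ler_pM => //.
    apply: le_trans (expR_taylor2 _) _; apply: ler_pM => //; rewrite ?sqr_ge0 ?expR_ge0//.
    by rewrite ler_expR.
  by apply: le_trans (ler_normB _ _) _; rewrite normr1 lerD2l.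
rewrite -/v -/w (_ : _ - _ = f x * (expR w * (1 - w) - 1) + expR w * (I - f x * (1 - w))); last by ring.
apply: le_trans (ler_normD _ _) _; rewrite [leRHS]mulrDl; apply: lerD.
  rewrite normrM (ger0_norm (ltW fx0)); apply: le_trans e1.
  by rewrite ler_piMl.
rewrite normrM (ger0_norm (expR_ge0 _)) -mulrA.
by apply: ler_pM => //; exact: expR_ge0.
Qed.

Lemma smooth_kernel : exists (f psi : R -> R) (C : R),
  [/\ measurable_fun [set: R] f, measurable_fun [set: R] psi,
      forall x, 0 < f x <= 1, forall x, `|x| <= b -> expR (- (3 * theta * b)) <= f x &
  [/\ forall x, 0 <= psi x <= theta / (a + b) + theta ^+ 2 / 2,
      forall x, `|x| <= a -> theta / (a + b) <= psi x,
      forall x, b <= `|x| -> psi x = 0 &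
      forall x h, 0 < h -> h <= 1 ->
        `|expR ((psi x - theta ^+ 2 / 2) * h) * \int[normal_prob 0 (Num.sqrt h)]_y f (x + y) - f x|
        <= C * (h * Num.sqrt h)]].
Proof.
exists f, psi; eexists; split.
- exact: measurable_f.
- exact: measurable_psi.
- by move=> x; rewrite f0 f1.
- move=> x xb; rewrite ler_expR lerN2 -mulrA mulrCA ler_wpM2l ?(ltW theta0)//; exact: phi3b.
split.
- exact: psi0M.
- move=> x xa; rewrite /psi inside// lerDl mulr_ge0// subr_ge0; exact: slope2.
- by move=> x xb; rewrite /psi; have [-> ->] := outside xb; rewrite mulr0 subrr mulr0 addr0.
- by move=> x h h0 h1; exact: step.
Qed.

End smooth_kernel.

(** * The skeleton of Brownian motion *)

Section independence.
Context d (T : measurableType d) (R : realType) (P : probability T R).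
Context (T1 : pointedType) (G : set (set T1)).
Context d2 (T2 : measurableType d2).
Variables (X : {mfun T >-> g_sigma_algebraType G}) (Y : {mfun T >-> T2}).
Hypothesis GI : setI_closed G.
Hypothesis GT : G setT.
Hypothesis GP : forall D B, G D -> measurable B ->
  P (X @^-1` D `&` Y @^-1` B) = (P (X @^-1` D) * P (Y @^-1` B))%E.

Let mX D : measurable (D : set (g_sigma_algebraType G)) -> measurable (X @^-1` D).
Proof. by move=> mD; rewrite -[_ @^-1` _]setTI; exact: measurable_funP. Qed.
Let mY B : measurable B -> measurable (Y @^-1` B).
Proof. by move=> mB; rewrite -[_ @^-1` _]setTI; exact: measurable_funP. Qed.

(** Both sides are finite measures in [D] that agree on the pi-system [G]: the law of [X] on the
    event [Y^-1 B], and the law of [X] scaled by the probability of that event. *)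
Let rectangle (D : set (g_sigma_algebraType G)) B : measurable D -> measurable B ->
  P (X @^-1` D `&` Y @^-1` B) = (P (X @^-1` D) * P (Y @^-1` B))%E.
Proof.
move=> mD mB.
have c0 : 0 <= fine (P (Y @^-1` B)) by rewrite fine_ge0.
pose c := NngNum c0.
have PB : P (Y @^-1` B) = c%:num%:E by rewrite fineK// fin_num_measure//; exact: mY.
pose m2 := mscale c (distribution P X).
have mXf : measurable_fun [set: T] X by exact: measurable_funP.
pose m1' : {measure set (g_sigma_algebraType G) -> \bar R} :=
  measure_function_pushforward__canonical__measure_function_Measure (mrestr P (mY mB)) mXf.
pose m2' : {measure set (g_sigma_algebraType G) -> \bar R} := m2.
suff : m1' D = m2' D by rewrite /m1' /m2' /m2 /= /pushforward /mrestr /mscale /= PB muleC.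
have eG A : G A -> m1' A = m2' A.
  by move=> GA; rewrite /= /pushforward /mrestr /mscale/= GP// PB muleC.
have fG (k : nat) : (m1' setT < +oo)%E.
  by apply: le_lt_trans (ltry 1); apply: probability_le1; apply: measurableI; [exact: mX|exact: mY].
have cG : \bigcup_(k : nat) [set: g_sigma_algebraType G] = setT by rewrite bigcup_const.
have := @measure_unique _ R (g_sigma_algebraType G) G (fun=> setT) erefl GI (fun=> GT) cG m1' m2'.
by move/(_ eG fG D mD).
Qed.

Lemma integral_independent (F : g_sigma_algebraType G * T2 -> \bar R) :
  measurable_fun [set: g_sigma_algebraType G * T2] F -> (forall z, 0 <= F z)%E ->
  (\int[P]_w F (X w, Y w) = \int[P]_w \int[distribution P Y]_y F (X w, y))%E.
Proof.
move=> mF F0.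
have mZ : measurable_fun [set: T] (fun w => (X w, Y w)).
  by apply: measurable_fun_pair; exact: measurable_funP.
have prod S : measurable S -> (distribution P X \x distribution P Y)%E S = pushforward P (fun w => (X w, Y w)) S.
  apply: (product_measure_unique (m' := pushforward P (fun w => (X w, Y w)) )) => A B mA mB.
  exact: rectangle.
transitivity (\int[pushforward P (fun w => (X w, Y w))]_z F z)%E.
  by rewrite ge0_integral_pushforward.
transitivity (\int[(distribution P X \x distribution P Y)%E]_z F z)%E.
  by apply/esym/eq_measure_integral => A mA _; exact: prod.
rewrite fubini_tonelli1// ge0_integral_distribution//.
- exact: measurable_fun_fubini_tonelli_F.
- by move=> x; exact: integral_ge0.
Qed.

End independence.

Section laplace_exp.
Context {R : realType}.

(** At [+oo] the default value 0 of [fine] is the one wanted, the exponential of [- oo]. *)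
Definition laplace_exp (lam : R) (y : \bar R) : R :=
  fine (er_map (fun r => expR (- (lam * r))) y).

End laplace_exp.

Section increments.
Context d (T : measurableType d) (R : realType) (P : probability T R) (xi : nat -> T -> measurableTypeR R).
Hypothesis mxi : forall i, measurable_fun [set: T] (xi i).
Hypothesis ind : forall n A, (forall i, measurable (A i)) ->
  P [set w | forall i, (i < n)%N -> A i (xi i w)] = (\prod_(i < n) P [set w | A i (xi i w)])%E.

(** The product events on which independence is assumed; they form a pi-system generating the
    history of the first [k] increments. *)
Definition past (k : nat) : set (set T) :=
  [set D | exists2 A : nat -> set (measurableTypeR R), (forall i, measurable (A i)) &
    D = [set w | forall i, (i < k)%N -> A i (xi i w)]].

Lemma past_setI k : setI_closed (past k).
Proof.
move=> _ _ [A mA ->] [B mB ->]; exists (fun i => A i `&` B i).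
  by move=> i; exact: measurableI.
apply/seteqP; split => w /=.
  by move=> [h1 h2] i ik; split; [exact: h1|exact: h2].
by move=> h; split=> i ik; have [] := h i ik.
Qed.

Lemma past_setT k : past k setT.
Proof. by exists (fun=> setT) => //; apply/seteqP; split. Qed.

Lemma past_measurable k (D : set T) : (<<s past k>>) D -> measurable D.
Proof.
apply: smallest_sub; first exact: sigma_algebra_measurable.
move=> _ [A mA ->].
rewrite (_ : [set w | _] = \bigcap_(i in [set i | (i < k)%N]) (xi i @^-1` A i)); last first.
  by apply/seteqP; split => w /= h i ik; apply: h.
apply: bigcap_measurableType => i _; rewrite -[X in measurable X]setTI; exact: mxi.
Qed.

Lemma past_id k : measurable_fun [set: T] (id : T -> g_sigma_algebraType (past k)).
Proof. by move=> _ D mD; rewrite setTI preimage_id; exact: (@past_measurable k). Qed.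

Lemma measurable_past_xi k i : (i < k)%N ->
  measurable_fun [set: g_sigma_algebraType (past k)] (xi i : g_sigma_algebraType (past k) -> measurableTypeR R).
Proof.
move=> ik _ B mB; rewrite setTI; apply: sub_sigma_algebra.
exists (fun j => if j == i then B else setT); first by move=> j; case: ifP.
apply/seteqP; split => w /=.
  by move=> h j jk; case: eqP => [->|].
by move/(_ i ik); rewrite eqxx.
Qed.

(** The history is represented by the identity map into [T] with the smaller sigma-algebra, so one
    Fubini argument covers every functional of the past. *)
Lemma integral_next k (F : g_sigma_algebraType (past k) * measurableTypeR R -> \bar R) :
  measurable_fun [set: g_sigma_algebraType (past k) * measurableTypeR R] F -> (forall z, 0 <= F z)%E ->
  (\int[P]_w F (w, xi k w) = \int[P]_w \int[pushforward P (xi k)]_y F (w, y))%E.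
Proof.
move=> mF F0.
have idm := isMeasurableFun.Build _ _ _ _ (id : T -> g_sigma_algebraType (past k)) (@past_id k).
pose X : {mfun T >-> g_sigma_algebraType (past k)} := HB.pack (id : T -> g_sigma_algebraType (past k)) idm.
have xim := isMeasurableFun.Build _ _ _ _ (xi k) (@mxi k).
pose Y : {mfun T >-> measurableTypeR R} := HB.pack (xi k) xim.
apply: (@integral_independent _ T R P T (past k) _ (measurableTypeR R) X Y) => //.
- exact: past_setI.
- exact: past_setT.
move=> _ B [A mA ->] mB.
have := ind k.+1 (A := fun i => if i == k then B else A i).
rewrite big_ord_recr/= eqxx => e.
rewrite (_ : _ `&` _ = [set w | forall i, (i < k.+1)%N -> (if i == k then B else A i) (xi i w)]); last first.
  apply/seteqP; split => w /=.
    move=> [h1 h2] i; rewrite ltnS leq_eqVlt => /orP[/eqP->|ik]; first by rewrite eqxx.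
    by rewrite ltn_eqF//; exact: h1.
  move=> h; split; last by have := h k (ltnSn k); rewrite eqxx.
  by move=> i ik; have := h i (ltnW ik); rewrite ltn_eqF.
rewrite e; last by move=> i; case: ifP.
congr (_ * _)%E; rewrite (ind k)//; apply: eq_bigr => i _.
by rewrite ltn_eqF.
Qed.

End increments.

Section skeleton.
Context d (T : measurableType d) (R : realType) (P : probability T R) (xi : nat -> T -> R).
Hypothesis mxi : forall i, measurable_fun [set: T] (xi i).
Hypothesis ind : forall n A, (forall i, measurable (A i)) ->
  P [set w | forall i, (i < n)%N -> A i (xi i w)] = (\prod_(i < n) P [set w | A i (xi i w)])%E.
Variables (theta b h alp : R) (f psi : R -> R) (C M : R).
Let lam := theta ^+ 2 / 2.
Hypothesis law : forall i A, measurable A -> P [set w | A (xi i w)] = normal_prob 0 (Num.sqrt h) A.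
Hypothesis theta0 : 0 < theta.
Hypothesis h0 : 0 < h.
Hypothesis alp0 : 0 < alp.
Hypothesis mf : measurable_fun [set: R] f.
Hypothesis mpsi : measurable_fun [set: R] psi.
Hypothesis f01 : forall x, 0 < f x <= 1.
Hypothesis fb : forall x, `|x| <= b -> expR (- (3 * theta * b)) <= f x.
Hypothesis b0 : 0 < b.
Hypothesis psi0M : forall x, 0 <= psi x <= M.
Hypothesis psib : forall x, b <= `|x| -> psi x = 0.
Hypothesis step : forall x, `|expR ((psi x - lam) * h) *
  \int[normal_prob 0 (Num.sqrt h)]_y f (x + y) - f x| <= C * (h * Num.sqrt h).

Definition walk_sum k w := \sum_(i < k) xi i w.
Definition clock k w := \sum_(i < k) h * psi (walk_sum i w).
(** At most one [k] contributes, the step in which the clock reaches [alp]. So [crossings n] is the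
    discount [exp (- lam k h)] at that step if it comes within the first [n], and 0 otherwise. *)
Definition crossing k w := expR (- (lam * (k%:R * h))) * ((clock k w < alp) && (alp <= clock k.+1 w))%:R.
Definition crossings n w := \sum_(k < n) crossing k w.

Let lam0 : 0 < lam. Proof. by rewrite divr_gt0// exprn_gt0. Qed.

Lemma clock_recr k w : clock k.+1 w = clock k w + h * psi (walk_sum k w).
Proof. by rewrite /clock big_ord_recr. Qed.

Lemma clock_le k m w : (k <= m)%N -> clock k w <= clock m w.
Proof.
elim: m => [|m IH]; first by rewrite leqn0 => /eqP->.
rewrite leq_eqVlt => /orP[/eqP->//|]; rewrite ltnS => /IH h1; rewrite clock_recr.
apply: le_trans h1 _; rewrite lerDl mulr_ge0 ?(ltW h0)//; by case/andP: (psi0M (walk_sum m w)).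
Qed.

Lemma crossings_le j n w : clock j w < alp -> 0 <= crossings n w <= expR (- (lam * (j%:R * h))).
Proof.
move=> cj; suff : [/\ clock n w < alp -> crossings n w = 0, 0 <= crossings n w & crossings n w <= expR (- (lam * (j%:R * h)))] by case=> _ -> ->.
elim: n => [|n [IH1 IH2 IH3]]; first by rewrite /crossings big_ord0 expR_ge0.
rewrite /crossings big_ord_recr/= -/(crossings n w) /crossing.
case: (ltrP (clock n w) alp) => h1 /=; last first.
  rewrite mulr0 addr0; split => // h2; have := le_lt_trans (clock_le w (leqnSn n)) h2.
  by move=> h3; have := lt_le_trans h3 h1; rewrite ltxx.
rewrite IH1// add0r; case: (lerP alp (clock n.+1 w)) => h2 /=.
  rewrite mulr1; split=> //.
  rewrite ler_expR lerN2 ler_wpM2l ?(ltW lam0)// ler_wpM2r ?(ltW h0)// ler_nat leqNgt; apply/negP => nj.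
  by have := le_lt_trans (clock_le w nj) cj; move/(le_lt_trans h2); rewrite ltxx.
by rewrite mulr0; split => //; exact: expR_ge0.
Qed.

Lemma clock0 w : clock 0 w = 0. Proof. by rewrite /clock big_ord0. Qed.

Lemma crossings01 n w : 0 <= crossings n w <= 1.
Proof. by have := @crossings_le 0 n w; rewrite clock0 mul0r mulr0 oppr0 expR0; apply. Qed.

Lemma crossing_ge0 k w : 0 <= crossing k w.
Proof. by rewrite mulr_ge0 ?expR_ge0. Qed.

Lemma crossings_ge j n w : (j <= n)%N -> alp <= clock j w -> expR (- (lam * (j%:R * h))) <= crossings n w.
Proof.
have self m : alp <= clock m w -> expR (- (lam * (m%:R * h))) <= crossings m w.
  elim: m => [|m IH]; first by rewrite clock0 leNgt alp0.
  move=> h1; rewrite /crossings big_ord_recr/= -/(crossings m w) /crossing h1 andbT.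
  have le_e : expR (- (lam * (m.+1%:R * h))) <= expR (- (lam * (m%:R * h))).
    by rewrite ler_expR lerN2 ler_wpM2l ?(ltW lam0)// ler_wpM2r ?(ltW h0)// ler_nat.
  case: (ltrP (clock m w) alp) => h2.
    rewrite mulr1; apply: le_trans le_e _; rewrite lerDr; by case/andP: (crossings01 m w).
  by rewrite mulr0 addr0; apply: le_trans le_e _; exact: IH.
move=> jn cj; apply: le_trans (self _ cj) _.
rewrite -(subnKC jn) /crossings big_split_ord/= lerDl sumr_ge0// => i _; exact: crossing_ge0.
Qed.

Let pT k := g_sigma_algebraType (past xi k).

Lemma measurable_walk_sum (d1 : measure_display) (T1 : measurableType d1) (g : T1 -> T) k :
  (forall i, (i < k)%N -> measurable_fun [set: T1] (xi i \o g)) ->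
  measurable_fun [set: T1] (walk_sum k \o g).
Proof.
elim: k => [|k IH] hg.
  rewrite (_ : _ \o g = cst 0); last by apply/funext => w; rewrite /walk_sum/= big_ord0.
  exact: measurable_cst.
rewrite (_ : _ \o g = (walk_sum k \o g) \+ (xi k \o g)); last by apply/funext => w; rewrite /walk_sum/= big_ord_recr.
apply: measurable_funD; last exact: hg.
by apply: IH => i ik; apply: hg; exact: ltnW.
Qed.

(** The hypothesis stops at [k.-1] because [clock k] sees the positions up to index [k - 1] only.
    Hence [clock k.+1] depends on the first [k] increments and is independent of [xi k]. *)
Lemma measurable_clock (d1 : measure_display) (T1 : measurableType d1) (g : T1 -> T) k :
  (forall i, (i < k.-1)%N -> measurable_fun [set: T1] (xi i \o g)) ->
  measurable_fun [set: T1] (clock k \o g).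
Proof.
elim: k => [|k IH] hg.
  rewrite (_ : _ \o g = cst 0); last by apply/funext => w; rewrite /= clock0.
  exact: measurable_cst.
rewrite (_ : _ \o g = (clock k \o g) \+ (fun x => h * (psi \o (walk_sum k \o g)) x)); last first.
  by apply/funext => w; rewrite /= clock_recr.
apply: measurable_funD.
  by apply: IH => i ik; apply: hg; case: (k) ik => //= m im; exact: ltnW.
apply: measurable_funM; first exact: measurable_cst.
apply: measurableT_comp => //; exact: measurable_walk_sum.
Qed.

Let mws k : measurable_fun [set: T] (walk_sum k).
Proof. by apply: (@measurable_walk_sum _ T id) => i _; exact: mxi. Qed.
Let mcl k : measurable_fun [set: T] (clock k).
Proof. by apply: (@measurable_clock _ T id) => i _; exact: mxi. Qed.

Let measurable_ind (d1 : measure_display) (T1 : measurableType d1) (u : T1 -> R) (c : R) :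
  measurable_fun [set: T1] u -> measurable_fun [set: T1] (fun w => (u w < c)%R%:R : R).
Proof.
move=> mu; rewrite (_ : (fun w => _) = \1_[set w | u w < c]); last first.
  apply/funext => w; rewrite indicE; congr (_%:R); congr nat_of_bool.
  by apply/idP/idP; rewrite ?inE//= => /set_mem.
apply: measurable_indic; rewrite -[X in measurable X]setTI.
exact: measurable_fun_ltr.
Qed.

Lemma measurable_crossings n : measurable_fun [set: T] (crossings n).
Proof.
apply: measurable_sum => k; apply: measurable_funM; first exact: measurable_cst.
rewrite (_ : (fun w => _) = (fun w => (clock k w < alp)%R%:R * (1 - (clock k.+1 w < alp)%R%:R))); last first.
  by apply/funext => w; rewrite [alp <= _]leNgt; case: (_ < _); case: (_ < _); rewrite /= ?mul1r ?mul0r ?subrr ?subr0.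
apply: measurable_funM; first exact: measurable_ind.
by apply: measurable_funB => //; exact: measurable_ind.
Qed.

Let weight k w := expR (- (lam * (k%:R * h)) + clock k w) * (clock k w < alp)%R%:R.
(** The discretised exponential martingale, killed once the clock has reached [alp]; [J k] is the
    part of it lost in the crossing step. *)
Let N k w := weight k w * f (walk_sum k w).
Let J k w := expR (- (lam * (k%:R * h)) + clock k w) * f (walk_sum k w) * ((clock k w < alp) && (alp <= clock k.+1 w))%:R.
Let gam := normal_prob 0 (Num.sqrt h).
Let avgf x := \int[gam]_y f (x + y).

Let measurable_weight (d1 : measure_display) (T1 : measurableType d1) (g : T1 -> T) k :
  (forall i, (i < k.-1)%N -> measurable_fun [set: T1] (xi i \o g)) ->
  measurable_fun [set: T1] (weight k \o g).
Proof.
move=> /measurable_clock mc; apply: measurable_funM; last exact: measurable_ind.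
by apply: measurableT_comp => //; apply: measurable_funD.
Qed.

Let weight_ge0 k w : 0 <= weight k w. Proof. by rewrite mulr_ge0 ?expR_ge0. Qed.
Let weight_le k w : weight k w <= expR (alp - lam * (k%:R * h)).
Proof.
rewrite /weight; case: ltrP => hc; last by rewrite mulr0 expR_ge0.
by rewrite mulr1 ler_expR addrC lerD2r ltW.
Qed.
Let weight_le1 k w : weight k w <= expR alp.
Proof.
apply: le_trans (weight_le k w) _; rewrite ler_expR gerBl.
by rewrite mulr_ge0 ?(ltW lam0)// mulr_ge0// ltW.
Qed.

Let bounded_integrable (Y : T -> R) (B : R) : measurable_fun [set: T] Y ->
  (forall w, `|Y w| <= B) -> P.-integrable [set: T] (EFin \o Y).
Proof.
move=> mY YB; apply: measurable_bounded_integrable => //.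
  exact: (le_lt_trans (probability_le1 P measurableT) (ltry 1)).
exists B; split; first exact: num_real.
by move=> M' BM w _ /=; apply: le_trans (YB w) (ltW BM).
Qed.

Let Rint_cst (c : R) : \int[P]_w c = c.
Proof. by rewrite Rintegral_cst//= probability_setT mulr1. Qed.

Let avgf_ereal x : (\int[gam]_y (f (x + y))%:E = (avgf x)%:E)%E.
Proof.
rewrite /avgf /Rintegral fineK//; apply: integrable_fin_num => //.
apply: measurable_bounded_integrable => //.
- exact: (le_lt_trans (probability_le1 gam measurableT) (ltry 1)).
- by apply: measurableT_comp => //; exact: measurable_funD.
- exists 1; split => // M' M1 y _ /=; have /andP[? ?] := f01 (x + y).
  by rewrite ger0_norm ?ltW// (le_lt_trans _ M1).
Qed.

Let avgf01 x : 0 <= avgf x <= 1.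
Proof.
rewrite -!lee_fin -avgf_ereal integral_ge0/=; last by move=> y _; rewrite lee_fin; case/andP: (f01 (x + y)) => /ltW.
apply: (@le_trans _ _ (\int[gam]_y (cst 1%:E y))%E).
  apply: ge0_le_integral => //.
  - by move=> y _; rewrite lee_fin; case/andP: (f01 (x + y)) => /ltW.
  - apply/measurable_EFinP; apply: measurableT_comp => //; exact: measurable_funD.
  - by move=> y _; rewrite lee_fin; case/andP: (f01 (x + y)).
by rewrite integral_cst// mul1e; exact: probability_le1.
Qed.

Let measurable_avgf : measurable_fun [set: R] avgf.
Proof.
apply/measurable_EFinP; rewrite (_ : _ \o _ = fubini_F gam (fun z : R * R => (f (z.1 + z.2))%:E)); last first.
  by apply/funext => x; rewrite /= -avgf_ereal.
apply: measurable_fun_fubini_tonelli_F.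
- apply/measurable_EFinP; apply: measurableT_comp => //; apply: measurable_funD.
    exact: measurable_fst.
  exact: measurable_snd.
- by move=> z; rewrite lee_fin; case/andP: (f01 (z.1 + z.2)) => /ltW.
Qed.

Let N_next k : \int[P]_w N k.+1 w = \int[P]_w (weight k.+1 w * avgf (walk_sum k w)).
Proof.
rewrite /Rintegral; congr fine.
pose F (z : pT k * measurableTypeR R) : \bar R := (weight k.+1 z.1 * f (walk_sum k z.1 + z.2))%:E.
have F0 z : (0 <= F z)%E.
  by rewrite lee_fin mulr_ge0//; case/andP: (f01 (walk_sum k z.1 + z.2)) => /ltW.
have mpast i : (i < k)%N -> measurable_fun [set: pT k] (xi i \o (id : pT k -> T)).
  by move=> ik; exact: (@measurable_past_xi _ _ _ _ _ _ ik).
have mF : measurable_fun [set: pT k * measurableTypeR R] F.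
  apply/measurable_EFinP; apply: measurable_funM.
    apply: (@measurableT_comp _ _ _ _ _ _ (weight k.+1 \o (id : pT k -> T))); last exact: measurable_fst.
    exact: measurable_weight.
  apply: measurableT_comp => //; apply: measurable_funD; last exact: measurable_snd.
  apply: (@measurableT_comp _ _ _ _ _ _ (walk_sum k \o (id : pT k -> T))); last exact: measurable_fst.
  exact: measurable_walk_sum.
transitivity (\int[P]_w F (w, xi k w))%E.
  by apply: eq_integral => w _; rewrite /F /N /= /walk_sum big_ord_recr.
rewrite (integral_next mxi ind mF F0); apply: eq_integral => w _.
transitivity (\int[gam]_y ((weight k.+1 w)%:E * (f (walk_sum k w + y))%:E))%E.
  transitivity (\int[gam]_y F (w, y))%E; last by apply: eq_integral => y _; rewrite -EFinM.
  pose mu : {measure set (measurableTypeR R) -> \bar R} :=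
    measure_function_pushforward__canonical__measure_function_Measure P
      (mxi k : measurable_fun [set: T] (xi k : T -> measurableTypeR R)).
  transitivity (\int[mu]_y F (w, y))%E; first by [].
  have E := @eq_measure_integral _ (measurableTypeR R) R setT gam mu (fun y => F (w, y)).
  by apply: E => A mA _; exact: law.
rewrite ge0_integralZl//; first by rewrite avgf_ereal EFinM.
- by apply/measurable_EFinP; apply: measurableT_comp => //; exact: measurable_funD.
- by move=> y _; rewrite lee_fin; case/andP: (f01 (walk_sum k w + y)) => /ltW.
- by rewrite lee_fin.
Qed.

Let mweight k : measurable_fun [set: T] (weight k).
Proof. by apply: (@measurable_weight _ T id) => i _; exact: mxi. Qed.

Let mN k : measurable_fun [set: T] (N k).
Proof. by apply: measurable_funM => //; exact: measurableT_comp. Qed.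

Let mJ k : measurable_fun [set: T] (J k).
Proof.
rewrite /J (_ : (fun w => _) = (fun w => N k w * (1 - (clock k.+1 w < alp)%R%:R))); last first.
  apply/funext => w; rewrite /N /weight [alp <= _]leNgt mulrAC -!mulrA; congr (_ * _).
  by case: (_ < _); case: (_ < _); rewrite /= ?subrr ?subr0 ?mul1r ?mul0r ?mulr0 ?mulr1.
apply: measurable_funM => //; apply: measurable_funB => //; exact: measurable_ind.
Qed.

Let N01 k w : 0 <= N k w <= expR (alp - lam * (k%:R * h)).
Proof.
have /andP[/ltW f0 f1] := f01 (walk_sum k w); rewrite mulr_ge0//=.
by rewrite -[leRHS]mulr1; apply: ler_pM.
Qed.

Let iN k : P.-integrable [set: T] (EFin \o N k).
Proof.
apply: (bounded_integrable (B := expR (alp - lam * (k%:R * h)))) => // w.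
by have /andP[? ?] := N01 k w; rewrite ger0_norm.
Qed.

(** At the crossing step [psi] is nonzero, so the position is within [b] of 0, where [fb] bounds [f]
    from below, and the clock is within [h M] of [alp]. *)
Let J_bounds k w : expR (alp - h * M - 3 * theta * b) * crossing k w <= J k w /\
  J k w <= expR alp * crossing k w.
Proof.
rewrite /J /crossing; case: andP => [[h1 h2]|_]; last by rewrite !mulr0.
have hp : h * psi (walk_sum k w) <= h * M by rewrite ler_wpM2l ?(ltW h0)//; case/andP: (psi0M (walk_sum k w)).
have fw : expR (- (3 * theta * b)) <= f (walk_sum k w).
  apply: fb; rewrite leNgt; apply/negP => /ltW/psib p0.
  by move: h2; rewrite clock_recr p0 mulr0 addr0 leNgt h1.
have /andP[/ltW f0 f1] := f01 (walk_sum k w).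
rewrite !mulr1 [expR (_ - 3 * theta * b)]expRD; split.
  rewrite [expR (- _ + _)]expRD [leRHS]mulrAC -[leRHS]mulrA [leRHS]mulrC; apply: ler_wpM2r; first exact: expR_ge0.
  rewrite [leRHS]mulrC; apply: ler_pM; rewrite ?expR_ge0// ler_expR.
  by move: h2; rewrite clock_recr; lra.
rewrite expRD -mulrA mulrC; apply: ler_wpM2r; first exact: expR_ge0.
by apply: le_trans (ler_piMr (expR_ge0 _) f1) _; rewrite ler_expR ltW.
Qed.

Let iJ k : P.-integrable [set: T] (EFin \o J k).
Proof.
apply: (bounded_integrable (B := expR alp * 1)) => // w.
have J0 : 0 <= J k w.
  by rewrite !mulr_ge0 ?expR_ge0//; case/andP: (f01 (walk_sum k w)) => /ltW.
rewrite ger0_norm//; have [_ h2] := J_bounds k w; apply: le_trans h2 _.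
rewrite ler_wpM2l ?expR_ge0//; apply: (@le_trans _ _ (crossings k.+1 w)).
  rewrite /crossings big_ord_recr/= lerDr sumr_ge0// => i _; exact: crossing_ge0.
by case/andP: (crossings01 k.+1 w).
Qed.

Let one_step k : `|\int[P]_w N k w - \int[P]_w N k.+1 w - \int[P]_w J k w| <= C * expR alp * (h * Num.sqrt h).
Proof.
rewrite N_next; set Y := fun w => weight k.+1 w * avgf (walk_sum k w).
have mY : measurable_fun [set: T] Y by exact: (measurable_funM (mweight _) (measurableT_comp measurable_avgf (mws k))).
have iY : P.-integrable [set: T] (EFin \o Y).
  apply: (bounded_integrable (B := expR alp * 1)) => // w.
  have /andP[a1 a2] := avgf01 (walk_sum k w).
  by rewrite ger0_norm ?mulr_ge0//; apply: ler_pM.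
have iNY : P.-integrable [set: T] (EFin \o (fun w => N k w - Y w)) by exact: (integrableB _ (iN k) iY).
have iD : P.-integrable [set: T] (EFin \o (fun w => N k w - Y w - J k w)) by exact: (integrableB _ iNY (iJ k)).
rewrite -RintegralB// -RintegralB//.
apply: le_trans (le_normr_Rintegral _ iD) _ => //.
rewrite -[leRHS]Rint_cst.
apply: le_Rintegral => //; first exact: integrable_norm.
  exact: finite_measure_integrable_cst.
move=> w _ /=.
(* Three cases: not crossed at [k + 1], where [step] will apply; crossing now, where [N k = J k] and
   [Y] is zero; crossed earlier, where everything vanishes. *)
rewrite (_ : N k w - Y w - J k w = weight k w * (clock k.+1 w < alp)%R%:R *
  (f (walk_sum k w) - expR ((psi (walk_sum k w) - lam) * h) * avgf (walk_sum k w))); last first.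
  have hp : 0 <= h * psi (walk_sum k w) by rewrite mulr_ge0 ?(ltW h0)//; case/andP: (psi0M (walk_sum k w)).
  rewrite /N /Y /J /weight [alp <= _]leNgt.
  have -> : - (lam * (k.+1%:R * h)) + clock k.+1 w = - (lam * (k%:R * h)) + clock k w + (psi (walk_sum k w) - lam) * h.
    by rewrite clock_recr -natr1; ring.
  rewrite [in X in _ - X * _ - _]expRD.
  case: (ltrP (clock k.+1 w) alp) => h1.
    have -> : clock k w < alp by apply: le_lt_trans h1; exact: clock_le.
    by rewrite /=; ring.
  by case: (ltrP (clock k w) alp) => h2 /=; ring.
rewrite normrM ger0_norm; last by rewrite mulr_ge0.
rewrite distrC (_ : C * expR alp * (h * Num.sqrt h) = expR alp * (C * (h * Num.sqrt h))); last by ring.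
apply: ler_pM => //; first exact: mulr_ge0.
apply: le_trans (weight_le1 k w); rewrite ler_piMr//.
  by case: (clock k.+1 w < alp).
exact: step.
Qed.

Let telescoped n : `|\int[P]_w N 0 w - \int[P]_w N n w - \sum_(k < n) \int[P]_w J k w| <=
  n%:R * (C * expR alp * (h * Num.sqrt h)).
Proof.
elim: n => [|n IH]; first by rewrite big_ord0 subrr subrr normr0 mul0r.
rewrite big_ord_recr/= (_ : _ - _ = (\int[P]_w N 0 w - \int[P]_w N n w - \sum_(k < n) \int[P]_w J k w) +
  (\int[P]_w N n w - \int[P]_w N n.+1 w - \int[P]_w J n w)); last by ring.
by apply: le_trans (ler_normD _ _) _; rewrite -natr1 mulrDl mul1r; apply: lerD; [exact: IH|exact: one_step].
Qed.

Let icr k : P.-integrable [set: T] (EFin \o crossing k).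
Proof.
apply: (bounded_integrable (B := 1)) => [|w].
  rewrite (_ : crossing k = fun w => crossings k.+1 w - crossings k w); last first.
    by apply/funext => w; rewrite /crossings big_ord_recr/= addrAC subrr add0r.
  by apply: measurable_funB; exact: measurable_crossings.
rewrite ger0_norm ?crossing_ge0//; apply: (@le_trans _ _ (crossings k.+1 w)).
  rewrite /crossings big_ord_recr/= lerDr sumr_ge0// => i _; exact: crossing_ge0.
by case/andP: (crossings01 k.+1 w).
Qed.

Let icrs n : P.-integrable [set: T] (EFin \o crossings n).
Proof.
apply: (bounded_integrable (B := 1)) => [|w]; first exact: measurable_crossings.
by case/andP: (crossings01 n w) => ? ?; rewrite ger0_norm.
Qed.

Let sum_crossings n : \int[P]_w crossings n w = \sum_(k < n) \int[P]_w crossing k w.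
Proof.
elim: n => [|n IH].
  rewrite big_ord0 (_ : crossings 0 = cst 0); last by apply/funext => w; rewrite /crossings big_ord0.
  by rewrite Rintegral_cst// mul0r.
rewrite big_ord_recr/= -IH -RintegralD//; apply: eq_Rintegral => w _.
by rewrite /crossings big_ord_recr.
Qed.

Let N0 : expR (- (3 * theta * b)) <= \int[P]_w N 0 w <= 1.
Proof.
have N0E w : N 0 w = f 0.
  by rewrite /N /weight clock0 alp0 mulr1 mul0r mulr0 oppr0 addr0 expR0 mul1r /walk_sum big_ord0.
rewrite (_ : \int[P]_w N 0 w = f 0); last first.
  by rewrite (_ : N 0 = cst (f 0)); [rewrite Rint_cst|exact/funext].
by rewrite fb ?normr0 ?(ltW b0)//=; case/andP: (f01 0).
Qed.

Lemma crossings_expectation_le n :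
  expR (alp - h * M - 3 * theta * b) * \int[P]_w crossings n w <= 1 + n%:R * (C * expR alp * (h * Num.sqrt h)).
Proof.
have := telescoped n; rewrite ler_norml => /andP[h1 _].
have Nn : 0 <= \int[P]_w N n w by apply: Rintegral_ge0 => w _; case/andP: (N01 n w).
have /andP[_ h2] := N0.
have : expR (alp - h * M - 3 * theta * b) * \int[P]_w crossings n w <= \sum_(k < n) \int[P]_w J k w.
  rewrite sum_crossings mulr_sumr; apply: ler_sum => k _.
  rewrite -RintegralZl//; apply: le_Rintegral => //.
    exact: (integrableZl _ _ (icr k)).
  by move=> w _; have [] := J_bounds k w.
lra.
Qed.

(** The second exponential bounds [N n] on the paths that have not crossed by time [n h]; it
    disappears only when this horizon tends to infinity. *)
Lemma crossings_expectation_ge n :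
  expR (- (3 * theta * b)) - expR (alp - lam * (n%:R * h)) - n%:R * (C * expR alp * (h * Num.sqrt h))
   <= expR alp * \int[P]_w crossings n w.
Proof.
have := telescoped n; rewrite ler_norml => /andP[_ h1].
have Nn : \int[P]_w N n w <= expR (alp - lam * (n%:R * h)).
  rewrite -[leRHS]Rint_cst.
  apply: le_Rintegral => //; first exact: finite_measure_integrable_cst.
  by move=> w _; case/andP: (N01 n w).
have /andP[h2 _] := N0.
have : \sum_(k < n) \int[P]_w J k w <= expR alp * \int[P]_w crossings n w.
  rewrite sum_crossings mulr_sumr; apply: ler_sum => k _.
  rewrite -RintegralZl//; apply: le_Rintegral => //.
    exact: (integrableZl _ _ (icr k)).
  by move=> w _; have [] := J_bounds k w.
lra.
Qed.

End skeleton.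

(** * The Laplace transform of the inverse local time *)

Section path_occupation.
Context {R : realType}.

Lemma dyadic_below (t del : R) : 0 <= t -> 0 < del ->
  exists k n, k%:R * 2^-1 ^+ n <= t /\ t < k%:R * 2^-1 ^+ n + del.
Proof.
move=> t0 d0.
have /cvgrPdist_lt/(_ _ d0)[n _ /(_ n (leqnn n))] : 2^-1 ^+ n @[n --> \oo] --> (0 : R).
  by apply: cvg_expr; rewrite ger0_norm ?invr_ge0// invf_lt1// ltr1n.
rewrite /= sub0r normrN ger0_norm ?exprn_ge0// => hn.
exists (Num.trunc (t * 2 ^+ n)), n.
have p0 : 0 < 2 ^+ n :> R by rewrite exprn_gt0.
have h := truncn_itv (mulr_ge0 t0 (ltW p0)).
rewrite exprVn ler_pdivrMr//; split; first by case/andP: h.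
apply: le_lt_trans (_ : t <= (Num.trunc (t * 2 ^+ n)).+1%:R / 2 ^+ n) _.
  by rewrite ler_pdivlMr// ltW//; case/andP: h.
by rewrite -natr1 mulrDl mul1r -exprVn ltrD2l.
Qed.

Variable beta : R -> R.
Hypothesis cbeta : {within `[0, +oo[, continuous beta}.

Lemma path_continuity (x e : R) : 0 <= x -> 0 < e ->
  exists2 del, 0 < del & forall s, 0 <= s -> `|s - x| < del -> `|beta s - beta x| < e.
Proof.
move=> x0 e0; have x0' : `[0, +oo[%classic x by rewrite /= in_itv/= x0.
move/subspace_continuousP : cbeta => /(_ x x0') /cvgrPdist_lt /(_ e e0).
rewrite /within/= => /nbhs_ballP[del /= del0 hd]; exists del => // s s0 sx.
by rewrite distrC; apply: hd; rewrite /ball/= ?in_itv/= ?s0// distrC.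
Qed.

Lemma path_uniform (t e : R) : 0 < e ->
  exists2 del, 0 < del & forall x s, 0 <= x <= t -> 0 <= s -> `|s - x| < del -> `|beta s - beta x| < e.
Proof.
move=> e0.
have e2 : 0 < e / 2 by rewrite divr_gt0.
have /compact_near_coveringP cov := @segment_compact R 0 t.
have : \forall del \near (0:R)^'+, `[0, t] `<=`
    (fun x => 0 <= x -> forall s, 0 <= s -> `|s - x| < del -> `|beta s - beta x| < e).
  apply: cov => x; rewrite /= in_itv/= => /andP[x0 xt].
  have [r r0 hr] := path_continuity x0 e2.
  have r2 : 0 < r / 2 by rewrite divr_gt0.
  exists (ball x (r / 2), [set del | del < r / 2]) => /=.
    by split; [exact: nbhsx_ballx|exact: nbhs_right_lt].
  move=> [y del] /= [xy hdel] y0 s s0 sy.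
  have h1 : `|beta y - beta x| < e / 2.
    apply: hr => //; rewrite distrC; apply: lt_trans xy _; rewrite /=; lra.
  have h2 : `|beta s - beta x| < e / 2.
    apply: hr => //; rewrite -(subrK y s) -addrA; apply: le_lt_trans (ler_normD _ _) _.
    rewrite /ball/= in xy; rewrite (distrC y x); lra.
  rewrite (_ : beta s - beta y = (beta s - beta x) - (beta y - beta x)); last by ring.
  apply: le_lt_trans (ler_normB _ _) _; lra.
move=> H; have [del [/= d0 hd]] := filter_ex (filterI (nbhs_right_gt (0:R)) H).
exists del => // x s /andP[x0 xt] s0; apply: (hd x) => //.
by rewrite /= in_itv/= x0.
Qed.

Definition occupied (t e : R) : set R := [set s | 0 <= s <= t /\ `|beta s| < e].

Lemma measurable_occupied t e : measurable (occupied t e).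
Proof.
have mb := subspace_continuous_measurable_fun (measurable_itv _) cbeta.
rewrite (_ : occupied t e = `[0, t]%classic `&` (`[0, +oo[%classic `&` beta @^-1` `]- e, e[%classic)); last first.
  apply/seteqP; split=> s; rewrite /occupied/= !in_itv/= ltr_norml.
    by move=> [/andP[-> ->] ->].
  by move=> [-> [_ ->]].
by apply: measurableI => //; apply: mb.
Qed.

Let measure_piece (k : nat) (h : R) : 0 < h ->
  lebesgue_measure (`]k%:R * h, k.+1%:R * h]%classic : set R) = h%:E.
Proof.
move=> h0; rewrite lebesgue_measure_itv/= lte_fin -[in X in X < _](addr0 (k%:R * h)) -natr1 mulrDl mul1r ltrD2l h0.
by rewrite -EFinB addrAC subrr add0r.
Qed.

(** On a mesh interval the path moves by less than [e' - e], so a value below [e] anywhere in it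
    forces a value below [e'] at its left end. *)
Lemma occupied_le (h e e' : R) j : 0 < h -> 0 <= e' ->
  (forall k s, (k < j)%N -> k%:R * h <= s <= k.+1%:R * h -> `|beta s - beta (k%:R * h)| < e' - e) ->
  (lebesgue_measure (occupied (j%:R * h) e) <= (\sum_(k < j) h * (`|beta (k%:R * h)| < e')%R%:R)%:E)%E.
Proof.
move=> h0 e'0; elim: j => [|j IH] osc.
  rewrite big_ord0; apply: (@le_trans _ _ (lebesgue_measure [set (0:R)])); last by rewrite lebesgue_measure_set1.
  apply: le_measure; rewrite ?inE//; first exact: measurable_occupied.
  by move=> s [/andP[a b] _] /=; apply/eqP; rewrite eq_le a andbT; move: b; rewrite mul0r.
rewrite big_ord_recr/= EFinD.
apply: (@le_trans _ _ (lebesgue_measure (occupied (j%:R * h) e `|`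
    (if `|beta (j%:R * h)| < e' then `]j%:R * h, j.+1%:R * h]%classic else set0)))).
  apply: le_measure; rewrite ?inE.
  - exact: measurable_occupied.
  - by apply: measurableU; [exact: measurable_occupied|case: ifP].
  - move=> s [/andP[s0 sj] be].
    case: (lerP s (j%:R * h)) => sjh; [left; split => //; exact/andP|right].
    have := osc j s (ltnSn j); rewrite (ltW sjh) sj => /(_ isT) o.
    have -> : `|beta (j%:R * h)| < e'.
      rewrite -(subKr (beta s) (beta (j%:R * h))); apply: le_lt_trans (ler_normB _ _) _; lra.
    by rewrite /= in_itv/= sjh.
set I : set R := if _ then _ else _.
have mI : measurable I by rewrite /I; case: ifP.
apply: (le_trans (measureU2 lebesgue_measure (measurable_occupied _ _) mI)).
rewrite /I; apply: leeD; first by apply: IH => k s kj; apply: osc; exact: ltnW.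
case: ifP => _; last by rewrite measure0 mulr0.
by rewrite mulr1 -(measure_piece j h0); exact: lexx.
Qed.

Lemma occupied_ge (h e e' : R) j : 0 < h ->
  (forall k s, (k < j)%N -> k%:R * h <= s <= k.+1%:R * h -> `|beta s - beta (k%:R * h)| < e' - e) ->
  ((\sum_(k < j) h * (`|beta (k%:R * h)| < e)%R%:R)%:E <= lebesgue_measure (occupied (j%:R * h) e'))%E.
Proof.
move=> h0; elim: j => [|j IH] osc; first by rewrite big_ord0 measure_ge0.
rewrite big_ord_recr/= EFinD.
have jh : j%:R * h <= j.+1%:R * h by rewrite ler_wpM2r ?(ltW h0)// ler_nat.
apply: (@le_trans _ _ (lebesgue_measure (occupied (j%:R * h) e' `|`
    (if `|beta (j%:R * h)| < e then `]j%:R * h, j.+1%:R * h]%classic else set0)))); last first.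
  apply: le_measure; rewrite ?inE.
  - by apply: measurableU; [exact: measurable_occupied|case: ifP].
  - exact: measurable_occupied.
  - move=> s [[/andP[s0 sj] be]|].
      by split => //; rewrite s0/=; exact: le_trans jh.
    case: ifP => // bj; rewrite /= in_itv/= => /andP[s1 s2].
    have s0 : 0 <= s by apply: le_trans (ltW s1); rewrite mulr_ge0// ltW.
    split; first by rewrite s0.
    have := osc j s (ltnSn j); rewrite (ltW s1) s2 => /(_ isT) o.
    rewrite -(subrK (beta (j%:R * h)) (beta s)); apply: le_lt_trans (ler_normD _ _) _; lra.
rewrite measureU.
- apply: leeD; first by apply: IH => k s kj; apply: osc; exact: ltnW.
  case: ifP => _; last by rewrite measure0 mulr0.
  by rewrite mulr1 -(measure_piece j h0); exact: lexx.
- exact: measurable_occupied.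
- by case: ifP.
- apply/seteqP; split => // s [[/andP[_ sj] _]]; case: ifP => //= _; rewrite in_itv/= => /andP[sj' _].
  by move: (lt_le_trans sj' sj); rewrite ltxx.
Qed.

(** For [i >= i0] the truncated subtraction is exact, and [j0 * 2 ^ (i - i0)] steps of length
    [2 ^ (- i)] end precisely at the dyadic time. *)
Lemma occupied_dyadic (j0 i0 : nat) (e1 e2 e3 e4 : R) : 0 < e1 -> e1 < e2 -> e3 < e4 ->
  \forall i \near \oo,
   (lebesgue_measure (occupied (j0%:R * 2^-1 ^+ i0) e1) <=
     (\sum_(k < j0 * 2 ^ (i - i0)) 2^-1 ^+ i * (`|beta (k%:R * 2^-1 ^+ i)| < e2)%R%:R)%:E)%E /\
   ((\sum_(k < j0 * 2 ^ (i - i0)) 2^-1 ^+ i * (`|beta (k%:R * 2^-1 ^+ i)| < e3)%R%:R)%:E <=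
     lebesgue_measure (occupied (j0%:R * 2^-1 ^+ i0) e4))%E.
Proof.
move=> e10 e12 e34; pose e := Num.min (e2 - e1) (e4 - e3).
have ep : 0 < e by rewrite lt_min !subr_gt0 e12.
set t := j0%:R * _; have [del d0 hd] := path_uniform t ep.
have c0 : 2^-1 ^+ n @[n --> \oo] --> (0 : R).
  by apply: cvg_expr; rewrite ger0_norm ?invr_ge0// invf_lt1// ltr1n.
have near_del : \forall i \near \oo, (2^-1 : R) ^+ i < del by exact: (cvgr_lt _ c0).
near=> i.
have hdel : (2^-1 : R) ^+ i < del by near: i.
have ii0 : (i0 <= i)%N by near: i; exact: nbhs_infty_ge.
have h0 : 0 < (2^-1 : R) ^+ i by rewrite exprn_gt0.
have tE : t = (j0 * 2 ^ (i - i0))%N%:R * 2^-1 ^+ i.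
  rewrite /t natrM natrX -mulrA; congr (_ * _).
  have -> : (2^-1 : R) ^+ i = 2^-1 ^+ i0 * 2^-1 ^+ (i - i0) by rewrite -exprD subnKC.
  by rewrite mulrCA -exprMn divff// expr1n mulr1.
have osc k s : (k < j0 * 2 ^ (i - i0))%N -> k%:R * 2^-1 ^+ i <= s <= k.+1%:R * 2^-1 ^+ i ->
    `|beta s - beta (k%:R * 2^-1 ^+ i)| < e.
  move=> kj /andP[s1 s2]; have k0 : 0 <= k%:R * (2^-1 : R) ^+ i by rewrite mulr_ge0// ltW.
  apply: hd.
  - by rewrite k0/= tE ler_wpM2r ?(ltW h0)// ler_nat ltnW.
  - exact: le_trans s1.
  - rewrite ger0_norm ?subr_ge0//; apply: le_lt_trans hdel.
    by move: s2; rewrite -natr1 mulrDl mul1r; lra.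
rewrite tE; split.
- apply: occupied_le => //; first by rewrite ltW// (lt_trans e10).
  by move=> k s kj ks; apply: lt_le_trans (osc k s kj ks) _; rewrite ge_min lexx.
- apply: occupied_ge => // k s kj ks; apply: lt_le_trans (osc k s kj ks) _.
  by rewrite ge_min lexx orbT.
Unshelve. all: by end_near. Qed.

End path_occupation.

(** * Attainment and measurability of the inverse local time *)

Section inverse_local_time.
Context {R : realType} (dsp : measure_display) (Om : measurableType dsp) (P : probability Om R).
Variables (L : R -> {RV P >-> R}) (u : R).
Hypothesis cL : forall w, {within `[0, +oo[, continuous (fun t => L t w)}.

(** If [L] stays below [u] on [[0, z]], continuity keeps it below slightly beyond [z], so the
    infimum cannot be [z]. *)
Lemma inv_local_time_leP (z : R) w : 0 <= z ->
  (inv_local_time L u w <= z%:E)%E <-> exists2 t, 0 <= t <= z & u <= L t w.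
Proof.
move=> z0; split; last first.
  move=> [t /andP[t0 tz] ut]; apply: le_trans (_ : t%:E <= _)%E; last by rewrite lee_fin.
  by apply: ereal_inf_lbound; exists t.
apply: contraPP => no.
have nt t : 0 <= t <= z -> L t w < u.
  by move=> tz; rewrite ltNge; apply/negP => ut; apply: no; exists t.
have Lz : L z w < u by apply: nt; rewrite z0 lexx.
have gap : 0 < u - L z w by rewrite subr_gt0.
have [del d0 hd] := path_continuity (@cL w) z0 gap.
move=> inf_le; have := @le_ereal_inf_tmp _ [set t%:E | t in [set t : R | 0 <= t /\ u <= L t w]] (z + del)%:E.
apply/not_implyP; split; last first.
  apply/negP; rewrite -ltNge; apply: le_lt_trans inf_le _; rewrite lte_fin; lra.
move=> _ [t [t0 ut] <-]; rewrite lee_fin leNgt; apply/negP => tzd.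
case: (lerP t z) => tz; first by have := nt t; rewrite t0 tz => /(_ isT); rewrite ltNge ut.
have := hd t t0; rewrite gtr0_norm ?subr_gt0// ltrBlDl => /(_ tzd).
by rewrite ltr_norml => /andP[_]; rewrite ltrD2r ltNge ut.
Qed.

Lemma inv_local_time_ge0 w : (0 <= inv_local_time L u w)%E.
Proof. by apply: le_ereal_inf_tmp => _ [t [t0 _] <-]; rewrite lee_fin. Qed.

(** The event that level [u] is reached by time [z] is expressed through countably many times: for
    each [p], some dyadic time up to [z] has [L > u - 1 / (p + 1)]. The maximum of the continuous
    path over [[0, z]] is then at least [u]. *)
Lemma measurable_inv_local_time : measurable_fun [set: Om] (inv_local_time L u).
Proof.
move=> _; apply: (measurability _ (ErealGenOInfty.measurableE R)) => //.
move=> _ [_ [z ->] <-]; rewrite setTI.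
rewrite (_ : _ @^-1` _ = ~` [set w | (inv_local_time L u w <= z%:E)%E]); last first.
  apply/seteqP; split => w; rewrite /= in_itv/= andbT.
    by move=> h; apply/negP; rewrite -ltNge.
  by move=> /negP; rewrite -ltNge.
apply: measurableC; have [z0|z0] := ltP z 0.
  rewrite (_ : [set w | _] = set0)//; apply/seteqP; split => // w /=.
  by move=> /(le_trans (inv_local_time_ge0 w)); rewrite lee_fin leNgt z0.
rewrite (_ : [set w | _] = \bigcap_(p : nat) \bigcup_(k : nat) \bigcup_(n : nat)
    (if k%:R * 2^-1 ^+ n <= z then L (k%:R * 2^-1 ^+ n) @^-1` `]u - p.+1%:R^-1, +oo[ else set0)).
  apply: bigcapT_measurable => p; apply: bigcupT_measurable => k; apply: bigcupT_measurable => n.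
  by case: ifP => // _; rewrite -[X in measurable X]setTI; exact: measurable_funP.
apply/seteqP; split => w /=.
  move/(inv_local_time_leP _ z0) => [t /andP[t0 tz] ut] p _.
  have gap : 0 < p.+1%:R^-1 :> R by rewrite invr_gt0.
  have [del d0 hd] := path_continuity (@cL w) t0 gap.
  have [k [n [kn1 kn2]]] := dyadic_below t0 d0.
  exists k => //; exists n => //; rewrite (le_trans kn1 tz) /= in_itv/= andbT.
  have q0 : 0 <= k%:R * (2^-1 : R) ^+ n by rewrite mulr_ge0.
  have := hd _ q0; rewrite ler0_norm ?subr_le0// opprB ltrBlDl => /(_ kn2).
  by rewrite ltr_norml => /andP[+ _]; set v := p.+1%:R^-1; lra.
move=> h; apply/(inv_local_time_leP _ z0).
have cLz : {within `[0, z], continuous (fun t => L t w)}.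
  by apply: continuous_subspaceW (@cL w) => t; rewrite /= !in_itv/= => /andP[-> _].
have [c cz maxc] := EVT_max z0 cLz.
exists c; first by move: cz; rewrite in_itv.
apply/ler_addgt0Pr => e e0.
pose p := Num.trunc e^-1.
have pe : p.+1%:R^-1 <= e.
  by rewrite -[leRHS]invrK lef_pV2 ?posrE ?invr_gt0// ltW// truncnS_gt.
have [k _ [n _]] := h p I; case: ifP => // knz; rewrite /= in_itv/= andbT => hu.
have q0 : 0 <= k%:R * (2^-1 : R) ^+ n by rewrite mulr_ge0.
have := maxc (k%:R * 2^-1 ^+ n); rewrite in_itv/= q0 knz => /(_ isT).
by move: hu pe; set v := p.+1%:R^-1; lra.
Qed.

End inverse_local_time.

Section double_fatou.
Context {R : realType}.

Lemma limn_einf_ge (u : (\bar R)^nat) (x : \bar R) :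
  (\forall n \near \oo, x <= u n)%E -> (x <= limn_einf u)%E.
Proof.
move=> [n0 _ h]; rewrite limn_einf_lim (cvg_lim _ (@cvg_einfs_sup R u))//.
apply: (@le_trans _ _ (einfs u n0)); last by apply: ereal_sup_ubound; exists n0.
by apply: le_ereal_inf_tmp => _ [m /= n0m <-]; exact: h.
Qed.

Lemma limn_einf_le (u : (\bar R)^nat) (x : \bar R) :
  (\forall n \near \oo, u n <= x)%E -> (limn_einf u <= x)%E.
Proof.
move=> [n0 _ h]; rewrite limn_einf_lim (cvg_lim _ (@cvg_einfs_sup R u))//.
apply: ge_ereal_sup => _ [n _ <-].
apply: (@le_trans _ _ (u (maxn n n0))); last by apply: h; rewrite /= leq_maxr.
by apply: ereal_inf_lbound; exists (maxn n n0) => //=; rewrite leq_maxl.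
Qed.

Context d (T : measurableType d) (P : probability T R).
Variables (Phi : nat -> nat -> T -> R) (g : T -> R) (c : R).
Hypothesis mPhi : forall m i, measurable_fun [set: T] (Phi m i).
Hypothesis Phi0 : forall m i w, 0 <= Phi m i w.
Hypothesis mg : measurable_fun [set: T] g.
Hypothesis g0 : forall w, 0 <= g w.
Hypothesis EPhi : forall e, 0 < e -> \forall m \near \oo, \forall i \near \oo,
  (\int[P]_w (Phi m i w)%:E <= (c + e)%:E)%E.
Hypothesis gPhi : {ae P, forall w, forall e, 0 < e -> \forall m \near \oo, \forall i \near \oo,
  g w - e <= Phi m i w}.

(** Fatou for the inner limit in [i], then for the outer one in [m]. The limits are iterated since
    the mesh goes to 0 before the kernel concentrates. *)
Lemma double_fatou : (\int[P]_w (g w)%:E <= c%:E)%E.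
Proof.
pose inner m w := limn_einf (fun i => (Phi m i w)%:E).
pose outer w := limn_einf (fun m => inner m w).
have mlim (u : (T -> \bar R)^nat) : (forall n, measurable_fun [set: T] (u n)) ->
    measurable_fun [set: T] (fun w => limn_einf (fun n => u n w)).
  move=> mu; rewrite /limn_einf; apply: measurableT_comp => //.
  by apply: measurable_fun_limn_esup => n; exact: measurableT_comp.
have minner m : measurable_fun [set: T] (inner m).
  by apply: mlim => i; apply/measurable_EFinP.
have inner0 m w : (0 <= inner m w)%E.
  by apply: limn_einf_ge; near=> i; rewrite lee_fin.
have outer0 w : (0 <= outer w)%E by apply: limn_einf_ge; near=> i; exact: inner0.
apply: (@le_trans _ _ (\int[P]_w outer w)%E).
  apply: ae_ge0_le_integral => //.
  - by move=> w _; rewrite lee_fin.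
  - exact/measurable_EFinP.
  - by apply: mlim.
  apply: filterS gPhi => w hw _; apply/lee_subgt0Pr => e e0; rewrite -EFinB.
  apply: limn_einf_ge; apply: filterS (hw _ e0) => m hm.
  by apply: limn_einf_ge; apply: filterS hm => i; rewrite lee_fin.
apply/lee_addgt0Pr => e e0; rewrite -EFinD.
apply: le_trans (fatou P measurableT minner (fun m w _ => inner0 m w)) _.
apply: limn_einf_le; apply: filterS (EPhi e0) => m hm.
have mi i : measurable_fun [set: T] (fun w => (Phi m i w)%:E) by exact/measurable_EFinP.
have p0 i w : [set: T] w -> (0 <= (Phi m i w)%:E)%E by rewrite lee_fin.
apply: le_trans (fatou P measurableT mi p0) _.
exact: limn_einf_le.
Unshelve. all: by end_near. Qed.

End double_fatou.

(** With [q = sqrt r], Bernoulli's inequality bounds [n q ^ n], and the other factor [q ^ n] tends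
    to 0. *)
Lemma cvg_mul_geometric {R : realType} (r : R) : 0 < r < 1 -> n%:R * r ^+ n @[n --> \oo] --> (0 : R).
Proof.
move=> /andP[r0 r1]; pose q := Num.sqrt r.
have q0 : 0 < q by rewrite sqrtr_gt0.
have qr : r = q ^+ 2 by rewrite sqr_sqrtr// ltW.
have q1 : q < 1 by rewrite -[ltRHS]sqrtr1 ltr_sqrt.
pose del := q^-1 - 1.
have d0 : 0 < del by rewrite subr_gt0 invf_gt1.
have bern n : 1 + n%:R * del <= (q^-1) ^+ n.
  elim: n => [|n IH]; first by rewrite mul0r addr0 expr0.
  rewrite exprS -natr1 (_ : q^-1 = 1 + del); last by rewrite addrC subrK.
  have := ler_wpM2l (_ : 0 <= 1 + del) IH; rewrite (_ : q^-1 = 1 + del) ?[del + 1]addrC ?subrK//; last by rewrite addrC subrK.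
  have nd : 0 <= n%:R * del * del by rewrite !mulr_ge0// ltW.
  move=> h; have {}h := h (addr_ge0 ler01 (ltW d0)); lra.
apply: (@squeeze_cvgr _ _ _ _ (fun=> 0) (fun n => del^-1 * q ^+ n)); last 2 first.
- exact: cvg_cst.
- rewrite -[X in _ --> X](mulr0 del^-1); apply: cvgM; first exact: cvg_cst.
  by apply: cvg_expr; rewrite gtr0_norm.
near=> n; rewrite mulr_ge0 ?exprn_ge0 ?(ltW r0)//=.
rewrite qr -exprM mulnC exprM expr2 mulrA ler_wpM2r ?exprn_ge0 ?(ltW q0)//.
rewrite -[leRHS]mul1r ler_pdivlMr// -[leRHS](mulfV (_ : q ^+ n != 0)); last by rewrite expf_neq0// gt_eqF.
rewrite mulrAC mulrC ler_wpM2l ?exprn_ge0 ?(ltW q0)// -exprVn.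
by apply: le_trans (bern n); rewrite lerDr.
Unshelve. all: by end_near. Qed.

Section brownian_inverse_local_time.
Context {R : realType} (dsp : measure_display) (Om : measurableType dsp) (P : probability Om R).
Variables (B L : R -> {RV P >-> R}).
Hypothesis hB : is_brownian B.
Hypothesis hL : is_local_time0 B L.
Variable theta : R.
Hypothesis theta0 : 0 < theta.
Let lam := theta ^+ 2 / 2.
Let lam0 : 0 < lam. Proof. by rewrite divr_gt0// exprn_gt0. Qed.

Let hh (i : nat) : R := 2^-1 ^+ i.
Let hh0 i : 0 < hh i. Proof. by rewrite exprn_gt0. Qed.
Let hh1 i : hh i <= 1. Proof. by rewrite exprn_ile1// invf_le1// ler1n. Qed.

Let xi i k w := B (k.+1%:R * hh i) w - B (k%:R * hh i) w.
Let walk_sum_xi i k w : walk_sum (xi i) k w = B (k%:R * hh i) w.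
Proof.
have [B0 _ _ _] := hB; elim: k => [|k IH]; first by rewrite /walk_sum big_ord0 mul0r B0.
by rewrite /walk_sum big_ord_recr/= -/(walk_sum (xi i) k w) IH /xi addrC subrK.
Qed.
Let mxi i k : measurable_fun [set: Om] (xi i k).
Proof. by apply: measurable_funB; exact: measurable_funP. Qed.
Let xi_ind i n (A : nat -> set R) : (forall k, measurable (A k)) ->
  P [set w | forall k, (k < n)%N -> A k (xi i k w)] = (\prod_(k < n) P [set w | A k (xi i k w)])%E.
Proof.
have [_ _ _ ind] := hB => mA; apply: (ind n (fun k => k%:R * hh i)) => //.
  by rewrite mul0r.
by move=> k _; rewrite ler_wpM2r ?ler_nat// ltW.
Qed.
Let xi_law i k (A : set R) : measurable A ->
  P [set w | A (xi i k w)] = normal_prob 0 (Num.sqrt (hh i)) A.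
Proof.
have [_ _ law _] := hB => mA.
have k0 : 0 <= k%:R * hh i by rewrite mulr_ge0// ltW.
have lt : k%:R * hh i < k.+1%:R * hh i by rewrite ltr_pM2r// ltr_nat.
have := law _ _ k0 lt A mA; rewrite (_ : k.+1%:R * hh i - k%:R * hh i = hh i); first by [].
by rewrite -natr1 mulrDl mul1r addrAC subrr add0r.
Qed.

Let ep (m : nat) : R := m.+1%:R^-1.
(** [ep < aa < bb < ep (1 + 3 ep)]: the strict gaps leave room for the mesh oscillation, and all are
    equivalent to [ep], so that [1 / (aa + bb)] matches the normalisation [1 / (2 ep)] of local
    time. *)
Let aa m := ep m * (1 + ep m).
Let bb m := ep m * (1 + 2 * ep m).
Let ep0 m : 0 < ep m. Proof. by rewrite invr_gt0. Qed.
Let aa0 m : 0 < aa m. Proof. by rewrite mulr_gt0// addr_gt0. Qed.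
Let aabb m : aa m < bb m.
Proof. by rewrite ltr_pM2l// ltrD2l; have := ep0 m; lra. Qed.
Let bb0 m : 0 < bb m. Proof. exact: lt_trans (aa0 m) (aabb m). Qed.
Let MM m := theta / (aa m + bb m) + theta ^+ 2 / 2.

Let kernel_spec m (K : (R -> R) * (R -> R) * R) :=
  let: (f, psi, C) := K in
  [/\ measurable_fun [set: R] f, measurable_fun [set: R] psi,
      forall x, 0 < f x <= 1, forall x, `|x| <= bb m -> expR (- (3 * theta * bb m)) <= f x &
  [/\ forall x, 0 <= psi x <= MM m,
      forall x, `|x| <= aa m -> theta / (aa m + bb m) <= psi x,
      forall x, bb m <= `|x| -> psi x = 0 &
      forall x h, 0 < h -> h <= 1 ->
        `|expR ((psi x - lam) * h) * \int[normal_prob 0 (Num.sqrt h)]_y f (x + y) - f x|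
        <= C * (h * Num.sqrt h)]].

Let kernels : exists K, forall m, kernel_spec m (K m).
Proof.
have H m : exists K, kernel_spec m K.
  by have [f [psi [C H]]] := smooth_kernel theta0 (aa0 m) (aabb m); exists (f, psi, C).
by have [K hK] := choice H; exists K.
Qed.

Let limits : [/\ ep n @[n --> \oo] --> (0:R), bb n @[n --> \oo] --> (0:R) & hh n @[n --> \oo] --> (0:R)].
Proof.
have e : ep n @[n --> \oo] --> (0:R) by exact: cvg_harmonic.
split => //.
  rewrite -[X in _ --> X](mul0r (1 + 2 * 0)); apply: cvgM => //.
  by apply: cvgD; [exact: cvg_cst|apply: cvgM => //; exact: cvg_cst].
by apply: cvg_expr; rewrite ger0_norm ?invr_ge0// invf_lt1// ltr1n.
Qed.

Let occ t e w := fine (lebesgue_measure (occupied (fun s => B s w) t e)).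

Let occ_fin t e w : lebesgue_measure (occupied (fun s => B s w) t e) = (occ t e w)%:E.
Proof.
have [_ cB _ _] := hB.
rewrite /occ fineK// ge0_fin_numE ?measure_ge0//.
apply: (@le_lt_trans _ _ (lebesgue_measure (`[0, t]%classic : set R))).
  apply: le_measure; rewrite ?inE//; first by apply: measurable_occupied; exact: cB.
  by move=> s [st _]; rewrite /= in_itv.
by rewrite lebesgue_measure_itv/=; case: ifP => _; rewrite ?ltry// -EFinB ltry.
Qed.

(** Only dyadic times are involved, so countably many null sets are discarded. *)
Let good w := forall j i : nat, (occ (j%:R * hh i) e w / (2 * e)) @[e --> 0^'+] --> L (j%:R * hh i) w.

Let ae_good : {ae P, forall w, good w}.
Proof.
have [_ hL2] := hL; rewrite /good.
apply/ae_foralln => j; apply/ae_foralln => i.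
have := hL2 (j%:R * hh i) (mulr_ge0 (ler0n _ _) (ltW (hh0 i))).
apply: filterS => w hw.
have : ((occ (j%:R * hh i) e w / (2 * e))%:E @[e --> 0^'+] --> (L (j%:R * hh i) w)%:E)%E.
  by under eq_fun => e do rewrite mulrC EFinM -occ_fin.
by move/fine_cvgP => [_].
Qed.

Let EFin_integral (Y : Om -> R) : measurable_fun [set: Om] Y -> (forall w, 0 <= Y w <= 1) ->
  (\int[P]_w (Y w)%:E)%E = (\int[P]_w Y w)%:E /\ P.-integrable [set: Om] (EFin \o Y).
Proof.
move=> mY Y01.
have iY : P.-integrable [set: Om] (EFin \o Y).
  apply: measurable_bounded_integrable => //.
    exact: (le_lt_trans (probability_le1 P measurableT) (ltry 1)).
  exists 1; split => // M' M1 w _ /=; have /andP[? ?] := Y01 w.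
  by rewrite ger0_norm// (le_trans _ (ltW M1)).
by split => //; rewrite /Rintegral fineK//; exact: integrable_fin_num.
Qed.

(** * Limits of the crossing functionals *)

Section crossing_limits.
Variables (K : nat -> (R -> R) * (R -> R) * R) (alp : R).
Hypothesis hK : forall m, kernel_spec m (K m).
Hypothesis alp0 : 0 < alp.

Let psi m := (K m).1.2.
Let ck m i := clock (xi i) (hh i) (psi m).
(** With [i * 2 ^ i] steps of length [2 ^ (- i)] the horizon [i] grows while the mesh shrinks, and
    the accumulated error, of order [i * 2 ^ (- i / 2)], still vanishes. *)
Let Phi m i w := crossings (xi i) theta (hh i) alp (psi m) (i * 2 ^ i) w.

Let clock_ge m j0 i0 w : \forall i \near \oo,
  theta / (aa m + bb m) * occ (j0%:R * hh i0) (ep m) w <= ck m i (j0 * 2 ^ (i - i0)) w.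
Proof.
have [_ cB _ _] := hB.
have eaa : ep m < aa m by rewrite /aa ltr_pMr// ltrDl.
have := occupied_dyadic (cB w) j0 i0 (ep0 m) eaa (ltr01); apply: filterS => i [+ _].
rewrite occ_fin lee_fin => h1.
have := hK m; rewrite /kernel_spec; rewrite (_ : K m = (((K m).1).1, psi m, (K m).2)); last by rewrite /psi; case: (K m) => [[]].
move=> [_ _ _ _ [p1 p2 _ _]].
apply: le_trans (ler_wpM2l _ h1) _; first by rewrite divr_ge0 ?(ltW theta0)// addr_ge0 ?ltW.
rewrite mulr_sumr; apply: ler_sum => k _; rewrite walk_sum_xi mulrCA ler_wpM2l ?(ltW (hh0 i))//.
case: ltrP => hb; first by rewrite mulr1 p2// ltW.
by rewrite mulr0; case/andP: (p1 (B (k%:R * hh i) w)).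
Qed.

Let clock_le' m j0 i0 w : \forall i \near \oo,
  ck m i (j0 * 2 ^ (i - i0)) w <= MM m * occ (j0%:R * hh i0) (ep m * (1 + 3 * ep m)) w.
Proof.
have [_ cB _ _] := hB.
have eaa : bb m < ep m * (1 + 3 * ep m) by rewrite ltr_pM2l// ltrD2l; have := ep0 m; lra.
have := occupied_dyadic (cB w) j0 i0 (@ltr01 R) (ltr1n _ 2) eaa; apply: filterS => i [_].
rewrite occ_fin lee_fin => h1.
have := hK m; rewrite /kernel_spec; rewrite (_ : K m = (((K m).1).1, psi m, (K m).2)); last by rewrite /psi; case: (K m) => [[]].
move=> [_ _ _ _ [p1 _ p3 _]].
have M0 : 0 <= MM m by have /andP[a b] := p1 0; exact: le_trans a b.
apply: le_trans (ler_wpM2l M0 h1).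
rewrite mulr_sumr; apply: ler_sum => k _; rewrite walk_sum_xi mulrCA ler_wpM2l ?(ltW (hh0 i))//.
case: ltrP => hb; first by rewrite mulr1; case/andP: (p1 (B (k%:R * hh i) w)).
by rewrite mulr0 p3.
Qed.

Let index_time j0 i0 i : (i0 <= i)%N -> (j0 * 2 ^ (i - i0))%N%:R * hh i = j0%:R * hh i0.
Proof.
move=> ii0; rewrite natrM natrX -mulrA; congr (_ * _).
have -> : hh i = hh i0 * 2^-1 ^+ (i - i0) by rewrite /hh -exprD subnKC.
by rewrite mulrCA -exprMn divff// expr1n mulr1.
Qed.

Let kapE m : theta / (aa m + bb m) = theta * (2 / (2 + 3 * ep m)) / (2 * ep m).
Proof.
have e0 := ep0 m; rewrite /aa /bb; field.
by rewrite !gt_eqF ?addr_gt0 ?mulr_gt0//; lra.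
Qed.

Let cvg_ratio : theta * (2 / (2 + 3 * ep m)) @[m --> \oo] --> theta.
Proof.
have [e _ _] := limits.
rewrite [X in _ --> X](_ : theta = theta * (2 / (2 + 3 * 0))); last by rewrite mulr0 addr0 divff// mulr1.
apply: cvgM; first exact: cvg_cst.
apply: cvgM; first exact: cvg_cst.
apply: cvgV; first by rewrite mulr0 addr0.
by apply: cvgD; [exact: cvg_cst|apply: cvgM => //; exact: cvg_cst].
Qed.

Let Phi_ge j i w : good w -> alp < theta * L (j%:R * hh i) w ->
  \forall m \near \oo, \forall i' \near \oo, expR (- (lam * (j%:R * hh i))) <= Phi m i' w.
Proof.
move=> gw hL'; have [e _ _] := limits.
have c1 : occ (j%:R * hh i) (ep m) w / (2 * ep m) @[m --> \oo] --> L (j%:R * hh i) w.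
  by move/cvg_at_rightP : (gw j i); apply; split.
have c2 : theta / (aa m + bb m) * occ (j%:R * hh i) (ep m) w @[m --> \oo] --> theta * L (j%:R * hh i) w.
  under eq_fun do rewrite kapE -mulrA [_^-1 * _]mulrC.
  exact: (cvgM cvg_ratio c1).
have near_m : \forall m \near \oo, alp < theta / (aa m + bb m) * occ (j%:R * hh i) (ep m) w by apply: (cvgr_gt _ c2).
apply: filterS near_m => m hm.
have hc := clock_ge m j i w.
near=> i'.
have i'i : (i <= i')%N by near: i'; exact: nbhs_infty_ge.
have i'j : (j <= i')%N by near: i'; exact: nbhs_infty_ge.
rewrite -(index_time j i'i).
have := hK m; rewrite /kernel_spec; rewrite (_ : K m = (((K m).1).1, psi m, (K m).2)); last by rewrite /psi; case: (K m) => [[]].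
move=> [_ _ _ _ [p1 _ p3 _]].
apply: (crossings_ge (M := MM m)) => //.
  by apply: leq_mul => //; rewrite leq_exp2l// leq_subr.
apply: le_trans (ltW hm) _; near: i'; exact: hc.
Unshelve. all: by end_near. Qed.

Let Phi_le j i w : good w -> theta * L (j%:R * hh i) w < alp ->
  \forall m \near \oo, \forall i' \near \oo, Phi m i' w <= expR (- (lam * (j%:R * hh i))).
Proof.
move=> gw hL'; have [e _ _] := limits.
have e3 : ep m * (1 + 3 * ep m) @[m --> \oo] --> (0:R).
  rewrite -[X in _ --> X](mul0r (1 + 3 * 0)); apply: cvgM => //.
  by apply: cvgD; [exact: cvg_cst|apply: cvgM => //; exact: cvg_cst].
have e3p m : 0 < ep m * (1 + 3 * ep m) by rewrite mulr_gt0// addr_gt0// mulr_gt0.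
have c1 : occ (j%:R * hh i) (ep m * (1 + 3 * ep m)) w / (2 * (ep m * (1 + 3 * ep m))) @[m --> \oo] --> L (j%:R * hh i) w.
  by move/cvg_at_rightP : (gw j i); apply; split.
have c2 : MM m * occ (j%:R * hh i) (ep m * (1 + 3 * ep m)) w @[m --> \oo] --> theta * L (j%:R * hh i) w.
  have : (theta * (2 / (2 + 3 * ep m)) * (1 + 3 * ep m) + theta ^+ 2 / 2 * (2 * (ep m * (1 + 3 * ep m)))) *
     (occ (j%:R * hh i) (ep m * (1 + 3 * ep m)) w / (2 * (ep m * (1 + 3 * ep m)))) @[m --> \oo] -->
     (theta * (1 + 3 * 0) + theta ^+ 2 / 2 * (2 * 0)) * L (j%:R * hh i) w.
    exact: (cvgM (cvgD (cvgM cvg_ratio (cvgD (cvg_cst _) (cvgM (cvg_cst _) e))) (cvgM (cvg_cst _) (cvgM (cvg_cst _) e3))) c1).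
  rewrite !mulr0 !addr0 mulr1; apply: cvg_trans; apply: near_eq_cvg; near=> m.
  rewrite /MM kapE; set o := occ _ _ _; have q0 := ep0 m; have q3 := e3p m.
  by field; rewrite !gt_eqF//; lra.
have near_m : \forall m \near \oo, MM m * occ (j%:R * hh i) (ep m * (1 + 3 * ep m)) w < alp by apply: (cvgr_lt _ c2).
apply: filterS near_m => m hm.
have hc := clock_le' m j i w.
near=> i'.
have i'i : (i <= i')%N by near: i'; exact: nbhs_infty_ge.
rewrite -(index_time j i'i).
have := hK m; rewrite /kernel_spec; rewrite (_ : K m = (((K m).1).1, psi m, (K m).2)); last by rewrite /psi; case: (K m) => [[]].
move=> [_ _ _ _ [p1 _ p3 _]].
suff : ck m i' (j * 2 ^ (i' - i)) w < alp by move=> /(crossings_le (M := MM m) theta0 (hh0 i') p1 (i' * 2 ^ i')) /andP[].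
apply: le_lt_trans hm; near: i'; exact: hc.
Unshelve. all: by end_near. Qed.

Let mPhi m i : measurable_fun [set: Om] (Phi m i).
Proof.
apply: measurable_crossings => //.
by have := hK m; rewrite /kernel_spec; rewrite (_ : K m = (((K m).1).1, psi m, (K m).2)); [case|rewrite /psi; case: (K m) => [[]]].
Qed.

Let Phi01 m i w : 0 <= Phi m i w <= 1.
Proof.
have := hK m; rewrite /kernel_spec; rewrite (_ : K m = (((K m).1).1, psi m, (K m).2)); last by rewrite /psi; case: (K m) => [[]].
move=> [_ _ _ _ [p1 _ _ _]]; apply: crossings01 => //; exact: p1.
Qed.

Let del m i := (K m).2 * expR alp * (i%:R * Num.sqrt (2^-1) ^+ i).

Let sqrt_hh i : Num.sqrt (hh i) = Num.sqrt (2^-1) ^+ i.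
Proof.
rewrite /hh; elim: i => [|i IH]; first by rewrite !expr0 sqrtr1.
by rewrite !exprS sqrtrM// IH.
Qed.

Let ni i : (i * 2 ^ i)%N%:R * hh i = i%:R.
Proof. by have := @index_time i 0 i (leq0n i); rewrite subn0 /hh expr0 mulr1. Qed.

Let del_cvg m : del m i @[i --> \oo] --> (0:R).
Proof.
rewrite -[X in _ --> X](mulr0 ((K m).2 * expR alp)); apply: cvgM; first exact: cvg_cst.
apply: cvg_mul_geometric; rewrite sqrtr_gt0 invr_gt0 ltr0n/=.
by rewrite -[ltRHS]sqrtr1 ltr_sqrt// invf_lt1// ltr1n.
Qed.

Let expectation_bounds m i :
  expR (alp - hh i * MM m - 3 * theta * bb m) * (\int[P]_w Phi m i w) <= 1 + del m i /\
  expR (- (3 * theta * bb m)) - expR (alp - lam * i%:R) - del m i <= expR alp * \int[P]_w Phi m i w.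
Proof.
have := hK m; rewrite /kernel_spec; rewrite (_ : K m = (((K m).1).1, psi m, (K m).2)); last by rewrite /psi; case: (K m) => [[]].
move=> [mf mp f01 fb [p1 p2 p3 st]].
have stp x := st x (hh i) (hh0 i) (hh1 i).
have delE : del m i = (i * 2 ^ i)%N%:R * ((K m).2 * expR alp * (hh i * Num.sqrt (hh i))).
  by rewrite /del sqrt_hh -(ni i); ring.
split.
  rewrite delE; exact: (crossings_expectation_le (mxi i) (@xi_ind i) (@xi_law i) theta0 (hh0 i) alp0 mf mp f01 fb (bb0 m) p1 p3 stp).
rewrite delE -(ni i).
exact: (crossings_expectation_ge (mxi i) (@xi_ind i) (@xi_law i) theta0 (hh0 i) alp0 mf mp f01 fb (bb0 m) p1 p3 stp).
Qed.

Let exp_cvg (c : R) : expR (- alp + c * bb m) @[m --> \oo] --> expR (- alp).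
Proof.
have [_ b _] := limits.
apply: continuous_cvg; first exact: continuous_expR.
rewrite -[X in _ --> X]addr0 -[X in _ --> _ + X](mulr0 c).
by apply: cvgD; [exact: cvg_cst|apply: cvgM => //; exact: cvg_cst].
Qed.

Let expectation_le e : 0 < e -> \forall m \near \oo, \forall i \near \oo,
  (\int[P]_w (Phi m i w)%:E <= (expR (- alp) + e)%:E)%E.
Proof.
move=> e0; have [_ _ hc] := limits.
have lt0 : expR (- alp) < expR (- alp) + e by rewrite ltrDl.
apply: filterS (cvgr_lt _ (exp_cvg (3 * theta)) _ lt0) => m hm.
have c1 : (1 + del m i) * expR (- alp + 3 * theta * bb m + hh i * MM m) @[i --> \oo] -->
    (1 + 0) * expR (- alp + 3 * theta * bb m + 0 * MM m).
  apply: cvgM; first by apply: cvgD; [exact: cvg_cst|exact: del_cvg].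
  apply: continuous_cvg; first exact: continuous_expR.
  by apply: cvgD; [exact: cvg_cst|apply: cvgM => //; exact: cvg_cst].
rewrite addr0 mul1r mul0r addr0 in c1.
apply: filterS (cvgr_lt _ c1 _ hm) => i hi.
have [-> _] := EFin_integral (mPhi m i) (Phi01 m i).
rewrite lee_fin; apply: le_trans (ltW hi).
have [+ _] := expectation_bounds m i.
rewrite -ler_pdivlMl ?expR_gt0// -expRN mulrC => h; apply: le_trans h _.
by rewrite (_ : - (_ - _) = - alp + 3 * theta * bb m + hh i * MM m)//; ring.
Qed.

Let expectation_ge e : 0 < e -> \forall m \near \oo, \forall i \near \oo,
  (\int[P]_w (1 - Phi m i w)%:E <= (1 - expR (- alp) + e)%:E)%E.
Proof.
move=> e0; have [_ _ hc] := limits.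
have lt0 : expR (- alp) - e < expR (- alp) by rewrite ltrBlDr ltrDl.
apply: filterS (cvgr_gt _ (exp_cvg (- (3 * theta))) _ lt0) => m hm.
have c1 : (expR (- (3 * theta * bb m)) - expR (alp - lam * i%:R) - del m i) * expR (- alp) @[i --> \oo] -->
    (expR (- (3 * theta * bb m)) - 0 - 0) * expR (- alp).
  apply: cvgM; last exact: cvg_cst.
  apply: cvgB; last exact: del_cvg.
  apply: cvgB; first exact: cvg_cst.
  have : expR alp * expR (- lam) ^+ i @[i --> \oo] --> expR alp * 0.
    apply: cvgM; first exact: cvg_cst.
    by apply: cvg_expr; rewrite gtr0_norm ?expR_gt0// expR_lt1 oppr_lt0.
  by rewrite mulr0; under eq_fun => i do rewrite -expRM_natl -expRD mulrN [i%:R * lam]mulrC.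
rewrite !subr0 -expRD in c1.
rewrite (_ : - alp + - (3 * theta) * bb m = - (3 * theta * bb m) - alp) in hm; last by ring.
apply: filterS (cvgr_gt _ c1 _ hm) => i hi.
have m1 : measurable_fun [set: Om] (fun w => 1 - Phi m i w) by exact: measurable_funB.
have b01 w : 0 <= 1 - Phi m i w <= 1 by have /andP[a b] := Phi01 m i w; apply/andP; split; lra.
have [-> _] := EFin_integral m1 b01.
have [_ iP] := EFin_integral (mPhi m i) (Phi01 m i).
rewrite lee_fin RintegralB//; last exact: (finite_measure_integrable_cst P 1).
rewrite Rintegral_cst//= probability_setT mulr1 -addrA lerD2l.
have [_] := expectation_bounds m i.
rewrite -ler_pdivrMl ?expR_gt0// -expRN mulrC => h; lra.
Qed.

Let V u w := laplace_exp lam (inv_local_time L u w).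

Let cL := hL.1.

Lemma measurable_laplace_inv u : measurable_fun [set: Om] (V u).
Proof.
apply: (@measurableT_comp _ _ _ _ _ _ (@fine R)); first exact: fine_measurable.
apply: (@measurableT_comp _ _ _ _ _ _ (er_map (fun r => expR (- (lam * r))))); last first.
  exact: measurable_inv_local_time.
have me : measurable_fun [set: R] (fun r : R => expR (- (lam * r))).
  by apply: measurableT_comp => //; apply: measurableT_comp => //; exact: measurable_funM.
exact: (@measurable_er_map _ Om R _ me).
Qed.

Lemma laplace_inv01 u w : 0 <= V u w <= 1.
Proof.
rewrite /V /laplace_exp; have := inv_local_time_ge0 L u w; case: inv_local_time => [r||]//=; rewrite ?lexx ?ler01//.
by rewrite lee_fin => r0; rewrite expR_ge0 expR_le1 oppr_le0 mulr_ge0// ltW.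
Qed.

(** As [alp < theta u], there is by continuity a dyadic time not after the inverse local time at
    which [theta L] already exceeds [alp]. [Phi_ge] applies there, and its discount dominates
    [V]. *)
Lemma laplace_inv_le u : alp < theta * u -> (\int[P]_w (V u w)%:E <= (expR (- alp))%:E)%E.
Proof.
move=> au; apply: (double_fatou mPhi) => //.
- by move=> m i w; case/andP: (Phi01 m i w).
- exact: measurable_laplace_inv.
- by move=> w; case/andP: (laplace_inv01 u w).
apply: filterS ae_good => w gw e e0.
have [Vy|fin] := eqVneq (inv_local_time L u w) +oo%E.
  near=> m; near=> i; rewrite /V /laplace_exp Vy/= sub0r (@le_trans _ _ 0) ?oppr_le0 ?(ltW e0)//.
  by case/andP: (Phi01 m i w).
suff [q [n [hq hV]]] : exists q n, alp < theta * L (q%:R * hh n) w /\ V u w <= expR (- (lam * (q%:R * hh n))).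
  apply: filterS (Phi_ge gw hq) => m; apply: filterS => i hi.
  by apply: le_trans hi; apply: le_trans hV; rewrite gerBl ltW.
rewrite /V /laplace_exp.
case E : (inv_local_time L u w) fin => [z||] //= _.
- have z0 : 0 <= z by rewrite -lee_fin -E inv_local_time_ge0.
  have : (inv_local_time L u w <= z%:E)%E by rewrite E.
  move/(inv_local_time_leP u cL w z0) => [s /andP[s0 sz] us].
  have gap : 0 < L s w - alp / theta.
    by rewrite subr_gt0 ltr_pdivrMr// mulrC (lt_le_trans au)// ler_pM2l.
  have [dl d0 hd] := path_continuity (@cL w) s0 gap.
  have [q [n [qs sq]]] := dyadic_below s0 d0.
  exists q, n; rewrite -/(hh n) in qs sq *; split.
    have q0 : 0 <= q%:R * hh n by rewrite mulr_ge0// ltW.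
    have := hd _ q0; rewrite ler0_norm ?subr_le0// opprB ltrBlDl => /(_ sq).
    by rewrite ltr_norml => /andP[hl _]; rewrite [ltRHS]mulrC -ltr_pdivrMr//; lra.
  by rewrite ler_expR lerN2 ler_wpM2l ?(ltW lam0)// (le_trans qs).
- by have := inv_local_time_ge0 L u w; rewrite E.
Unshelve. all: by end_near. Qed.

(** Fatou is one-sided, so it is applied to [1 - Phi]. At a dyadic time before the inverse local
    time [theta L] is below [alp] and [Phi_le] applies; such times are taken close to it, or large
    when it is infinite. *)
Lemma laplace_inv_ge u : theta * u < alp -> (\int[P]_w (1 - V u w)%:E <= (1 - expR (- alp))%:E)%E.
Proof.
move=> au; apply: (@double_fatou _ _ _ _ (fun m i w => 1 - Phi m i w)) => //.
- by move=> m i; apply: measurable_funB.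
- by move=> m i w; rewrite subr_ge0; case/andP: (Phi01 m i w).
- by apply: measurable_funB => //; exact: measurable_laplace_inv.
- by move=> w; rewrite subr_ge0; case/andP: (laplace_inv01 u w).
apply: filterS ae_good => w gw e e0.
have below (q n : nat) : ~ (inv_local_time L u w <= (q%:R * hh n)%:E)%E ->
    expR (- (lam * (q%:R * hh n))) <= V u w + e ->
    \forall m \near \oo, \forall i \near \oo, 1 - V u w - e <= 1 - Phi m i w.
  move=> nq hV.
  have q0 : 0 <= q%:R * hh n by rewrite mulr_ge0// ltW.
  have Lq : theta * L (q%:R * hh n) w < alp.
    apply: le_lt_trans au; rewrite ler_pM2l// leNgt; apply/negP => uL; apply: nq.
    by apply/(inv_local_time_leP u cL w q0); exists (q%:R * hh n); rewrite ?q0 ?lexx// ltW.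
  apply: filterS (Phi_le gw Lq) => m; apply: filterS => i hi; lra.
have [|z0] := leP (inv_local_time L u w) 0%E.
  move=> z0; near=> m; near=> i.
  have -> : V u w = 1.
    rewrite /V /laplace_exp (_ : inv_local_time L u w = 0%E) /=; first by rewrite mulr0 oppr0 expR0.
    by apply/eqP; rewrite eq_le z0 inv_local_time_ge0.
  by have /andP[? ?] := Phi01 m i w; lra.
have VE : V u w = laplace_exp lam (inv_local_time L u w) by [].
move: VE below z0; move: (V u w) => v; case: (inv_local_time L u w) => [z||] // ->; rewrite /laplace_exp/= => below; rewrite ?lte_fin => z0.
- have cz : expR (- (lam * s)) @[s --> z] --> expR (- (lam * z)).
    apply: continuous_cvg; first exact: continuous_expR.
    by apply: cvgN; apply: cvgM; [exact: cvg_cst|exact: cvg_id].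
  have lt0 : expR (- (lam * z)) < expR (- (lam * z)) + e by rewrite ltrDl.
  have near_z : \forall s \near z, expR (- (lam * s)) < expR (- (lam * z)) + e by apply: (cvgr_lt _ cz).
  move/nbhs_ballP : near_z => [dl /= d0 hd].
  have d2 : 0 < dl / 2 by rewrite divr_gt0.
  have s0 : 0 <= Num.max 0 (z - dl / 2) by rewrite le_max lexx.
  have [q [n [qs sq]]] := dyadic_below s0 d2.
  have sz : Num.max 0 (z - dl / 2) < z by rewrite gt_max z0 ltrBlDr ltrDl.
  apply: (below q n).
    by rewrite lee_fin; apply/negP; rewrite -ltNge; exact: le_lt_trans qs sz.
  apply/ltW/hd; rewrite /ball/= ger0_norm ?subr_ge0; last by rewrite ltW// (le_lt_trans qs).
  have : z - dl / 2 <= Num.max 0 (z - dl / 2) by rewrite le_max lexx orbT.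
  by rewrite /hh; lra.
- pose q := (Num.trunc (lam * e)^-1).+1.
  apply: (below q 0); first by [].
  have le0 : 0 < lam * e by rewrite mulr_gt0.
  rewrite add0r /hh expr0 mulr1 expRN invf_ple ?posrE ?expR_gt0//.
  apply: le_trans (expR_ge1Dx _); apply: (@le_trans _ _ (lam * q%:R)); last by rewrite lerDr.
  by rewrite -ler_pdivrMl// -invfM ltW// truncnS_gt.
Unshelve. all: by end_near. Qed.

End crossing_limits.

(** The level [alp] is free on either side of [theta u]; letting it tend to [theta u] closes the gap
    between the two one-sided bounds. *)
Lemma brownian_laplace u : 0 < u ->
  (\int[P]_w (laplace_exp lam (inv_local_time L u w))%:E = (expR (- (theta * u)))%:E)%E.
Proof.
move=> u0; have [K hK] := kernels.
have tu : 0 < theta * u by rewrite mulr_gt0.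
set V := fun w => laplace_exp lam (inv_local_time L u w).
have mV : measurable_fun [set: Om] V by exact: measurable_laplace_inv.
have V01 w : 0 <= V w <= 1 by exact: laplace_inv01.
have [EV iV] := EFin_integral mV V01.
have mV1 : measurable_fun [set: Om] (fun w => 1 - V w) by exact: measurable_funB.
have V101 w : 0 <= 1 - V w <= 1 by have /andP[? ?] := V01 w; apply/andP; split; lra.
have [EV1 iV1] := EFin_integral mV1 V101.
rewrite -/(V _) EV; congr (_%:E); set I := \int[P]_w V w.
have upper a : 0 < a -> a < theta * u -> I <= expR (- a).
  by move=> a0 au; rewrite -lee_fin -EV; exact: (laplace_inv_le hK a0 au).
have lower a : theta * u < a -> expR (- a) <= I.
  move=> au; have a0 : 0 < a by exact: lt_trans au.
  have := laplace_inv_ge hK a0 au.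
  have -> : (\int[P]_w (1 - laplace_exp lam (inv_local_time L u w))%:E = (1 - I)%:E)%E.
    rewrite -[LHS]/(\int[P]_w (1 - V w)%:E)%E EV1.
    rewrite RintegralB//; last exact: (finite_measure_integrable_cst P 1).
    by rewrite Rintegral_cst//= probability_setT mulr1.
  by rewrite lee_fin; lra.
have I0 : 0 < I by apply: lt_le_trans (expR_gt0 _) (lower (theta * u + 1) _); rewrite ltrDl.
apply/eqP; rewrite eq_le; apply/andP; split; rewrite leNgt; apply/negP.
  move=> h; pose y := - ln I.
  have yI : expR (- y) = I by rewrite opprK lnK.
  have yu : y < theta * u by rewrite -ltrN2 -ltr_expR yI.
  pose a := (Num.max 0 y + theta * u) / 2.
  have m1 : Num.max 0 y < theta * u by rewrite gt_max tu.
  have m2 : 0 <= Num.max 0 y by rewrite le_max lexx.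
  have m3 : y <= Num.max 0 y by rewrite le_max lexx orbT.
  have a0 : 0 < a by rewrite /a; lra.
  have au : a < theta * u by rewrite /a; lra.
  have := upper a a0 au; rewrite -yI ler_expR lerN2 /a; lra.
move=> h; pose y := - ln I.
have yI : expR (- y) = I by rewrite opprK lnK.
have yu : theta * u < y by rewrite -ltrN2 -ltr_expR yI.
have := lower ((y + theta * u) / 2); rewrite -yI ler_expR lerN2 => hh'.
have : y <= (y + theta * u) / 2 by apply: hh'; lra.
lra.
Qed.

End brownian_inverse_local_time.

(** * Convergence in law from Laplace transforms *)

Section bernstein.
Context {R : realType}.

(* bern n a v is the probability that a binomial (n, v) variable is at least n a. *)
Definition bern (n : nat) (a v : R) : R :=
  \sum_(k < n.+1 | n%:R * a <= k%:R) 'C(n, k)%:R * v ^+ k * (1 - v) ^+ (n - k).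

Let w (n : nat) (v : R) (k : nat) : R := 'C(n, k)%:R * v ^+ k * (1 - v) ^+ (n - k).

Let sum_w n v : \sum_(k < n.+1) w n v k = 1.
Proof.
rewrite -[RHS](expr1n _ n) -(subrK v 1) exprDn; apply: eq_bigr => k _.
by rewrite /w -mulr_natl; ring.
Qed.

Let sum_w1 n v : \sum_(k < n.+1) k%:R * w n v k = n%:R * v.
Proof.
case: n => [|n]; first by rewrite big_ord_recl big_ord0 !mul0r addr0.
rewrite big_ord_recl mul0r add0r.
transitivity (n.+1%:R * v * \sum_(k < n.+1) w n v k); last by rewrite sum_w mulr1.
rewrite mulr_sumr; apply: eq_bigr => k _; rewrite /w lift0 subSS exprS.
have : n.+1%:R * 'C(n, k)%:R = k.+1%:R * 'C(n.+1, k.+1)%:R :> R by rewrite -!natrM mul_bin_diag.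
set x := 'C(n, k)%:R; set y := 'C(n.+1, _)%:R => e.
transitivity (k.+1%:R * y * v * v ^+ k * (1 - v) ^+ (n - k)); first by ring.
by rewrite -e; ring.
Qed.

Let sum_w2 n v : \sum_(k < n.+1) (k%:R * (k%:R - 1)) * w n v k = n%:R * (n%:R - 1) * v ^+ 2.
Proof.
case: n => [|n]; first by rewrite big_ord_recl big_ord0 !mul0r addr0.
rewrite big_ord_recl !mul0r add0r.
transitivity (n.+1%:R * v * \sum_(k < n.+1) k%:R * w n v k); last first.
  by rewrite sum_w1 -natr1; ring.
rewrite mulr_sumr; apply: eq_bigr => k _; rewrite /w lift0 subSS exprS.
have : n.+1%:R * 'C(n, k)%:R = k.+1%:R * 'C(n.+1, k.+1)%:R :> R by rewrite -!natrM mul_bin_diag.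
set x := 'C(n, k)%:R; set y := 'C(n.+1, _)%:R => e.
transitivity (k.+1%:R * y * k%:R * v * v ^+ k * (1 - v) ^+ (n - k)); first by rewrite -natr1; ring.
by rewrite -e; ring.
Qed.

Let variance n v : \sum_(k < n.+1) (k%:R - n%:R * v) ^+ 2 * w n v k = n%:R * v * (1 - v).
Proof.
transitivity (\sum_(k < n.+1) ((k%:R * (k%:R - 1)) * w n v k + (1 - 2 * (n%:R * v)) * (k%:R * w n v k)
   + (n%:R * v) ^+ 2 * w n v k)).
  by apply: eq_bigr => k _; ring.
by rewrite !big_split/= -!mulr_sumr sum_w sum_w1 sum_w2; ring.
Qed.

Let w_ge0 n v k : 0 <= v <= 1 -> 0 <= w n v k.
Proof. by move=> /andP[v0 v1]; rewrite !mulr_ge0 ?exprn_ge0// subr_ge0. Qed.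

(** The bound is uniform in [v] because [v (1 - v) <= 1 / 4]. *)
Let chebyshev n v (del : R) (p : pred nat) : 0 <= v <= 1 -> 0 < del ->
  (forall k : nat, p k -> n.+1%:R * del <= `|k%:R - n.+1%:R * v|) ->
  \sum_(k < n.+2 | p k) w n.+1 v k <= (4 * n.+1%:R * del ^+ 2)^-1.
Proof.
move=> v01 d0 hp.
have q0 : 0 < (n.+1%:R * del) ^+ 2 by rewrite exprn_gt0// mulr_gt0.
have h1 : (n.+1%:R * del) ^+ 2 * \sum_(k < n.+2 | p k) w n.+1 v k <= n.+1%:R * v * (1 - v).
  rewrite -variance mulr_sumr [leRHS](bigID (fun k : 'I_n.+2 => p k))/=.
  apply: ler_wpDr; first by apply: sumr_ge0 => k _; rewrite mulr_ge0 ?sqr_ge0 ?w_ge0.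
  apply: ler_sum => k pk; rewrite ler_wpM2r ?w_ge0//.
  by rewrite -[leRHS]real_normK ?num_real// lerXn2r ?nnegrE ?mulr_ge0 ?(ltW d0)// hp.
have h2 : v * (1 - v) <= 4^-1 by have := sqr_ge0 (v - 2^-1); lra.
rewrite -(ler_pM2l q0); apply: le_trans h1 _.
rewrite (_ : (n.+1%:R * del) ^+ 2 * _ = n.+1%:R * 4^-1); first by rewrite -mulrA ler_wpM2l.
by field; rewrite gt_eqF//= nat1r pnatr_eq0.
Qed.

Lemma bern_ge0 n a v : 0 <= v <= 1 -> 0 <= bern n a v.
Proof. by move=> v01; apply: sumr_ge0 => k _; exact: w_ge0. Qed.

Lemma bern_low n a v del : 0 <= v <= 1 -> 0 < del -> v < a - del ->
  bern n.+1 a v <= (4 * n.+1%:R * del ^+ 2)^-1.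
Proof.
move=> v01 d0 va; apply: (chebyshev (p := fun k => n.+1%:R * a <= k%:R)) => // k ka.
have n0 : 0 < n.+1%:R :> R by rewrite ltr0n.
apply: le_trans (ler_norm _); apply: (@le_trans _ _ (n.+1%:R * a - n.+1%:R * v)); last by lra.
by rewrite -mulrBr ler_pM2l//; lra.
Qed.

Lemma bern_high n a v del : 0 <= v <= 1 -> 0 < del -> a + del <= v ->
  1 - (4 * n.+1%:R * del ^+ 2)^-1 <= bern n.+1 a v.
Proof.
move=> v01 d0 va; rewrite lerBlDr -[leLHS](sum_w n.+1 v) (bigID (fun k : 'I_n.+2 => n.+1%:R * a <= k%:R))/=.
rewrite lerD2l; apply: (chebyshev (p := fun k => ~~ (n.+1%:R * a <= k%:R))) => // k; rewrite -ltNge => ka.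
have n0 : 0 < n.+1%:R :> R by rewrite ltr0n.
rewrite distrC; apply: le_trans (ler_norm _); apply: (@le_trans _ _ (n.+1%:R * v - n.+1%:R * a)); last by lra.
by rewrite -mulrBr ler_pM2l//; lra.
Qed.

Lemma bern_le1 n a v : 0 <= v <= 1 -> bern n a v <= 1.
Proof.
move=> v01; rewrite -[leRHS](sum_w n v) [leRHS](bigID (fun k : 'I_n.+1 => n%:R * a <= k%:R))/=.
by rewrite lerDl; apply: sumr_ge0 => k _; exact: w_ge0.
Qed.

Lemma bern_poly n a : exists p : {poly R}, forall v, bern n a v = p.[v].
Proof.
exists (\sum_(k < n.+1 | n%:R * a <= k%:R) 'C(n, k)%:R *: ('X^k * (1 - 'X) ^+ (n - k))) => v.
by rewrite horner_sum; apply: eq_bigr => k _; rewrite !hornerE/= -mulrA.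
Qed.

End bernstein.

Section moments.
Context {R : realType}.

Lemma integrable01 d (T : measurableType d) (P : probability T R) (V : T -> R) :
  measurable_fun [set: T] V -> (forall w, 0 <= V w <= 1) -> P.-integrable [set: T] (EFin \o V).
Proof.
move=> mV V01; apply: measurable_bounded_integrable => //.
  exact: (le_lt_trans (probability_le1 P measurableT) (ltry 1)).
exists 1; split => // M' M1 w _ /=; have /andP[? ?] := V01 w.
by rewrite ger0_norm// (le_trans _ (ltW M1)).
Qed.

Lemma Rintegral_poly d (T : measurableType d) (P : probability T R) (V : T -> R) (p : {poly R}) :
  measurable_fun [set: T] V -> (forall w, 0 <= V w <= 1) ->
  \int[P]_w p.[V w] = \sum_(i < size p) p`_i * \int[P]_w V w ^+ i.
Proof.
move=> mV V01.
have iX i : P.-integrable [set: T] (EFin \o (fun w => V w ^+ i)).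
  apply: integrable01; first exact: measurable_funX.
  by move=> w; have /andP[? ?] := V01 w; rewrite exprn_ge0 ?exprn_ile1.
have iS n : P.-integrable [set: T] (EFin \o (fun w => \sum_(i < n) p`_i * V w ^+ i)) /\
  \int[P]_w (\sum_(i < n) p`_i * V w ^+ i) = \sum_(i < n) p`_i * \int[P]_w V w ^+ i.
  elim: n => [|n [IH1 IH2]].
    under eq_fun do rewrite big_ord0; rewrite big_ord0.
    split; first exact: (finite_measure_integrable_cst P 0).
    by rewrite Rintegral_cst// mul0r.
  have i1 : P.-integrable [set: T] (EFin \o (fun w => p`_n * V w ^+ n)).
    by rewrite (_ : EFin \o _ = fun w => (p`_n)%:E * (V w ^+ n)%:E)%E//; apply: integrableZl => //; exact: iX.
  under eq_fun do rewrite big_ord_recr/=; rewrite big_ord_recr/=.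
  split; first exact: (integrableD _ IH1 i1).
  by rewrite RintegralD// IH2 RintegralZl//; exact: iX.
have [_ <-] := iS (size p).
by apply: eq_Rintegral => w _; rewrite horner_coef.
Qed.

(** [bern n.+1 a] is a polynomial substitute for the step at [a], blurred over a width [del], so its
    mean lies between two shifted tails up to the Chebyshev error. *)
Lemma bern_tail_le d (T : measurableType d) (P : probability T R) (V : T -> R) n a del :
  measurable_fun [set: T] V -> (forall w, 0 <= V w <= 1) -> 0 < del ->
  (P [set w | (a + del <= V w)%R] <= (\int[P]_w bern n.+1 a (V w) + (4 * n.+1%:R * del ^+ 2)^-1)%:E)%E /\
  ((\int[P]_w bern n.+1 a (V w))%:E <= P [set w | (a - del <= V w)%R] + ((4 * n.+1%:R * del ^+ 2)^-1)%:E)%E.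
Proof.
move=> mV V01 d0; set c := (4 * _ * _)^-1.
have c0 : 0 <= c by rewrite invr_ge0 mulr_ge0// sqr_ge0.
have mge b : measurable [set w | (b <= V w)%R].
  rewrite (_ : [set w | _] = V @^-1` `[b, +oo[%classic); first by rewrite -[X in measurable X]setTI; exact: mV.
  by apply/seteqP; split => w /=; rewrite in_itv/= andbT.
have ind b : (\int[P]_w (\1_[set w | (b <= V w)%R] w : R))%:E = P [set w | (b <= V w)%R].
  by rewrite /Rintegral integral_indic// setIT fineK// fin_num_measure.
have [p pE] := bern_poly n.+1 a.
have mb : measurable_fun [set: T] (fun w => bern n.+1 a (V w)).
  under eq_fun do rewrite /bern big_mkcond/=.
  apply: (@measurable_sum _ T R setT 'I_n.+2 _ (fun k w => if n.+1%:R * a <= k%:R then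
    'C(n.+1, k)%:R * V w ^+ k * (1 - V w) ^+ (n.+1 - k) else 0)) => k.
  case: (boolP (n.+1%:R * a <= k%:R)) => _; last exact: measurable_cst.
  apply: measurable_funM; last by apply: measurable_funX; exact: measurable_funB.
  by apply: measurable_funM => //; exact: measurable_funX.
have b01 w : 0 <= bern n.+1 a (V w) <= 1 by rewrite bern_ge0// bern_le1.
have ib := integrable01 P mb b01.
have iind b : P.-integrable [set: T] (EFin \o (\1_[set w | (b <= V w)%R] : T -> R)).
  apply: integrable01; first exact: measurable_indic.
  by move=> w; rewrite indicE; case: (_ \in _); rewrite ?lexx ?ler01.
have ic : P.-integrable [set: T] (EFin \o (fun=> c)) by exact: finite_measure_integrable_cst.
have Rc : \int[P]_w c = c by rewrite Rintegral_cst//= probability_setT mulr1.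
rewrite -!ind -EFinD !lee_fin; split.
  rewrite -[in leRHS]Rc -RintegralD//; apply: le_Rintegral => //; first exact: (integrableD _ ib ic).
  move=> w _; rewrite indicE; have [|] := boolP (w \in _).
    by rewrite inE/= => /(bern_high n (V01 w) d0); rewrite -/c lerBlDr.
  by move=> _; rewrite addr_ge0// bern_ge0.
rewrite -[in leRHS]Rc -RintegralD//; apply: le_Rintegral => //; first exact: (integrableD _ (iind _) ic).
move=> w _; rewrite indicE; have [|] := boolP (w \in _).
  by move=> _; apply: ler_wpDr => //; exact: bern_le1.
rewrite notin_setE/= => /negP; rewrite -ltNge add0r => h.
exact: bern_low.
Qed.

Lemma moments_tail (dsp : nat -> measure_display) (Om : forall N, measurableType (dsp N))
    (P : forall N, probability (Om N) R) (V : forall N, Om N -> R)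
    (dsp' : measure_display) (Om' : measurableType dsp') (P' : probability Om' R) (W : Om' -> R) (a : R) :
  (\forall N \near \oo, measurable_fun [set: Om N] (V N) /\ forall w, 0 <= V N w <= 1) ->
  measurable_fun [set: Om'] W -> (forall w, 0 <= W w <= 1) ->
  (forall j, (0 < j)%N -> (\int[P N]_w V N w ^+ j) @[N --> \oo] --> \int[P']_w W w ^+ j) ->
  forall e, 0 < e -> \forall N \near \oo,
  (P N [set w | (a <= V N w)%R] <= P' [set w | (a - e <= W w)%R] + e%:E)%E /\
  (P' [set w | (a + e <= W w)%R] <= P N [set w | (a <= V N w)%R] + e%:E)%E.
Proof.
(* Two blurs of width [e / 2] add up to the shift [e]. The two Chebyshev errors and the error in the
   means take at most [e / 4] each. *)
move=> HV mW W01 mom e e0; pose del := e / 2.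
have d0 : 0 < del by rewrite divr_gt0.
pose n := Num.trunc (del ^+ 2 * e)^-1; set c : R := (4 * n.+1%:R * del ^+ 2)^-1.
have cE : c <= e / 4.
  have de : 0 < del ^+ 2 * e by rewrite mulr_gt0// exprn_gt0.
  have dd : 0 < del ^+ 2 by rewrite exprn_gt0.
  rewrite -[leRHS]invrK lef_pV2 ?posrE ?invr_gt0 ?mulr_gt0 ?divr_gt0//.
  have hn : 1 <= n.+1%:R * (del ^+ 2 * e) by rewrite -ler_pdivrMr// div1r ltW// truncnS_gt.
  rewrite invf_div ler_pdivrMr// (_ : 4 * _ * _ * e = 4 * (n.+1%:R * (del ^+ 2 * e))); last by ring.
  by rewrite ler_peMr.
have cvgT a' : (\int[P N]_w bern n.+1 a' (V N w)) @[N --> \oo] --> \int[P']_w bern n.+1 a' (W w).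
  have [p pE] := bern_poly (R := R) n.+1 a'.
  have : (\sum_(i < size p) p`_i * \int[P N]_w V N w ^+ i) @[N --> \oo] -->
      \sum_(i < size p) p`_i * \int[P']_w W w ^+ i.
    have ci (i : nat) : p`_i * (\int[P N]_w V N w ^+ i) @[N --> \oo] --> p`_i * \int[P']_w W w ^+ i; last first.
      elim: (size p) => [|m IH].
        by under eq_cvg do rewrite big_ord0; rewrite big_ord0; exact: cvg_cst.
      under eq_cvg do rewrite big_ord_recr/=; rewrite big_ord_recr/=.
      exact: (cvgD IH (ci m)).
    apply: cvgM; first exact: cvg_cst.
    case: (posnP i) => [->|/mom//].
    have one d (T : measurableType d) (Q : probability T R) (X : T -> R) : \int[Q]_w X w ^+ 0 = 1.
      rewrite (_ : (fun w => _) = cst 1); last by apply/funext => w; rewrite expr0.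
      by rewrite Rintegral_cst//= probability_setT mulr1.
    rewrite (_ : (fun N => \int[P N]_w V N w ^+ 0) = fun=> 1); first by rewrite one; exact: cvg_cst.
    by apply/funext => N; exact: one.
  under eq_Rintegral do rewrite pE; rewrite Rintegral_poly//.
  apply: cvg_trans; apply: near_eq_cvg; apply: filterS HV => N [mV V01].
  by under [RHS]eq_Rintegral do rewrite pE; rewrite Rintegral_poly.
have e4 : 0 < e / 4 by rewrite divr_gt0.
have /cvgrPdist_le/(_ _ e4) n1 := cvgT (a - del).
have /cvgrPdist_le/(_ _ e4) n2 := cvgT (a + del).
near=> N.
have [mV V01] : measurable_fun [set: Om N] (V N) /\ forall w, 0 <= V N w <= 1 by near: N.
split.
- have [h1 _] := bern_tail_le (P N) n (a - del) mV V01 d0.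
  have [_ h2] := bern_tail_le P' n (a - del) mW W01 d0.
  rewrite subrK in h1; rewrite -addrA -opprD (_ : del + del = e) in h2; last by rewrite /del; field.
  apply: le_trans h1 _; apply: le_trans (leeD2r e%:E (_ : (_%:E <= _)%E)); last first.
    by rewrite -leeBlDr// in h2; exact: h2.
  rewrite -EFinD lee_fin -/c.
  have : `|\int[P']_w bern n.+1 (a - del) (W w) - \int[P N]_w bern n.+1 (a - del) (V N w)| <= e / 4 by near: N.
  by rewrite ler_norml => /andP[? ?]; lra.
- have [h1 _] := bern_tail_le P' n (a + del) mW W01 d0.
  have [_ h2] := bern_tail_le (P N) n (a + del) mV V01 d0.
  rewrite addrK in h2; rewrite -addrA (_ : del + del = e) in h1; last by rewrite /del; field.
  apply: le_trans h1 _; apply: le_trans (leeD2r e%:E (_ : (_%:E <= _)%E)); last first.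
    by rewrite -leeBlDr// in h2; exact: h2.
  rewrite -EFinD lee_fin -/c.
  have : `|\int[P']_w bern n.+1 (a + del) (W w) - \int[P N]_w bern n.+1 (a + del) (V N w)| <= e / 4 by near: N.
  by rewrite ler_norml => /andP[? ?]; lra.
Unshelve. all: by end_near. Qed.

(** Moments of [exp (- Y)] are transforms at integers. Positivity of [j] matters at [+oo], where the
    left side is a power of 0. *)
Lemma laplace_expX j (y : \bar R) : (0 < j)%N -> laplace_exp 1 y ^+ j = laplace_exp j%:R y.
Proof.
move=> j0; rewrite /laplace_exp; case: y => [r||] /=; rewrite ?expr0n ?gtn_eqF//.
by rewrite -expRM_natl mul1r mulrN.
Qed.

Lemma laplace_exp01 lam (y : \bar R) : 0 < lam -> (0 <= y)%E -> 0 <= laplace_exp lam y <= 1.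
Proof.
move=> l0; rewrite /laplace_exp; case: y => [r||] //=; rewrite ?lexx ?ler01// lee_fin => r0.
by rewrite expR_ge0 expR_le1 oppr_le0 mulr_ge0// ltW.
Qed.

Lemma laplace_exp_ge (z : R) (y : \bar R) : (0 <= y)%E -> (expR (- z) <= laplace_exp 1 y) = (y <= z%:E)%E.
Proof.
rewrite /laplace_exp; case: y => [r||] //= _; first by rewrite ler_expR lerN2 mul1r lee_fin.
by rewrite leNgt expR_gt0 leye_eq.
Qed.

Lemma measurable_laplace_exp d (T : measurableType d) lam (Y : T -> \bar R) :
  measurable_fun [set: T] Y -> measurable_fun [set: T] (fun w => laplace_exp lam (Y w)).
Proof.
move=> mY; apply: (@measurableT_comp _ _ _ _ _ _ (@fine R)); first exact: fine_measurable.
apply: (@measurableT_comp _ _ _ _ _ _ (er_map (fun r => expR (- (lam * r))))); last exact: mY.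
have me : measurable_fun [set: R] (fun r : R => expR (- (lam * r))).
  by apply: measurableT_comp => //; apply: measurableT_comp => //; exact: measurable_funM.
exact: (@measurable_er_map _ T R _ me).
Qed.

Lemma laplace_cvg_in_law (dsp : nat -> measure_display) (Om : forall N, measurableType (dsp N))
    (P : forall N, probability (Om N) R) (Y : forall N, Om N -> \bar R)
    (dsp' : measure_display) (Om' : measurableType dsp') (P' : probability Om' R) (Z : Om' -> \bar R) :
  (\forall N \near \oo, measurable_fun [set: Om N] (Y N) /\ forall w, (0 <= Y N w)%E) ->
  measurable_fun [set: Om'] Z -> (forall w, (0 <= Z w)%E) ->
  (forall j, (0 < j)%N -> (\int[P N]_w laplace_exp j%:R (Y N w)) @[N --> \oo] -->
    \int[P']_w laplace_exp j%:R (Z w)) ->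
  cvg_in_law P Y P' Z.
Proof.
move=> HY mZ Z0 lap z cz.
have mZle s : measurable [set w | (Z w <= s%:E)%E].
  by rewrite -[X in measurable X]setTI; apply: emeasurable_fun_infty_c.
have fZ s : P' [set w | (Z w <= s%:E)%E] = (fine (P' [set w | (Z w <= s%:E)%E]))%:E.
  by rewrite fineK// fin_num_measure.
have fc : fine (P' [set w | (Z w <= s%:E)%E]) @[s --> z] --> fine (P' [set w | (Z w <= z%:E)%E]).
  have : P' [set w | (Z w <= s%:E)%E] @[s --> z] --> (fine (P' [set w | (Z w <= z%:E)%E]))%:E.
    by rewrite -fZ; exact: cz.
  by case/fine_cvgP.
rewrite fZ; apply/fine_cvgP; split.
  apply: filterS HY => N [mY _]; rewrite fin_num_measure//.
  by rewrite -[X in measurable X]setTI; apply: emeasurable_fun_infty_c.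
apply/cvgrPdist_le => e e0.
have e2 : 0 < e / 2 by rewrite divr_gt0.
have /cvgrPdist_le/(_ _ e2) := fc; move=> /nbhs_ballP[dl /= d0 hd].
have dl2 : 0 < dl / 2 by rewrite divr_gt0.
pose a := expR (- z).
(* Small enough for [a - eta] and [a + eta] to stay between the exponentials at [z + dl / 2] and
   [z - dl / 2], where continuity of the limit at [z] is used. *)
pose eta := Num.min (e / 2) (Num.min (a - expR (- (z + dl / 2))) (expR (- (z - dl / 2)) - a)).
have eta0 : 0 < eta by rewrite !lt_min e2 !subr_gt0 !ltr_expR/=; apply/andP; split; lra.
have V01 : \forall N \near \oo, measurable_fun [set: Om N] (fun w => laplace_exp 1 (Y N w)) /\
    forall w, 0 <= laplace_exp 1 (Y N w) <= 1.
  apply: filterS HY => N [mY Y0]; split; first exact: measurable_laplace_exp.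
  by move=> w; exact: laplace_exp01.
have W01 w : 0 <= laplace_exp 1 (Z w) <= 1 by exact: laplace_exp01.
have mom j : (0 < j)%N -> (\int[P N]_w laplace_exp 1 (Y N w) ^+ j) @[N --> \oo] --> \int[P']_w laplace_exp 1 (Z w) ^+ j.
  move=> j0; have := lap j j0.
  under eq_Rintegral do rewrite -laplace_expX//.
  by under eq_cvg do under eq_Rintegral do rewrite -laplace_expX//.
have := moments_tail a V01 (measurable_laplace_exp 1 mZ) W01 mom eta0.
move=> near_t; near=> N.
have [mY Y0] : measurable_fun [set: Om N] (Y N) /\ forall w, (0 <= Y N w)%E by near: N.
have [] : (P N [set w | (a <= laplace_exp 1 (Y N w))%R] <= P' [set w | (a - eta <= laplace_exp 1 (Z w))%R] + eta%:E)%E /\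
  (P' [set w | (a + eta <= laplace_exp 1 (Z w))%R] <= P N [set w | (a <= laplace_exp 1 (Y N w))%R] + eta%:E)%E by near: N.
have -> : [set w | (a <= laplace_exp 1 (Y N w))%R] = [set w | (Y N w <= z%:E)%E].
  by apply/seteqP; split => w /=; rewrite laplace_exp_ge.
have mYle : measurable [set w | (Y N w <= z%:E)%E].
  by rewrite -[X in measurable X]setTI; apply: emeasurable_fun_infty_c.
have fY : P N [set w | (Y N w <= z%:E)%E] = (fine (P N [set w | (Y N w <= z%:E)%E]))%:E.
  by rewrite fineK// fin_num_measure.
have mW b : measurable [set w | (b <= laplace_exp 1 (Z w))%R].
  rewrite (_ : [set w | _] = (fun w => laplace_exp 1 (Z w)) @^-1` `[b, +oo[%classic).
    by rewrite -[X in measurable X]setTI; exact: measurable_laplace_exp.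
  by apply/seteqP; split => w /=; rewrite in_itv/= andbT.
have up : (P' [set w | (a - eta <= laplace_exp 1 (Z w))%R] <= P' [set w | (Z w <= (z + dl / 2)%:E)%E])%E.
  apply: le_measure; rewrite ?inE// => w /= h; rewrite -laplace_exp_ge//; apply: le_trans h.
  have : eta <= a - expR (- (z + dl / 2)) by rewrite /eta !ge_min lexx !orbT.
  lra.
have dn : (P' [set w | (Z w <= (z - dl / 2)%:E)%E] <= P' [set w | (a + eta <= laplace_exp 1 (Z w))%R])%E.
  apply: le_measure; rewrite ?inE// => w /=; rewrite -laplace_exp_ge// => h; apply: le_trans h.
  have : eta <= expR (- (z - dl / 2)) - a by rewrite /eta !ge_min lexx !orbT.
  lra.
move=> h1 h2.
have {h1} := le_trans h1 (leeD2r eta%:E up); rewrite fY fZ -EFinD lee_fin => h1.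
have {h2} := le_trans dn h2; rewrite fY fZ -EFinD lee_fin => h2.
have eta2 : eta <= e / 2 by rewrite /eta ge_min lexx.
have := hd (z + dl / 2); rewrite /ball/= opprD addrA subrr add0r normrN gtr0_norm// => /(_ _).
have := hd (z - dl / 2); rewrite /ball/= opprB addrC subrK gtr0_norm// => /(_ _).
have dl3 : dl / 2 < dl by lra.
move=> /(_ dl3); rewrite ler_norml => /andP[b1 b2] /(_ dl3); rewrite ler_norml => /andP[c1 c2].
rewrite ler_norml /=; apply/andP; split; lra.
Unshelve. all: by end_near. Qed.

End moments.

(** * Conclusion *)

Section cover_time_laplace.
Context {R : realType} {G : zmodType} {I : finType} (st : I -> G).
Context {dsp : measure_display} {Om : measurableType dsp} (P : probability Om R).
Context (X : nat -> Om -> G) (mu : G -> R) (A : {fset G}).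
Hypothesis I0 : (0 < #|I|)%N.
Hypothesis hX : is_walk st mu P X.

Let cov n w : Prop := forall y, y \in A -> exists2 j, (j <= n)%N & X j w = y.

Let cover_timeP w :
  (cover_time R X A w = +oo%E /\ forall n, ~ cov n w) \/
  exists2 m, cover_time R X A w = m%:R%:E & forall n, cov n w <-> (m <= n)%N.
Proof.
have [[n0 cn0]|no] := pselect (exists n, cov n w); last first.
  left; have no' n : ~ cov n w by move=> cn; apply: no; exists n.
  split => //; rewrite /cover_time (_ : [set _ | _ in _] = set0) ?ereal_inf0//.
  by apply/seteqP; split => // x [n hn _]; case: (no' n hn).
right; have ex : exists n, `[< cov n w >] by exists n0; apply/asboolP.
have [m /asboolP cm mmin] := ex_minnP ex.
have covE n : cov n w <-> (m <= n)%N.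
  split; first by move=> cn; apply: mmin; apply/asboolP.
  by move=> mn y yA; have [j jm] := cm y yA; exists j => //; exact: leq_trans mn.
exists m => //; apply/eqP; rewrite eq_le; apply/andP; split.
  by apply: ereal_inf_lbound; exists m.
by apply: le_ereal_inf_tmp => _ [n /covE mn <-]; rewrite lee_fin ler_nat.
Qed.

Let measurable_cov n : measurable [set w | cov n w].
Proof.
have := measurable_covered hX A 0 n; rewrite (_ : [set w | _] = [set w | cov n w])//.
by apply/seteqP; split => w /= h y /h; [case=> j [] *; exists j|case=> j *; exists j].
Qed.

Lemma cover_time_ge0 w : (0 <= cover_time R X A w)%E.
Proof. by case: (cover_timeP w) => [[-> _]|[m -> _]]; rewrite ?leey// lee_fin. Qed.

Lemma measurable_cover_time : measurable_fun [set: Om] (cover_time R X A).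
Proof.
move=> _; apply: (measurability _ (ErealGenOInfty.measurableE R)) => //.
move=> _ [_ [z ->] <-]; rewrite setTI.
rewrite (_ : _ @^-1` _ = ~` \bigcup_(n in [set n : nat | n%:R <= z]) [set w | cov n w]).
  by apply: measurableC; apply: bigcup_measurable => n _; exact: measurable_cov.
apply/seteqP; split => w; rewrite /= in_itv/= andbT.
  move=> zC [n /= nz cn]; case: (cover_timeP w) => [[_ /(_ n)]//|[m mE /(_ n) [/(_ cn) mn _]]].
  by move: zC; rewrite mE lte_fin ltNge => /negP; apply; apply: le_trans nz; rewrite ler_nat.
move=> h; case: (cover_timeP w) => [[-> _]|[m mE cm]]; first by rewrite ltry.
rewrite mE lte_fin ltNge; apply/negP => mz; apply: h; exists m => //=.
exact/cm.
Qed.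

Variables (lam k : R).
Hypothesis lam0 : 0 < lam.
Hypothesis k0 : 0 < k.
Let s := expR (- (lam * k)).
Let s01 : 0 <= s < 1. Proof. by rewrite expR_ge0 expR_lt1 oppr_lt0 mulr_gt0. Qed.

Let V w := laplace_exp lam (cover_time R X A w * k%:E).

(** [s ^ m] is the sum of [(1 - s) s ^ i] over [i >= m], and [i >= m] means covered by time [i]. The
    first [n] terms miss at most [s ^ n]. *)
Let partial_sums n w : 0 <= V w - \sum_(i < n) (1 - s) * s ^+ i * \1_[set w | cov i w] w <= s ^+ n.
Proof.
have /andP[s0 s1] := s01.
case: (cover_timeP w) => [[Cy no]|[m Cm cm]].
  rewrite big1; last by move=> i _; rewrite indicE memNset ?mulr0//; exact: no.
  by rewrite /V Cy gt0_mulye ?lte_fin// /laplace_exp/= subr0 lexx exprn_ge0.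
have -> : V w = s ^+ m.
  by rewrite /V Cm -EFinM /laplace_exp/= /s -expRM_natl; congr expR; ring.
have -> : \sum_(i < n) (1 - s) * s ^+ i * (\1_[set w | cov i w] w : R) = if (m <= n)%N then s ^+ m - s ^+ n else 0.
  elim: n => [|n IH]; first by rewrite big_ord0; case: m {Cm cm} => [|m]; rewrite ?subrr.
  rewrite big_ord_recr/= IH indicE; case: (ltngtP m n.+1) => mn.
  - rewrite -ltnS mn mem_set; last by apply/cm; rewrite -ltnS.
    by rewrite mulr1 exprS; ring.
  - by rewrite memNset ?mulr0 ?addr0; [rewrite leqNgt (ltn_trans _ mn)|move/cm; rewrite leqNgt (ltn_trans _ mn)].
  - by rewrite mn ltnn memNset ?mulr0 ?addr0 ?subrr//; move/cm; rewrite mn ltnn.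
case: leqP => mn; first by rewrite subKr exprn_ge0//= lexx.
by rewrite subr0 exprn_ge0//= ler_wiXn2l ?(ltW s1)// ltnW.
Qed.

Lemma integral_laplace_cover_time (S : seq G) : uniq S -> (forall x, x \notin S -> mu x = 0) ->
  \sum_(x <- S) mu x = 1 ->
  \int[P]_w laplace_exp lam (cover_time R X A w * k%:E) = \sum_(x <- S) mu x * coverL st s x A.
Proof.
move=> uS mu0 mu1; have /andP[s0 s1] := s01.
have mV : measurable_fun [set: Om] V.
  apply: measurable_laplace_exp; apply: emeasurable_funM => //; exact: measurable_cover_time.
have V01 w : 0 <= V w <= 1.
  by apply: laplace_exp01 => //; rewrite mule_ge0 ?cover_time_ge0// lee_fin ltW.
have iV := integrable01 P mV V01.
pose p n := \sum_(x <- S) mu x * coverp st n x A.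
have pE n : P [set w | cov n w] = (p n)%:E by exact: (prob_covered I0 hX _ _ uS mu0 mu1).
have p1 n : `|p n| <= 1.
  have : (0 <= (p n)%:E <= 1)%E by rewrite -pE measure_ge0 probability_le1.
  by rewrite !lee_fin => /andP[? ?]; rewrite ger0_norm.
have iI n : P.-integrable [set: Om] (EFin \o (fun w => (1 - s) * s ^+ n * (\1_[set w | cov n w] w : R))).
  apply: integrable01.
    by apply: measurable_funM => //; apply: measurable_indic; exact: measurable_cov.
  move=> w; rewrite indicE; have c0 : 0 <= (1 - s) * s ^+ n by rewrite mulr_ge0 ?exprn_ge0// subr_ge0 ltW.
  case: (_ \in _); rewrite ?mulr0 ?lexx ?ler01// mulr1 c0/=.
  by rewrite mulr_ile1 ?exprn_ge0 ?exprn_ile1 ?subr_ge0 ?(ltW s1)// lerBlDr lerDl.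
have iS n : P.-integrable [set: Om] (EFin \o (fun w => \sum_(i < n) (1 - s) * s ^+ i * (\1_[set w | cov i w] w : R))) /\
    \int[P]_w (\sum_(i < n) (1 - s) * s ^+ i * (\1_[set w | cov i w] w : R)) = (1 - s) * \sum_(0 <= i < n) s ^+ i * p i.
  elim: n => [|n [IH1 IH2]].
    under eq_fun do rewrite big_ord0.
    split; first exact: (finite_measure_integrable_cst P 0).
    by rewrite Rintegral_cst// mul0r big_geq// mulr0.
  under eq_fun do rewrite big_ord_recr/=.
  split; first exact: (integrableD _ IH1 (iI n)).
  rewrite RintegralD// IH2 big_nat_recr//= mulrDr; congr (_ + _).
  rewrite RintegralZl//; last first.
    by apply: integrable01; [apply: measurable_indic; exact: measurable_cov|move=> w; rewrite indicE; case: (_ \in _); rewrite ?lexx ?ler01].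
  by rewrite /Rintegral integral_indic ?setIT//= pE/= mulrA.
rewrite -/(V _) [RHS](_ : _ = (1 - s) * gsum s p); last first.
  rewrite /p (gsum_sum _ (M := \sum_(x <- S) `|mu x|))//; last first.
    move=> x n; case/andP: (coverp01 (R := R) st I0 n x A) => c0 c1; rewrite normrM (ger0_norm c0); apply: le_trans (ler_piMr _ c1) _ => //.
    have [xS|/mu0->] := boolP (x \in S); last by rewrite normr0 sumr_ge0.
    by rewrite (bigD1_seq x)//= lerDl sumr_ge0.
  rewrite mulr_sumr; apply: eq_bigr => x _; rewrite (gsumZ _ (M := 1))//.
    by rewrite /coverL mulrCA.
  by move=> n; case/andP: (coverp01 (R := R) st I0 n x A) => ? ?; rewrite ger0_norm.
have c1 : (1 - s) * \sum_(0 <= i < n) s ^+ i * p i @[n --> \oo] --> (1 - s) * gsum s p.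
  by apply: cvgM; [exact: cvg_cst|exact: gsum_is_cvg p1].
have c2 : (1 - s) * \sum_(0 <= i < n) s ^+ i * p i + s ^+ n @[n --> \oo] --> (1 - s) * gsum s p + 0.
  by apply: cvgD => //; apply: cvg_expr; rewrite ger0_norm.
rewrite addr0 in c2.
apply/eqP; rewrite eq_le; apply/andP; split.
  rewrite -(cvg_lim (@Rhausdorff R) c2); apply: limr_ge; first by apply/cvg_ex; eexists; exact: c2.
  near=> n; have [i1 <-] := iS n.
  have Rc : \int[P]_w (s ^+ n) = s ^+ n by rewrite Rintegral_cst//= probability_setT mulr1.
  rewrite -[X in _ <= _ + X]Rc -RintegralD//; last exact: finite_measure_integrable_cst.
  apply: le_Rintegral => //.
    have ic : P.-integrable [set: Om] (EFin \o (fun=> s ^+ n)) by exact: finite_measure_integrable_cst.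
    exact: (integrableD _ i1 ic).
  by move=> w _; have /andP[_] := partial_sums n w; rewrite lerBlDl.
rewrite -(cvg_lim (@Rhausdorff R) c1); apply: limr_le; first by apply/cvg_ex; eexists; exact: c1.
near=> n; have [i1 <-] := iS n.
apply: le_Rintegral => // w _.
by have /andP[+ _] := partial_sums n w; rewrite subr_ge0.
Unshelve. all: by end_near. Qed.

End cover_time_laplace.

Section uniform_start.
Context {R : realType} (d N : nat).

Definition base_points : seq (cylinder d N) := [seq (t, 0) | t <- enum {: torus d N}].

Lemma base_points_uniq : uniq base_points.
Proof. by rewrite map_inj_uniq ?enum_uniq// => x y [->]. Qed.

Lemma base_pointsP x : (x \in base_points) = (x.2 == 0).
Proof.
apply/mapP/eqP => [[t _ ->]//|]; case: x => t z /= ->.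
by exists t => //; rewrite mem_enum.
Qed.

Lemma unif_base_out x : x \notin base_points -> unif_base R x = 0.
Proof. by rewrite base_pointsP /unif_base => /negbTE ->. Qed.

Lemma unif_base_sum : \sum_(x <- base_points) @unif_base R d N x = 1.
Proof.
rewrite /base_points big_map (eq_bigr (fun=> ((N.-1.+1 ^ d)%N%:R)^-1)); last by move=> t _; rewrite /unif_base eqxx.
rewrite big_enum/= sumr_const card_mx card_ord mul1n -[LHS]mulr_natr mulVf//.
Qed.

End uniform_start.

Theorem corollary2p1 (R : realType) (d : nat) (hd : (2 <= d)%N)
  (* the simple random walk on each cylinder *)
  (dsp : nat -> measure_display) (Om : forall N : nat, measurableType (dsp N))
  (P : forall N : nat, probability (Om N) R)
  (X : forall N : nat, nat -> Om N -> cylinder d N)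
  (hX : forall N : nat, (0 < N)%N ->
     is_walk (@cylinder_step d N) (@unif_base R d N) (P N) (X N))
  (* the sets to be covered *)
  (F : forall N : nat, {fset cylinder d N})
  (hF : forall N : nat, (0 < N)%N -> forall x, x \in F N ->
     - (N%:R / 2) <= (x.2%:~R : R) <= N%:R / 2)
  (hFoo : (fun N : nat => (#|` F N|)%fset) @ \oo --> \oo)
  (* a standard Brownian motion and its local time at zero *)
  (dsp' : measure_display) (Om' : measurableType dsp') (P' : probability Om' R)
  (B L : R -> {RV P' >-> R}) (hB : is_brownian B) (hL : is_local_time0 B L) :
  cvg_in_law P
    (fun N w => (cover_time R (X N) (F N) w *
       (((N%:R ^+ d * ln (#|` F N|)%fset%:R) ^+ 2)^-1)%:E)%E)
    P' (inv_local_time L (fine (green R (0 : 'rV[int]_d.+1)) / Num.sqrt d.+1%:R)).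
Proof.
have d2 : (2 <= d)%N by [].
pose g : R := fine (green R (0 : 'rV[int]_d.+1)).
pose k N : R := ((N%:R ^+ d * ln (#|` F N|)%fset%:R) ^+ 2)^-1.
(* The term [k = 0] of the lazy series is 1. *)
have g0 : 0 < g.
  have := lazy_lattice_sum_le (R := R) d2 1.
  rewrite big_nat1/= eqxx => g1; rewrite -(pmulr_rgt0 g (ltr0n R 2)).
  exact: lt_le_trans g1.
(* Two points make the logarithm in the normalisation positive. *)
have F2 : \forall N \near \oo, (2 <= #|` F N|)%fset%N.
  exact: hFoo (nbhs_infty_ge 2).
have k0 : \forall N \near \oo, 0 < k N.
  near=> N.
  rewrite invr_gt0 exprn_gt0// mulr_gt0//.
    by rewrite exprn_gt0// ltr0n; near: N; exact: nbhs_infty_gt.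
  by rewrite ln_gt0// ltr1n; near: N.
have I0 : (0 < #|{: option 'I_d * bool}|)%N by rewrite card_prod card_bool card_option.
have N0 : \forall N \near \oo, (0 < N)%N by exact: nbhs_infty_gt.
apply: laplace_cvg_in_law.
- near=> N; have Np : (0 < N)%N by near: N.
  have kp : 0 < k N by near: N.
  split.
    by apply: emeasurable_funM => //; exact: measurable_cover_time (hX N Np).
  by move=> w; rewrite mule_ge0 ?lee_fin ?(ltW kp)//; exact: cover_time_ge0.
- exact: measurable_inv_local_time hL.1.
- by move=> w; exact: inv_local_time_ge0.
(* With [theta ^ 2 / 2 = j], the Brownian exponent is the limit in [cover_laplace] at [lam = j]. *)
move=> j j0; pose theta : R := Num.sqrt (2 * j%:R).
have jR : 0 < j%:R :> R by rewrite ltr0n.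
have theta0 : 0 < theta by rewrite sqrtr_gt0 mulr_gt0.
have thetaE : theta ^+ 2 / 2 = j%:R.
  by rewrite sqr_sqrtr ?mulr_ge0// mulrAC divff// mul1r.
have u0 : 0 < g / Num.sqrt d.+1%:R :> R by rewrite divr_gt0// sqrtr_gt0.
have limE : \int[P']_w laplace_exp j%:R (inv_local_time L (g / Num.sqrt d.+1%:R) w) =
    expR (- (theta * (g / Num.sqrt d.+1%:R))).
  by rewrite /Rintegral -thetaE (brownian_laplace hB hL theta0 u0).
rewrite limE; apply/cvgrPdist_le => eps eps0.
have cL := cover_laplace d2 hF hFoo jR eps0.
near=> N; have Np : (0 < N)%N by near: N.
have kp : 0 < k N by near: N.
have cN : forall y : cylinder d N, y.2 = 0 -> `|coverL (@cylinder_step d N) (expR (- (j%:R * k N))) y (F N) - expR (- (theta * (g / Num.sqrt d.+1%:R)))| <= eps.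
  move=> y y2; have : y.2 = 0 by []. move: y {y2}; near: N.
  apply: filterS cL => N h y y2; have := h y y2; rewrite (mulrC theta).
  by rewrite /k.
have -> := integral_laplace_cover_time (F N) I0 (hX N Np) jR kp
  (base_points_uniq d N) (@unif_base_out R d N) (@unif_base_sum R d N).
set e := expR _.
(* Both [e] and [eps] are written as averages against the initial law, of total mass 1, to compare
   term by term. *)
rewrite -[e]mul1r -[X in X * _](@unif_base_sum R d N) mulr_suml -sumrB.
have -> : eps = \sum_(x <- base_points d N) unif_base R x * eps.
  by rewrite -mulr_suml unif_base_sum mul1r.
apply: le_trans (ler_norm_sum _ _ _) _.
rewrite big_seq_cond [leRHS]big_seq_cond; apply: ler_sum => x; rewrite andbT base_pointsP => /eqP x2.
have m0 : 0 <= unif_base R x by rewrite /unif_base; case: ifP => // _; rewrite invr_ge0.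
rewrite -mulrBr normrM ger0_norm// ler_wpM2l// distrC; exact: cN.
Unshelve. all: by end_near. Qed.
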